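(* Let $\mathbb{G}$ be a stratified group, let $\Omega\subset\mathbb{G}$ be open and let $u:\Omega\to\mathbb{R}$ be h-convex. Then for every $x\in\Omega$ we have $$\overline{\mathrm{co}}\big(\nabla_H^\star u(x)\big)=\partial_Hu(x).$$
   Context: Stratified group: $\mathbb{G}=H_1\oplus\cdots\oplus H_\iota$ is a finite dimensional graded vector space with a polynomial group operation given by the Baker-Campbell-Hausdorff formula (so $\mathbb{G}$ is identified with its stratified Lie algebra via exponential coordinates; the unit element is $0$, and the first layer $H_1$ generates the Lie algebra). Dilations: $\delta_r(x)=\sum_jr^jx_{(j)}$ if $x=\sum_jx_{(j)}$, $x_{(j)}\in H_j$. A scalar product $\langle\cdot,\cdot\rangle$ is fixed on $\mathbb{G}$ making the $H_j$ mutually orthogonal; $\pi_1:\mathbb{G}\to H_1$ is the orthogonal projection. A homogeneous distance $d$ is fixed: a continuous metric with $d(ux,uy)=d(x,y)$ and $d(\delta_rx,\delta_ry)=r\,d(x,y)$ for $r>0$; $\|w\|=d(0,w)$. For $h\in H_1$ put $[0,h]=\{th:0\le t\le1\}$ and $x\cdot[0,h]=\{x\delta_th:0\le t\le1\}$. A function $u:\Omega\to\mathbb{R}$ is h-convex if for all $x,y\in\Omega$ with $x^{-1}y\in H_1$ and $x\cdot[0,x^{-1}y]\subset\Omega$ one has $u(x\delta_\lambda(x^{-1}y))\le\lambda u(y)+(1-\lambda)u(x)$ for all $\lambda\in[0,1]$. All h-convex functions are assumed measurable; they are then locally Lipschitz with respect to $d$ (Rickly). The h-subdifferential $\partial_Hu(x)$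 is the set of $p\in H_1$ such that $u(xh)\ge u(x)+\langle p,h\rangle$ whenever $h\in H_1$ and $[0,h]\subset x^{-1}\Omega$. A linear map $L$ on $\mathbb{G}$ is h-linear if $L(x)=L(\pi_1(x))$ for all $x$. $u$ is h-differentiable at $x$ if there is an h-linear $L:\mathbb{G}\to\mathbb{R}$ with $u(xz)=u(x)+L(z)+o(\|z\|)$; then $\nabla_Hu(x)\in H_1$ is the vector representing $L$ (and $\nabla_Hu(x)$ is said to exist). Locally Lipschitz functions are a.e. h-differentiable (Pansu). The h-reachable gradient $\nabla_H^\star u(x)$ is the set of $p\in H_1$ for which there is a sequence $(x_k)$ in $\Omega$ with $x_k\to x$, $\nabla_Hu(x_k)$ exists for all $k$, and $\nabla_Hu(x_k)\to p$. For $E\subset H_1$, $\overline{\mathrm{co}}(E)$ is the closure of the convex hull of $E$ in $H_1$. *)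

(* Defs.v *)
From HB Require Import structures.
From mathcomp Require Import all_boot all_order all_algebra.
From mathcomp Require Import all_classical all_reals all_analysis.

Set Implicit Arguments.
Unset Strict Implicit.
Unset Printing Implicit Defensive.

Import Order.TTheory GRing.Theory Num.Theory.
Import numFieldNormedType.Exports.

Local Open Scope classical_set_scope.
Local Open Scope ring_scope.

Section BakerCampbellHausdorff.
Variables (R : realType) (V : lmodType R) (bracket : V -> V -> V).

(* [w_1, [w_2, [..., [w_(m-1), w_m]]]] *)
Fixpoint nested_bracket (w : seq V) : V :=
  match w with
  | [::] => 0
  | [:: x] => x
  | x :: w' => bracket x (nested_bracket w')
  end.

(* Dynkin's form of the Baker-Campbell-Hausdorff series: for k blocks
   x^(r_i) y^(s_i) with r_i + s_i > 0, the nested bracket of the word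
   x^(r_1) y^(s_1) ... x^(r_k) y^(s_k) has coefficient
   (-1)^(k-1) / (k * (\sum_i (r_i + s_i)) * \prod_i (r_i! s_i!)).
   Only words of length at most [step] are kept: in a Lie algebra that is
   nilpotent of this step all the other brackets vanish. *)
Definition bch (step : nat) (x y : V) : V :=
  \sum_(1 <= k < step.+1)
    \sum_(rs : {ffun 'I_k -> 'I_step.+1 * 'I_step.+1} |
          [forall i, 0 < (rs i).1 + (rs i).2]%N
          && (\sum_i ((rs i).1 + (rs i).2) <= step)%N)
      ((-1) ^+ k.-1
         / (k * (\sum_i ((rs i).1 + (rs i).2))
              * \prod_i ((rs i).1`! * (rs i).2`!))%N%:R) *:
      nested_bracket
        (flatten [seq nseq (rs i).1 x ++ nseq (rs i).2 y | i <- enum 'I_k]).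

End BakerCampbellHausdorff.

(* The underlying vector space is R^n with an arbitrary grading; [layer j] is
   H_j for 1 <= j <= step and is 0 for the other indices. *)
Record stratifiedGroup (R : realType) (n : nat) := StratifiedGroup {
  step : nat;
  layer : nat -> {vspace 'rV[R]_n};
  bracket : {bilinear 'rV[R]_n -> 'rV[R]_n -> 'rV[R]_n};
  layer_out : forall j, ~~ (1 <= j <= step)%N -> layer j = 0%VS;
  layer_full : (\sum_(1 <= j < step.+1) layer j)%VS = fullv;
  layer_direct : directv (\sum_(1 <= j < step.+1) layer j);
  bracketxx : forall x, bracket x x = 0;
  bracket_jacobi : forall x y z,
    bracket x (bracket y z) + bracket y (bracket z x)
      + bracket z (bracket x y) = 0;
  bracket_layer : forall i j x y, x \in layer i -> y \in layer j ->
    bracket x y \in layer (i + j)%N;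
  layer1_generates : forall W : {vspace 'rV[R]_n}, (layer 1 <= W)%VS ->
    (forall x y, x \in W -> y \in W -> bracket x y \in W) -> W = fullv;
  (* The operation is a group law: associativity follows from the previous
     axioms by the Baker-Campbell-Hausdorff theorem, so this field is no
     restriction; the unit is 0 and the inverse of x is - x. *)
  bchA : associative (bch bracket step)
}.

Section StratifiedGroup.
Variables (R : realType) (n : nat) (G : stratifiedGroup R n).
Local Notation V := 'rV[R]_n.

Definition gmul (x y : V) : V := bch (bracket G) (step G) x y.

(* bch x (- x) = x - x = 0, because all the brackets of x and - x vanish. *)
Definition ginv (x : V) : V := - x.

Definition component (j : nat) (x : V) : V :=
  sumv_pi (\sum_(1 <= i < (step G).+1) layer G i)%VS j x.

Definition dil (r : R) (x : V) : V :=
  \sum_(1 <= j < (step G).+1) r ^+ j *: component j x.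

Definition adapted_dot (ip : {dot V for idfun}) : Prop :=
  forall i j, i != j -> (layer G i <= orthov ip (layer G j))%VS.

Definition homogeneous_distance (d : V -> V -> R) : Prop :=
  [/\ (forall x y, d x y = 0 <-> x = y),
      (forall x y, d x y = d y x),
      (forall x y z, d x z <= d x y + d y z),
      continuous (fun p : V * V => d p.1 p.2) &
      (forall w x y, d (gmul w x) (gmul w y) = d x y) /\
      (forall r x y, 0 < r -> d (dil r x) (dil r y) = r * d x y)].

(* Functions on Omega are represented by total functions, of which only the
   values on Omega matter. *)

Definition h_convex (Omega : set V) (u : V -> R) : Prop :=
  forall x y, Omega x -> Omega y ->
    gmul (ginv x) y \in layer G 1 ->
    [set gmul x (dil t (gmul (ginv x) y)) | t in `[0%R, 1%R]%classic]
      `<=` Omega ->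
    forall lambda : R, 0 <= lambda <= 1 ->
      u (gmul x (dil lambda (gmul (ginv x) y)))
        <= lambda * u y + (1 - lambda) * u x.

Definition h_subdifferential (ip : {dot V for idfun}) (Omega : set V)
    (u : V -> R) (x : V) : set V :=
  [set p | p \in layer G 1 /\
    forall h, h \in layer G 1 ->
      [set t *: h | t in `[0%R, 1%R]%classic] `<=` gmul (ginv x) @` Omega ->
      u (gmul x h) >= u x + ip p h].

Definition layer1_proj (ip : {dot V for idfun}) (x : V) : V :=
  daddv_pi (layer G 1) (orthov ip (layer G 1)) x.

Definition h_linear (ip : {dot V for idfun}) (L : {scalar V}) : Prop :=
  forall x, L x = L (layer1_proj ip x).

(* p is the h-gradient of u at x (in particular, it exists) *)
Definition is_h_gradient (ip : {dot V for idfun}) (d : V -> V -> R)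
    (u : V -> R) (x p : V) : Prop :=
  p \in layer G 1 /\
  exists L : {scalar V},
    [/\ h_linear ip L,
        (fun z : V => u (gmul x z) - u x - L z : R^o) =o_ (nbhs (0 : V))
          (fun z : V => d 0 z : R^o) &
        forall h, h \in layer G 1 -> L h = ip p h].

Definition h_reachable_gradient (ip : {dot V for idfun}) (d : V -> V -> R)
    (Omega : set V) (u : V -> R) (x : V) : set V :=
  [set p | p \in layer G 1 /\
    exists x_ p_ : nat -> V,
      [/\ forall k, Omega (x_ k),
          x_ @ \oo --> x,
          forall k, is_h_gradient ip d u (x_ k) (p_ k) &
          p_ @ \oo --> p]].

End StratifiedGroup.

Section LebesgueMeasurability.
Variables (R : realType) (n : nat).
Local Notation V := 'rV[R]_n.

Definition box (a b : V) : set V :=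
  [set x | forall i, a ord0 i < x ord0 i <= b ord0 i].

(* Infimum over the families of boxes, indexed by a subset D of nat, that
   cover X; D may be empty, so that set0 has measure 0 also when n = 0. *)
Definition lebesgue_outer_measure (X : set V) : \bar R :=
  ereal_inf [set e : \bar R | exists (D : pred nat) (a b : nat -> V),
    [/\ forall k i, a k ord0 i <= b k ord0 i,
        X `<=` \bigcup_(k in [set k | D k]) box (a k) (b k) &
        e = (\sum_(0 <= k <oo | D k)
              (\prod_(i < n) (b k ord0 i - a k ord0 i))%:E)%E]].

Definition lebesgue_measurable_fun (Omega : set V) (u : V -> R) : Prop :=
  forall B : set R, measurable B ->
    caratheodory_measurable lebesgue_outer_measure (Omega `&` u @^-1` B).

End LebesgueMeasurability.

(* When E lies in H_1, so do its convex hull and, as H_1 is closed, the closure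
   of the latter, which can hence be taken in the whole space. *)
Definition closed_convex_hull (R : realType) (n : nat) (E : set 'rV[R]_n) :
    set 'rV[R]_n :=
  closure (smallest (@convex_set R 'rV[R]_n) E).

(* Main.v *)
Require Import Defs.
From HB Require Import structures.
From mathcomp Require Import all_boot all_order all_algebra.
From mathcomp Require Import all_classical all_reals all_analysis.
From mathcomp Require Import measurable_realfun.
From mathcomp Require Import ring lra zify.
Set Implicit Arguments.
Unset Strict Implicit.
Unset Printing Implicit Defensive.
Import Order.TTheory GRing.Theory Num.Theory.
Import numFieldNormedType.Exports.
Local Open Scope classical_set_scope.
Local Open Scope ring_scope.

(** The theorem is proved by convex analysis along horizontal lines. Differentiability
    almost everywhere is replaced by differentiability on a dense set, which
    comes from touching [u] with paraboloids.

    Regularity. Measurability enters only in [locally_bounded_above]. Iterating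
    the midpoint inequality [2 u(x) <= u(x h) + u(x (-h))] along a horizontal word
    with m letters bounds [u(y)] by the largest value of [u] at the 2^m end points
    of the words obtained by changing signs ([sign_tree]). For a generic word
    these end points move in all directions of the group when n of the letters
    are perturbed, whatever the signs are ([generic_word]); the perturbation is
    then an expanding map, for which preimages of sets of small outer
    measure are small ([expanding_preimage]). Since the superlevel sets
    [u >= N] become small, some perturbation avoids all of them. Genericity
    rests on [conj_generates]: conjugation by a group element is a linear map,
    and the conjugates of the horizontal layer span the Lie algebra because
    this layer generates it. An upper bound gives in turn a lower bound, Lipschitz
    continuity along horizontal lines and continuity, the same words joining
    neighbouring points by short horizontal paths ([connect_small]).

    Subgradients. At a point [y] where a smooth function touches [u] from below,
    its horizontal gradient is a subgradient of [u] ([subdiff_first_order]).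
    Adding a large paraboloid to [u] and minimizing yields such points near every
    point ([touching]). Subgradients are locally bounded and their graph is
    closed, so there are some at every point ([subdiff_nonempty]). Where a smooth function
    touches [u] from above there is at most one subgradient, and this also
    happens on a dense set ([subdiff_unique_dense]). At a point with exactly one
    subgradient [u] is h-differentiable: nearby subgradients are close to it, and
    they control the increments of [u] along a horizontal path with a bounded
    number of steps of length comparable with [d] ([unique_subgradient_is_gradient]).

    Conclusion. An h-gradient is a subgradient, and the set of subgradients at [x]
    is closed and convex, whence one inclusion. For the other one, let [p] be a
    subgradient at [x] and [h] a horizontal vector. At points of differentiability
    close to [x (t h)] with t small, monotonicity of the derivative
    along lines in the direction [h] gives gradients [q] with
    [<q, h> >= <p, h> - o(1)]; so every half-space that contains the
    reachable gradient contains [p] ([reachable_support]), and the projection of [p] to the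
    closed convex hull is [p] itself. *)

(** * The Baker-Campbell-Hausdorff product to second order *)

Section BchExpansion.
Variables (R : realType) (V : lmodType R) (b : {bilinear V -> V -> V}).
Hypothesis bxx : forall x, b x x = 0.

Definition bracket_word (p : seq bool) (x y : V) : V :=
  nested_bracket b [seq (if c then x else y) | c <- p].

(** Terms of order at least three. Their explicit form is kept because the
    Lipschitz estimates, the behaviour under dilations and the polynomial
    dependence on the arguments are all read off from it. *)
Definition bracket_remainder (f : V -> V -> V) :=
  exists T : seq (R * seq bool),
    all (fun t => 2 < size t.2)%N T /\
    forall x y, f x y = \sum_(t <- T) t.1 *: bracket_word t.2 x y.

Lemma bracket_remainderD f g : bracket_remainder f -> bracket_remainder g ->
  bracket_remainder (fun x y => f x y + g x y).
Proof.
move=> [S [S3 fE]] [T [T3 gE]]; exists (S ++ T); split; first by rewrite all_cat S3.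
by move=> x y; rewrite big_cat fE gE.
Qed.

Lemma bracket_remainder_sum (I : Type) (r : seq I) (P : pred I) f :
  (forall i, P i -> bracket_remainder (f i)) ->
  bracket_remainder (fun x y => \sum_(i <- r | P i) f i x y).
Proof.
move=> fP; elim: r => [|i r [T [T3 IH]]].
  by exists [::]; split=> // x y; rewrite !big_nil.
case Pi : (P i); last by exists T; split=> // x y; rewrite big_cons Pi IH.
have [U [U3 UE]] := bracket_remainderD (fP i Pi) (ex_intro _ T (conj T3 IH)).
by exists U; split=> // x y; rewrite big_cons Pi UE.
Qed.

Section Blocks.
Variables (s k : nat).
Local Notation blocks := {ffun 'I_k -> 'I_s.+1 * 'I_s.+1}.

Definition block_coef (rs : blocks) : R :=
  (-1) ^+ k.-1
    / (k * (\sum_i ((rs i).1 + (rs i).2))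
         * \prod_i ((rs i).1`! * (rs i).2`!))%N%:R.

Definition block_pattern (rs : blocks) : seq bool :=
  flatten [seq nseq (rs i).1 true ++ nseq (rs i).2 false | i <- enum 'I_k].

Definition block_ok (rs : blocks) : bool :=
  [forall i, 0 < (rs i).1 + (rs i).2]%N
    && (\sum_i ((rs i).1 + (rs i).2) <= s)%N.

Lemma size_block_pattern (rs : blocks) :
  size (block_pattern rs) = (\sum_i ((rs i).1 + (rs i).2))%N.
Proof.
rewrite size_flatten /shape -map_comp sumnE big_map enumT.
by apply: eq_bigr => i _ /=; rewrite size_cat !size_nseq.
Qed.

Lemma block_words x y (rs : blocks) :
  nested_bracket b
    (flatten [seq nseq (rs i).1 x ++ nseq (rs i).2 y | i <- enum 'I_k]) =
  bracket_word (block_pattern rs) x y.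
Proof.
rewrite /bracket_word /block_pattern map_flatten -map_comp; congr nested_bracket.
by congr flatten; apply: eq_map => i /=; rewrite map_cat !map_nseq.
Qed.

End Blocks.

Lemma bchE s x y : bch b s x y = \sum_(1 <= k < s.+1)
  \sum_(rs : {ffun 'I_k -> 'I_s.+1 * 'I_s.+1} | block_ok rs)
     block_coef rs *: bracket_word (block_pattern rs) x y.
Proof.
rewrite /bch; apply: eq_bigr => k _; apply: eq_bigr => rs _.
by rewrite block_words.
Qed.

Lemma big_explicit (I : finType) (P : pred I) (r : seq I) (F : I -> V) :
  uniq r -> (forall i, P i = (i \in r)) ->
  \sum_(i | P i) F i = \sum_(i <- r) F i.
Proof. by move=> ur Pr; rewrite big_uniq //; apply: eq_bigl. Qed.

Lemma bch1 x y : bch b 1 x y = x + y.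
Proof.
pose blk (p : nat * nat) : {ffun 'I_1 -> 'I_2 * 'I_2} := [ffun=> (inord p.1, inord p.2)].
pose key (rs : {ffun 'I_1 -> 'I_2 * 'I_2}) := ((rs ord0).1 : nat, (rs ord0).2 : nat).
have keyK : cancel key blk.
  move=> rs; apply/ffunP => i; rewrite ffunE /key /= !inord_val (ord1 i).
  by case: (rs ord0).
pose l := [:: (1, 0); (0, 1)]%N.
have keyl : [seq key i | i <- [seq blk p | p <- l]] = l.
  by rewrite /= /key !ffunE /= !inordK.
rewrite bchE big_nat1 (@big_explicit _ _ [seq blk p | p <- l]); first last.
- move=> rs; apply/idP/idP; last first.
    by rewrite /= !inE => /orP[] /eqP ->;
      rewrite /block_ok !big_ord_recl !big_ord0 !ffunE /= !inordK //
        !addn0 ?andbT; apply/forallP => i; rewrite !ffunE /= !inordK.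
  rewrite /block_ok big_ord_recl big_ord0 addn0.
  move=> /andP[/forallP/(_ ord0) h0 h2].
  rewrite -[rs]keyK; apply: map_f; move: h0 h2; rewrite /key.
  move: (nat_of_ord (rs ord0).1) (nat_of_ord (rs ord0).2) => p q.
  by case: p q => [|[|p]] [|[|q]]; rewrite ?addnS ?addSn ?addn0 ?add0n.
- by apply: (@map_uniq _ _ key); rewrite keyl.
rewrite /= !big_cons big_nil /block_coef /bracket_word /block_pattern.
rewrite enum_ordSl /= enum_ord0 /= !big_ord_recl !big_ord0 !ffunE /= !inordK //=.
by rewrite !addr0 expr0 !muln1 !div1r !invr1 !scale1r.
Qed.

Section OneBlock.
Variable s : nat.
Let blk (p : nat * nat) : {ffun 'I_1 -> 'I_s.+3 * 'I_s.+3} :=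
  [ffun=> (inord p.1, inord p.2)].
Let key (rs : {ffun 'I_1 -> 'I_s.+3 * 'I_s.+3}) : nat * nat :=
  ((rs ord0).1 : nat, (rs ord0).2 : nat).

Let keyK : cancel key blk.
Proof.
move=> rs; apply/ffunP => i; rewrite ffunE /key /= !inord_val (ord1 i).
by case: (rs ord0).
Qed.

Lemma one_block_small x y :
  \sum_(rs : {ffun 'I_1 -> 'I_s.+3 * 'I_s.+3}
        | block_ok rs && (size (block_pattern rs) <= 2)%N)
     block_coef rs *: bracket_word (block_pattern rs) x y
  = x + y + 2^-1 *: b x y.
Proof.
pose l := [:: (1, 0); (0, 1); (2, 0); (1, 1); (0, 2)]%N.
have keyl : [seq key i | i <- [seq blk p | p <- l]] = l.
  by rewrite /= /key !ffunE /= !inordK.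
rewrite (@big_explicit _ _ [seq blk p | p <- l]); first last.
- move=> rs; apply/idP/idP; last first.
    by rewrite /= !inE => /or4P[| | |/orP[]] /eqP ->;
      rewrite size_block_pattern /block_ok !big_ord_recl !big_ord0 !ffunE /= !inordK //
        !addn0 ?andbT; apply/forallP => i; rewrite !ffunE /= !inordK.
  rewrite size_block_pattern /block_ok big_ord_recl big_ord0 addn0.
  move=> /andP[/andP[/forallP/(_ ord0) h0 _] h2].
  rewrite -[rs]keyK; apply: map_f; move: h0 h2; rewrite /key.
  move: (nat_of_ord (rs ord0).1) (nat_of_ord (rs ord0).2) => p q.
  by case: p q => [|[|[|p]]] [|[|[|q]]]; rewrite ?addnS ?addSn ?addn0 ?add0n.
- by apply: (@map_uniq _ _ key); rewrite keyl.
rewrite /= !big_cons big_nil /block_coef /bracket_word /block_pattern.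
rewrite enum_ordSl /= enum_ord0 /= !big_ord_recl !big_ord0 !ffunE /= !inordK //=.
rewrite !bxx !scaler0 !add0r !addr0 expr0 !muln1 !div1r !invr1 !scale1r.
by rewrite addrA.
Qed.

End OneBlock.
Section TwoBlocks.
Variable s : nat.
Let blk (p : (nat * nat) * (nat * nat)) : {ffun 'I_2 -> 'I_s.+3 * 'I_s.+3} :=
  [ffun i => if i == ord0 then (inord p.1.1, inord p.1.2)
             else (inord p.2.1, inord p.2.2)].
Let key (rs : {ffun 'I_2 -> 'I_s.+3 * 'I_s.+3}) : (nat * nat) * (nat * nat) :=
  (((rs ord0).1 : nat, (rs ord0).2 : nat), ((rs ord_max).1 : nat, (rs ord_max).2 : nat)).

Let keyK : cancel key blk.
Proof.
move=> rs; apply/ffunP => i; rewrite ffunE /key /= !inord_val.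
case: eqP => [->|i0]; first by case: (rs ord0).
have -> : i = ord_max by apply/val_inj; case: i i0 => [[|[|i]]] //= hi /eqP; rewrite -val_eqE.
by case: (rs ord_max).
Qed.

Lemma two_blocks_small x y :
  \sum_(rs : {ffun 'I_2 -> 'I_s.+3 * 'I_s.+3}
        | block_ok rs && (size (block_pattern rs) <= 2)%N)
     block_coef rs *: bracket_word (block_pattern rs) x y
  = - 4^-1 *: (b x y + b y x).
Proof.
pose l := [:: ((1, 0), (1, 0)); ((1, 0), (0, 1)); ((0, 1), (1, 0)); ((0, 1), (0, 1))]%N.
have keyl : [seq key i | i <- [seq blk p | p <- l]] = l.
  by rewrite /= /key !ffunE /= !inordK.
have lift01 : lift (ord0 : 'I_2) (ord0 : 'I_1) = ord_max by apply/val_inj.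
rewrite (@big_explicit _ _ [seq blk p | p <- l]); first last.
- move=> rs; apply/idP/idP; last first.
    by rewrite /= !inE => /or4P[] /eqP ->;
      rewrite size_block_pattern /block_ok !big_ord_recl !big_ord0 !ffunE /= !inordK //
        ?addn0 ?andbT; apply/forallP => i; rewrite !ffunE /=; case: ifP => _ /=; rewrite !inordK.
  rewrite size_block_pattern /block_ok !big_ord_recl big_ord0 addn0 lift01.
  move=> /andP[/andP[/forallP h _] h2].
  rewrite -[rs]keyK; apply: map_f; move: (h ord0) (h ord_max) h2; rewrite /key.
  move: (nat_of_ord (rs ord0).1) (nat_of_ord (rs ord0).2)
    (nat_of_ord (rs ord_max).1) (nat_of_ord (rs ord_max).2).
  move=> p q p' q'.
  by case: p q p' q' => [|[|p]] [|[|q]] [|[|p']] [|[|q']]; rewrite ?addnS ?addSn ?addn0 ?add0n.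
- by apply: (@map_uniq _ _ key); rewrite keyl.
rewrite /= !big_cons big_nil /block_coef /bracket_word /block_pattern.
rewrite !enum_ordSl /= enum_ord0 /= !big_ord_recl !big_ord0 lift01 !ffunE /= !inordK //=.
rewrite !bxx !scaler0 !add0r !addr0 expr1 -scalerDr mulN1r.
by congr (- (_%:R)^-1 *: _).
Qed.

End TwoBlocks.

(** The one-block words contribute half of the bracket, and the two-block words
    xy and yx contribute brackets that cancel each other. *)
Lemma bch_expansion s : exists f, bracket_remainder f /\
  forall x y, bch b s.+2 x y = x + y + 2^-1 *: b x y + f x y.
Proof.
pose F k x y := \sum_(rs : {ffun 'I_k -> 'I_s.+3 * 'I_s.+3}
        | block_ok rs && ~~ (size (block_pattern rs) <= 2)%N)
     block_coef rs *: bracket_word (block_pattern rs) x y.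
exists (fun x y => \sum_(1 <= k < s.+3) F k x y); split.
  apply: bracket_remainder_sum => k _; apply: bracket_remainder_sum => rs.
  rewrite -ltnNge => /andP[_ rs3].
  exists [:: (block_coef rs, block_pattern rs)]; split; first by rewrite /= rs3.
  by move=> x y; rewrite big_seq1.
move=> x y; rewrite bchE.
under eq_bigr => k _ do rewrite
  (bigID (fun rs : {ffun 'I_k -> 'I_s.+3 * 'I_s.+3} => size (block_pattern rs) <= 2)%N) /=.
rewrite big_split /=; congr +%R.
rewrite big_ltn // big_ltn // one_block_small two_blocks_small.
rewrite [X in _ + (_ + X)]big_nat_cond [X in _ + (_ + X)]big1 ?addr0; last first.
  move=> k /andP[/andP[k3 _] _]; apply: big1 => rs /andP[/andP[/forallP h _]].
  rewrite size_block_pattern => h2; exfalso.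
  have : (\sum_(i < k) 1 <= 2)%N by apply: leq_trans h2; apply: leq_sum => i _.
  by rewrite sum1_card card_ord leqNgt k3.
have -> : b y x = - b x y.
  have := bxx (x + y); rewrite linearDr !linearDl /= !bxx add0r addr0 => /eqP.
  by rewrite addr_eq0 => /eqP ->; rewrite ?opprK.
by rewrite subrr scaler0 addr0.
Qed.

End BchExpansion.

(** * Estimates in finite dimension *)

Section FiniteDim.
Variable R : realType.

Lemma rV_norm_le n (v : 'rV[R]_n) r : 0 <= r ->
  (`|v| <= r) = [forall i, `|v ord0 i| <= r].
Proof.
move=> r0; rewrite [`|v|]/Num.norm /= mx_normrE; apply/bigmax_leP/forallP => /=.
  by move=> [_ h] i; apply: (h (ord0, i)).
by move=> h; split=> // -[i j] _; rewrite (ord1 i); apply: h.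
Qed.

Lemma coord_le_norm n (v : 'rV[R]_n) i : `|v ord0 i| <= `|v|.
Proof. by have := lexx `|v|; rewrite {1}rV_norm_le // => /forallP. Qed.

Lemma linear_bound n (W : normedModType R) (f : 'rV[R]_n -> W) : linear f ->
  exists2 C : R, 0 < C & forall v : 'rV[R]_n, `|f v| <= C * `|v|.
Proof.
move=> lf; pose L : {linear 'rV[R]_n -> W} := HB.pack f (GRing.isLinear.Build _ _ _ _ f lf).
exists (1 + \sum_i `|f (delta_mx ord0 i)|).
  by rewrite ltr_pwDl // sumr_ge0.
move=> v; have -> : f v = \sum_i v ord0 i *: f (delta_mx ord0 i).
  rewrite -[f]/(L : _ -> _) {1}(row_sum_delta v) linear_sum.
  by apply: eq_bigr => i _; rewrite linearZ.
apply: (le_trans (ler_norm_sum _ _ _)).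
apply: (@le_trans _ _ ((\sum_i `|f (delta_mx ord0 i)|) * `|v|)); last first.
  by rewrite ler_wpM2r // lerDr.
rewrite mulr_suml; apply: ler_sum => i _; rewrite normrZ mulrC ler_wpM2l //.
exact: coord_le_norm.
Qed.

Lemma bilinear_bound m n (W : normedModType R) (f : 'rV[R]_m -> 'rV[R]_n -> W) :
  (forall y, linear (f^~ y)) -> (forall x, linear (f x)) ->
  exists2 K : R, 0 < K & forall (x : 'rV[R]_m) (y : 'rV[R]_n), `|f x y| <= K * `|x| * `|y|.
Proof.
move=> fl fr; have fP i := linear_bound (fr (delta_mx ord0 i)).
pose c i := projT1 (cid2 (fP i)).
have c0 i : 0 < c i by rewrite /c; case: (cid2 (fP i)).
have cP i y : `|f (delta_mx ord0 i) y| <= c i * `|y| by rewrite /c; case: (cid2 (fP i)).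
exists (1 + \sum_i c i); first by rewrite ltr_pwDl // sumr_ge0 // => i _; exact/ltW.
move=> x y.
pose L : {linear 'rV[R]_m -> W} := HB.pack (f^~ y) (GRing.isLinear.Build _ _ _ _ (f^~ y) (fl y)).
rewrite -[f x y]/(L x) {1}(row_sum_delta x) linear_sum.
apply: (le_trans (ler_norm_sum _ _ _)).
apply: (@le_trans _ _ ((\sum_i c i) * `|x| * `|y|)); last first.
  by rewrite !ler_wpM2r // lerDr.
rewrite !mulr_suml; apply: ler_sum => i _; rewrite linearZ normrZ.
rewrite (mulrC (c i)) -mulrA; apply: ler_pM => //.
  exact: coord_le_norm.
exact: cP.
Qed.

End FiniteDim.

(** * The group law *)

Section Group.
Variables (R : realType) (n : nat) (G : stratifiedGroup R n).
Local Notation V := 'rV[R]_n.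
Local Notation "x ** y" := (gmul G x y) (at level 40, left associativity).
Local Notation br := (bracket G).
Local Notation H1 := (layer G 1).

Lemma layers_ind (P : V -> Prop) : P 0 -> (forall x y, P x -> P y -> P (x + y)) ->
  (forall j x, (1 <= j <= step G)%N -> x \in layer G j -> P x) -> forall x, P x.
Proof.
move=> P0 PD Pl x; have : x \in (\sum_(1 <= j < (step G).+1) layer G j)%VS.
  by rewrite layer_full memvf.
rewrite big_add1 /= big_mkord => /memv_sumP [v vl ->].
by elim/big_ind: _ => // i _; apply: (Pl i.+1); [exact: ltn_ord | exact: vl].
Qed.

Lemma bracketC x y : br y x = - br x y.
Proof.
have := bracketxx G (x + y); rewrite linearDr !linearDl /= !bracketxx add0r addr0 => /eqP.
by rewrite addr_eq0 => /eqP ->; rewrite ?opprK.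
Qed.


Lemma step0_trivial : step G = 0%N -> forall x y : V, x = y.
Proof.
move=> s0; have h x : x = 0 :> V.
  by apply: (layers_ind (P := fun x => x = 0)) x => [//|x y -> ->|[|j] x]; rewrite ?addr0 // s0.
by move=> x y; rewrite (h x) (h y).
Qed.

Lemma step1_abelian : step G = 1%N -> forall x y, br x y = 0.
Proof.
move=> s1 x y; have l0 j : j != 1%N -> layer G j = 0%VS.
  by move=> j1; apply: layer_out; rewrite s1 -eqn_leq eq_sym.
apply: (layers_ind (P := fun x => br x y = 0)) x; first exact: linear0l.
  by move=> x x' xy x'y; rewrite linearDl /= xy x'y addr0.
move=> i x /andP[i0 _] xi.
apply: (layers_ind (P := fun y => br x y = 0)) y; first exact: linear0r.
  by move=> y y' xy xy'; rewrite linearDr xy xy' addr0.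
move=> j y /andP[j0 _] yj; have := bracket_layer xi yj.
by rewrite l0 ?memv0 => [/eqP|] //; lia.
Qed.

(** For a step at most 1 the bracket vanishes, so that the formula takes the same
    form for every step. *)
Lemma gmul_expansion : exists T : seq (R * seq bool),
  all (fun t => 2 < size t.2)%N T /\
  forall x y, x ** y = x + y + 2^-1 *: br x y
                       + \sum_(t <- T) t.1 *: bracket_word br t.2 x y.
Proof.
case E : (step G) => [|[|s]].
- by exists [::]; split=> // x y; apply: step0_trivial.
- exists [::]; split=> // x y; rewrite big_nil step1_abelian // scaler0 !addr0.
  by rewrite /gmul E bch1.
have [f [[T [T3 fE]] bE]] := bch_expansion (@bracketxx _ _ G) s.
by exists T; split=> // x y; rewrite /gmul E bE fE.
Qed.

Lemma bracket_word0 x y p : br x y = 0 -> (1 < size p)%N -> bracket_word br p x y = 0.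
Proof.
move=> xy; have yx : br y x = 0 by rewrite bracketC xy oppr0.
elim: p => [|c [|c' [|c'' p]] IH] // _; last first.
  by rewrite /bracket_word /= in IH *; rewrite IH // linear0r.
by rewrite /bracket_word /=; case: c c' {IH} => [] []; rewrite ?bracketxx.
Qed.

Lemma gmul_commuting x y : br x y = 0 -> x ** y = x + y.
Proof.
move=> xy; have [T [T3 ->]] := gmul_expansion; rewrite xy scaler0 addr0.
rewrite big_seq big1 ?addr0 // => t /(allP T3) t3.
by rewrite bracket_word0 ?scaler0 //; apply: ltnW.
Qed.

Lemma gmulA : associative (gmul G).
Proof. exact: bchA. Qed.

Lemma gmul0 x : x ** 0 = x.
Proof. by rewrite gmul_commuting ?addr0 // linear0r. Qed.

Lemma g0mul x : 0 ** x = x.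
Proof. by rewrite gmul_commuting ?add0r // linear0l. Qed.

Lemma gmulZZ a b x : (a *: x) ** (b *: x) = (a + b) *: x.
Proof.
by rewrite gmul_commuting -?scalerDl // linearZl_LR linearZr_LR /= bracketxx !scaler0.
Qed.

Lemma gmulN x : x ** - x = 0.
Proof. by rewrite gmul_commuting ?subrr // linearNr /= bracketxx oppr0. Qed.

Lemma gNmul x : - x ** x = 0.
Proof. by rewrite gmul_commuting ?addNr // linearNl /= bracketxx oppr0. Qed.

Lemma gmulK x y : x ** y ** - y = x.
Proof. by rewrite -gmulA gmulN gmul0. Qed.

Lemma gKmul x y : - x ** (x ** y) = y.
Proof. by rewrite gmulA gNmul g0mul. Qed.

Lemma gNKmul x y : x ** (- x ** y) = y.
Proof. by rewrite gmulA gmulN g0mul. Qed.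

Lemma goppM x y : - (x ** y) = - y ** - x.
Proof.
have xyI : x ** y ** (- y ** - x) = 0 by rewrite gmulA gmulK gmulN.
by rewrite -[LHS]gmul0 -xyI gKmul.
Qed.

End Group.

(** * Estimates for the group law *)

Section GroupEstimates.
Variables (R : realType) (n : nat) (G : stratifiedGroup R n).
Local Notation V := 'rV[R]_n.
Local Notation "x ** y" := (gmul G x y) (at level 40, left associativity).
Local Notation br := (bracket G).

Lemma bracket_bound : exists2 K : R, 0 < K & forall x y : V, `|br x y| <= K * `|x| * `|y|.
Proof.
apply: (@bilinear_bound _ _ _ _ br) => [y|x].
  by move=> a u v; rewrite linearDl linearZl_LR.
by move=> a u v; rewrite linearDr linearZr_LR.
Qed.

Lemma bracket_word_bound p : (0 < size p)%N -> exists2 C : R, 0 < C &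
  forall (rho : R) (x y : V), `|x| <= rho -> `|y| <= rho ->
    `|bracket_word br p x y| <= C * rho ^+ size p.
Proof.
have [K K0 KP] := bracket_bound.
elim: p => [|c [|c' p] IH] // _.
  by exists 1 => // rho x y hx hy; rewrite mul1r expr1 /bracket_word /=; case: c.
have [C C0 CP] := IH isT.
exists (K * C) => [|rho x y hx hy]; first exact: mulr_gt0.
have rho0 : 0 <= rho by apply: le_trans hx.
apply: (le_trans (KP _ _)); rewrite exprS mulrACA.
apply: ler_pM => //; first by rewrite mulr_ge0 // ltW.
  by rewrite ler_wpM2l //; [exact: ltW | case: c].
exact: CP.
Qed.

Lemma bracket_word_lipschitz p : (0 < size p)%N -> exists2 C : R, 0 < C &
  forall (rho : R) (x y x' y' : V), `|x| <= rho -> `|y| <= rho -> `|x'| <= rho -> `|y'| <= rho ->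
    `|bracket_word br p x y - bracket_word br p x' y'|
      <= C * rho ^+ (size p).-1 * (`|x - x'| + `|y - y'|).
Proof.
have [K K0 KP] := bracket_bound.
elim: p => [|c [|c' p] IH] // _.
  exists 1 => // rho x y x' y' *; rewrite !mul1r /bracket_word /=.
  by case: c; rewrite ?lerDl ?lerDr.
have [C C0 CP] := IH isT.
have [D D0 DP] := @bracket_word_bound (c' :: p) isT.
exists (K * D + K * C) => [|rho x y x' y' hx hy hx' hy']; first by rewrite addr_gt0 // mulr_gt0.
have rho0 : 0 <= rho by apply: le_trans hx.
rewrite -[bracket_word _ _ x y]/(br (if c then x else y) (bracket_word br (c' :: p) x y)).
rewrite -[bracket_word _ _ x' y']/(br (if c then x' else y') (bracket_word br (c' :: p) x' y')).
set z := if c then x else y; set z' := if c then x' else y'.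
set w := bracket_word _ _ _ _; set w' := bracket_word _ _ _ _.
have -> : br z w - br z' w' = br (z - z') w + br z' (w - w').
  by rewrite linearBl linearBr /= addrA subrK.
have zz : `|z - z'| <= `|x - x'| + `|y - y'| by rewrite /z /z'; case: (c); rewrite ?lerDl ?lerDr.
have hz : `|z'| <= rho by rewrite /z'; case: (c).
have hw := DP rho x y hx hy; have hww := CP rho x y x' y' hx hy hx' hy'.
apply: (le_trans (ler_normD _ _)); rewrite !mulrDl; apply: lerD.
  apply: (le_trans (KP _ _)); rewrite -!mulrA ler_pM2l //.
  by rewrite [leRHS]mulrA [leRHS]mulrC; apply: ler_pM.
apply: (le_trans (KP _ _)); rewrite /= -!mulrA ler_pM2l //.
rewrite exprS; apply: (le_trans (ler_pM _ _ hz hww)) => //=.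
by rewrite !mulrA (mulrC rho).
Qed.

Lemma remainder_lipschitz k (T : seq (R * seq bool)) M : 0 < M ->
  all (fun t => k < size t.2)%N T ->
  exists2 C : R, 0 < C & forall (rho : R) (x y x' y' : V), rho <= M ->
    `|x| <= rho -> `|y| <= rho -> `|x'| <= rho -> `|y'| <= rho ->
    `|\sum_(t <- T) t.1 *: bracket_word br t.2 x y
      - \sum_(t <- T) t.1 *: bracket_word br t.2 x' y'|
      <= C * rho ^+ k * (`|x - x'| + `|y - y'|).
Proof.
move=> M0; elim: T => [_|t T IH /= /andP[tk /IH [C C0 CP]]].
  exists 1 => // rho x y x' y' _ hx *; rewrite !big_nil subrr normr0 mul1r.
  apply: mulr_ge0; last exact: addr_ge0.
  by apply: exprn_ge0; apply: le_trans hx.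
have [D D0 DP] := @bracket_word_lipschitz t.2 (leq_trans (ltn0Sn _) tk).
exists (`|t.1| * (D * M ^+ ((size t.2).-1 - k)) + C).
  by rewrite ltr_wpDl // !mulr_ge0 ?exprn_ge0 // ltW.
move=> rho x y x' y' hM hx hy hx' hy'; rewrite !big_cons opprD addrACA.
have rho0 : 0 <= rho by apply: le_trans hx.
apply: (le_trans (ler_normD _ _)); rewrite !mulrDl; apply: lerD; last exact: CP.
rewrite -scalerBr normrZ -!mulrA ler_wpM2l //.
apply: (le_trans (DP rho _ _ _ _ _ _ _ _)) => //; rewrite -!mulrA ler_pM2l //.
rewrite mulrA ler_wpM2r ?addr_ge0 //.
have tk' : (k <= (size t.2).-1)%N by rewrite -ltnS (leq_trans tk) // leqSpred.
rewrite -[X in rho ^+ X](subnK tk') exprD ler_wpM2r ?exprn_ge0 //.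
by rewrite lerXn2r ?nnegrE // ltW.
Qed.

Lemma bracket_word_0 p : (0 < size p)%N -> bracket_word br p 0 0 = 0.
Proof.
elim: p => [|c [|c' p] IH] // _; first by rewrite /bracket_word /=; case: c.
by rewrite /bracket_word /= in IH *; rewrite IH // linear0r.
Qed.

(** The words other than x and y have length at least two: on the ball of radius
    [rho] their Lipschitz constants are of order [rho]. *)
Lemma gmul_near0 : exists2 C : R, 0 < C & forall (rho : R) (x y x' y' : V), rho <= 1 ->
    `|x| <= rho -> `|y| <= rho -> `|x'| <= rho -> `|y'| <= rho ->
    `|(x ** y - (x + y)) - (x' ** y' - (x' + y'))| <= C * rho * (`|x - x'| + `|y - y'|).
Proof.
have [T [T3 TE]] := gmul_expansion G.
have [|C C0 CP] := @remainder_lipschitz 1 ((2^-1, [:: true; false]) :: T) 1 ltr01.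
  by rewrite /=; apply: sub_all T3 => t; apply: ltnW.
exists C => // rho x y x' y' hr hx hy hx' hy'.
have E z w : z ** w - (z + w) =
   \sum_(t <- (2^-1, [:: true; false]) :: T) t.1 *: bracket_word br t.2 z w.
  by rewrite big_cons TE /= -[X in X - _]addrA addrAC subrr add0r.
by rewrite !E; move: (CP rho x y x' y' hr hx hy hx' hy'); rewrite expr1.
Qed.

Lemma gmul_lipschitz M : 0 < M -> exists2 C : R, 0 < C & forall x y x' y' : V,
    `|x| <= M -> `|y| <= M -> `|x'| <= M -> `|y'| <= M ->
    `|x ** y - x' ** y'| <= C * (`|x - x'| + `|y - y'|).
Proof.
move=> M0; have [T [T3 TE]] := gmul_expansion G.
have [|C C0 CP] := @remainder_lipschitz 0 ([:: (1, [:: true]), (1, [:: false]),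
    (2^-1, [:: true; false]) & T]) M M0.
  by rewrite /=; apply: sub_all T3 => t; apply: (@ltn_trans 2).
exists C => // x y x' y' hx hy hx' hy'.
have E z w : z ** w =
   \sum_(t <- [:: (1, [:: true]), (1, [:: false]), (2^-1, [:: true; false]) & T])
     t.1 *: bracket_word br t.2 z w.
  by rewrite !big_cons TE /bracket_word /= !scale1r !addrA.
by rewrite !E; move: (CP M x y x' y' (lexx _) hx hy hx' hy'); rewrite mulr1.
Qed.

Lemma gmul_second_order : exists2 C : R, 0 < C & forall (rho : R) (x y : V), rho <= 1 ->
    `|x| <= rho -> `|y| <= rho ->
    `|x ** y - (x + y + 2^-1 *: br x y)| <= C * rho ^+ 3.
Proof.
have [T [T3 TE]] := gmul_expansion G.
have [C C0 CP] := @remainder_lipschitz 2 T 1 ltr01 T3.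
exists (C * 2) => [|rho x y hr hx hy]; first exact: mulr_gt0.
have rho0 : 0 <= rho by apply: le_trans hx.
have := CP rho x y 0 0 hr hx hy; rewrite normr0 => /(_ rho0 rho0).
rewrite [X in _ - X](_ : _ = 0) ?subr0; last first.
  by rewrite big_seq big1 // => t /(allP T3) t3; rewrite bracket_word_0 ?scaler0 // (ltn_trans _ t3).
rewrite TE addrAC subrr add0r => /le_trans; apply.
rewrite (_ : C * 2 * rho ^+ 3 = C * rho ^+ 2 * (2 * rho)); last by ring.
apply: ler_wpM2l; first by apply: mulr_ge0; [exact: ltW | exact: exprn_ge0].
by have := lerD hx hy; lra.
Qed.

End GroupEstimates.

(** * Conjugation is linear *)

Section Conjugation.
Variables (R : realType) (n : nat) (G : stratifiedGroup R n).
Local Notation V := 'rV[R]_n.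
Local Notation "x ** y" := (gmul G x y) (at level 40, left associativity).
Local Notation br := (bracket G).

(** The error is quadratic, rather than a little o, so that the class is stable
    under brackets by elementary estimates. *)
Definition diff2_at0 (f : V -> V) := exists A : V -> V, linear A /\
  exists2 C : R, 0 < C & forall z : V, `|z| <= 1 -> `|f z - f 0 - A z| <= C * `|z| ^+ 2.

Lemma diff2_cst c : diff2_at0 (fun=> c).
Proof.
exists (fun=> 0); split; first by move=> a u v; rewrite scaler0 addr0.
by exists 1 => // z _; rewrite subrr subr0 normr0 mul1r.
Qed.

Lemma diff2_id : diff2_at0 id.
Proof.
exists id; split=> //.
by exists 1 => // z _; rewrite subr0 subrr normr0 mul1r.
Qed.

Lemma diff2D f g : diff2_at0 f -> diff2_at0 g -> diff2_at0 (fun z => f z + g z).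
Proof.
move=> [A [Al [C C0 CP]]] [B [Bl [D D0 DP]]].
exists (fun z => A z + B z); split.
  by move=> a u v; rewrite Al Bl scalerDr addrACA.
exists (C + D); first exact: addr_gt0.
move=> z z1; rewrite mulrDl.
rewrite (_ : _ - _ = (f z - f 0 - A z) + (g z - g 0 - B z)); last first.
  by apply/rowP => i; rewrite !mxE; ring.
by apply: (le_trans (ler_normD _ _)); apply: lerD; [exact: CP | exact: DP].
Qed.

Lemma diff2Z a f : diff2_at0 f -> diff2_at0 (fun z => a *: f z).
Proof.
move=> [A [Al [C C0 CP]]]; exists (fun z => a *: A z); split.
  by move=> b u v; rewrite Al scalerDr !scalerA mulrC.
exists (`|a| * C + 1); first by rewrite ltr_wpDl // mulr_ge0 // ltW.
move=> z z1; rewrite -!scalerBr normrZ mulrDl.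
apply: (@le_trans _ _ (`|a| * C * `|z| ^+ 2)); last by rewrite lerDl mul1r exprn_ge0.
by rewrite -mulrA ler_wpM2l // CP.
Qed.

Lemma diff2_bracket f g : diff2_at0 f -> diff2_at0 g -> diff2_at0 (fun z => br (f z) (g z)).
Proof.
move=> [A [Al [C C0 CP]]] [B [Bl [D D0 DP]]].
have [K K0 KP] := bracket_bound G.
have [a a0 aP] := linear_bound Al.
have [b b0 bP] := linear_bound Bl.
exists (fun z => br (f 0) (B z) + br (A z) (g 0)); split.
  move=> t u v; rewrite Al Bl linearDl linearDr linearZl_LR linearZr_LR /=.
  by rewrite scalerDr addrACA.
pose E := K * `|f 0| * D + K * C * `|g 0| + K * (C + a) * (D + b).
have E0 : 0 < E.
  rewrite ltr_wpDl //; last by rewrite !mulr_gt0 // addr_gt0.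
  by rewrite addr_ge0 // !mulr_ge0 // ltW.
exists E => // z z1.
set f1 := f z - f 0 - A z; set g1 := g z - g 0 - B z.
rewrite (_ : _ - _ = br (f 0) g1 + br f1 (g 0) + br (f z - f 0) (g z - g 0)); last first.
  rewrite /f1 /g1; move: (f z) (f 0) (g z) (g 0) (A z) (B z) => F F0 H H0 A' B'.
  rewrite !(linearDl, linearDr, linearNl, linearNr) /= !opprK.
  set t1 := br F H; set t2 := br F0 H0; set t3 := br F H0; set t4 := br F0 H.
  set t5 := br F0 B'; set t6 := br A' H0.
  apply/rowP => i; rewrite !mxE; ring.
have zz : `|z| ^+ 2 <= `|z| by rewrite expr2 ler_piMl.
have bnd (h : V -> V) (L : V -> V) c l : 0 < c -> 0 < l -> `|h z - h 0 - L z| <= c * `|z| ^+ 2 ->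
    `|L z| <= l * `|z| -> `|h z - h 0| <= (c + l) * `|z|.
  move=> c0 l0 h1 h2; rewrite -(subrK (L z) (h z - h 0)) mulrDl.
  apply: (le_trans (ler_normD _ _)); apply: lerD => //; apply: (le_trans h1).
  by rewrite ler_pM2l.
have fb := bnd _ _ _ _ C0 a0 (CP z z1) (aP z).
have gb := bnd _ _ _ _ D0 b0 (DP z z1) (bP z).
rewrite /E !mulrDl; apply: (le_trans (ler_normD _ _)); apply: lerD.
  apply: (le_trans (ler_normD _ _)); apply: lerD.
    apply: (le_trans (KP _ _)); rewrite -!mulrA ler_pM2l // ler_wpM2l //.
    exact: DP.
  apply: (le_trans (KP _ _)); rewrite -!mulrA ler_pM2l //.
  by rewrite [leRHS]mulrCA [leLHS]mulrC ler_wpM2l // CP.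
apply: (le_trans (KP _ _)); rewrite -!mulrA ler_pM2l //.
apply: (le_trans (ler_pM _ _ fb gb)) => //.
by rewrite expr2 mulrACA -!mulrA.
Qed.

Lemma diff2_gmul f g : diff2_at0 f -> diff2_at0 g -> diff2_at0 (fun z => f z ** g z).
Proof.
move=> df dg; have [T [T3 TE]] := gmul_expansion G.
have -> : (fun z => f z ** g z) = (fun z => f z + g z + 2^-1 *: br (f z) (g z)
    + \sum_(t <- T) t.1 *: bracket_word br t.2 (f z) (g z)) by apply/funext => z.
apply: diff2D; first by apply: diff2D; [exact: diff2D | apply: diff2Z; exact: diff2_bracket].
elim: T {T3 TE} => [|[c p] T IH].
  by under [X in diff2_at0 X]eq_fun do rewrite big_nil; exact: diff2_cst.
under [X in diff2_at0 X]eq_fun do rewrite big_cons.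
apply: diff2D IH; apply: diff2Z; elim: p => [|e p IH]; first exact: diff2_cst.
have dfg : diff2_at0 (fun z => if e then f z else g z) by case: (e).
case: p IH => [|e' p] IH; first exact: dfg.
exact: (diff2_bracket dfg IH).
Qed.

(** This turns the differential of a function touching [u] at [y] into a linear
    function of the horizontal displacement from [y]. *)
Lemma left_translation_diff y : exists A : V -> V, linear A /\
  exists2 C : R, 0 < C & forall z : V, `|z| <= 1 -> `|y ** z - y - A z| <= C * `|z| ^+ 2.
Proof.
have [A [Al [C C0 CP]]] := diff2_gmul (diff2_cst y) diff2_id.
by exists A; split=> //; exists C => // z z1; have := CP z z1; rewrite gmul0.
Qed.

Definition conj s z := - s ** z ** s.

Lemma conjM s x y : conj s (x ** y) = conj s x ** conj s y.
Proof. by rewrite /conj !gmulA gmulK. Qed.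

Lemma conj_gmul s s' x : conj (s ** s') x = conj s' (conj s x).
Proof. by rewrite /conj goppM !gmulA. Qed.

Lemma conj0 x : conj 0 x = x.
Proof. by rewrite /conj oppr0 g0mul gmul0. Qed.

Lemma conjN_K s x : conj s (conj (- s) x) = x.
Proof. by rewrite -conj_gmul gNmul conj0. Qed.

(** [conj s] commutes with squaring, that is with the multiplication by 2, so
    it coincides with its differential at 0. *)
Lemma conj_linear s : linear (conj s).
Proof.
have [A [Al [C C0 CP]]] :=
  diff2_gmul (diff2_gmul (diff2_cst (- s)) diff2_id) (diff2_cst s).
suff -> : conj s = A by [].
have c0 : conj s 0 = 0 by rewrite /conj gmul0 gNmul.
have c2 x : conj s (2 *: x) = 2 *: conj s x.
  have d (z : V) : 2 *: z = z ** z by rewrite -{2 3}[z]scale1r gmulZZ.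
  by rewrite !d conjM.
have ck k x : conj s (2 ^+ k *: x) = 2 ^+ k *: conj s x.
  by elim: k => [|k IH]; rewrite ?scale1r // exprS -!scalerA c2 IH.
have AZ a x : A (a *: x) = a *: A x.
  have A0 : A 0 = 0 by have := Al (-1) 0 0; rewrite scaler0 addr0 scaleN1r addNr.
  by rewrite -[a *: x]addr0 Al A0 addr0.
apply/funext => x; apply/eqP; rewrite -subr_eq0 -normr_eq0; apply/eqP.
have small k : `|x| <= 2 ^+ k -> `|conj s x - A x| <= C * `|x| ^+ 2 / 2 ^+ k.
  move=> xk; have k0 : 0 < 2 ^+ k :> R by rewrite exprn_gt0.
  have nk : `|2 ^- k : R| = 2 ^- k by rewrite ger0_norm // invr_ge0 ltW.
  have := CP (2 ^- k *: x); rewrite normrZ nk.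
  rewrite ler_pdivrMl // mulr1 => /(_ xk).
  rewrite -!/(conj s _) c0 subr0 -{1}(scalerK (lt0r_neq0 k0) (conj s (2 ^- k *: x))) -ck.
  rewrite scalerA mulfV ?lt0r_neq0 // scale1r AZ -scalerBr normrZ.
  rewrite nk ler_pdivrMl // => /le_trans; apply.
  by rewrite le_eqVlt; apply/orP; left; apply/eqP; field; rewrite lt0r_neq0.
apply/eqP; rewrite eq_le normr_ge0 andbT; apply/ler_addgt0Pl => e e0; rewrite addr0.
pose k := (Num.bound (C * `|x| ^+ 2 / e) + Num.bound `|x|)%N.
have k0 : 0 < 2 ^+ k :> R by rewrite exprn_gt0.
have /small/le_trans : `|x| <= 2 ^+ k by apply/ltW/upper_nthrootP; rewrite leq_addl.
apply; rewrite ler_pdivrMr // -ler_pdivrMl //.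
by rewrite mulrC; apply/ltW/upper_nthrootP; rewrite leq_addr.
Qed.

End Conjugation.

Section ConjugationDerivative.
Variables (R : realType) (n : nat) (G : stratifiedGroup R n).
Local Notation V := 'rV[R]_n.
Local Notation "x ** y" := (gmul G x y) (at level 40, left associativity).
Local Notation br := (bracket G).
Local Notation conj := (conj G).
Local Notation H1 := (layer G 1).

(** Since [conj (t *: y)] is linear, its value at [w] is read off from its value at
    [t *: w], where both arguments of the group law are of order [t] and the
    second order expansion applies. *)
Lemma conj_first_order (w y : V) : exists2 C : R, 0 < C & exists2 T : R, 0 < T &
  forall t, 0 < t <= T -> `|conj (t *: y) w - w - t *: br w y| <= C * t ^+ 2.
Proof.
have [K K0 KP] := bracket_bound G.
have [C C0 CP] := gmul_second_order G.
pose m := 1 + `|w| + `|y|.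
have m0 : 0 < m by rewrite /m -addrA ltr_pwDl // addr_ge0.
pose c1 := K * m ^+ 2 + C * m ^+ 3.
have c10 : 0 < c1 by rewrite addr_gt0 // mulr_gt0 // exprn_gt0.
pose m' := 2 * m + c1; have m'0 : 0 < m' by rewrite addr_gt0 // mulr_gt0.
have mm' : m <= m' by rewrite /m'; lra.
have m1 : 1 <= m by rewrite /m -addrA lerDl addr_ge0.
have wm : `|w| <= m by have := normr_ge0 y; rewrite /m; lra.
have ym : `|y| <= m by have := normr_ge0 w; rewrite /m; lra.
exists (C * m ^+ 3 + C * m' ^+ 3 + K * m * c1).
  by rewrite !addr_gt0 // !mulr_gt0 // exprn_gt0.
exists m'^-1; first by rewrite invr_gt0.
move=> t /andP[t0 tT].
have tm' : t * m' <= 1 by rewrite -ler_pdivlMr // div1r.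
have tm : t * m <= 1 by apply: le_trans tm'; rewrite ler_pM2l.
have t1 : t <= 1 by apply: le_trans tm; rewrite ler_peMr // ltW.
have nt (v : V) : `|t *: v| = t * `|v| by rewrite normrZ gtr0_norm.
have n2 : `|2^-1 : R| = 2^-1 by rewrite ger0_norm.
have tw : `|t *: w| <= t * m by rewrite nt ler_pM2l.
have ty : `|t *: y| <= t * m by rewrite nt ler_pM2l.
set a := (t *: w) ** (t *: y).
have br1 : `|br w y| <= K * m ^+ 2.
  by apply: (le_trans (KP _ _)); rewrite -mulrA expr2 ler_pM2l // ler_pM.
pose r3 := a - (t *: w + t *: y + 2^-1 *: br (t *: w) (t *: y)).
have r3P : `|r3| <= C * m ^+ 3 * t ^+ 3 by rewrite -mulrA -exprMn (mulrC m); apply: CP.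
pose r := a - (t *: w + t *: y).
have brt : br (t *: w) (t *: y) = t ^+ 2 *: br w y.
  by rewrite linearZl_LR linearZr_LR /= scalerA expr2.
have rE : r = 2^-1 *: (t ^+ 2 *: br w y) + r3.
  rewrite /r /r3 brt; move: (a) (br w y) => a' b'.
  by apply/rowP => i; rewrite !mxE; ring.
have rP : `|r| <= c1 * t ^+ 2.
  rewrite rE mulrDl; apply: (le_trans (ler_normD _ _)); apply: lerD.
    have t20 : 0 <= t ^+ 2 by rewrite exprn_ge0 // ltW.
    rewrite normrZ n2 normrZ (ger0_norm t20).
    have : t ^+ 2 * `|br w y| <= K * m ^+ 2 * t ^+ 2.
      by rewrite mulrC ler_pM2r // exprn_gt0.
    have : 0 <= t ^+ 2 * `|br w y| by rewrite mulr_ge0 // exprn_ge0 // ltW.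
    lra.
  apply: (le_trans r3P); rewrite ler_pM2l; last by rewrite mulr_gt0 // exprn_gt0.
  by rewrite exprS ler_piMl // exprn_ge0 // ltW.
have aE : a = t *: w + t *: y + r by rewrite addrC subrK.
have am' : `|a| <= t * m'.
  rewrite aE; apply: (le_trans (ler_normD _ _)).
  have := ler_normD (t *: w) (t *: y); have : c1 * t ^+ 2 <= c1 * t.
    by rewrite ler_pM2l // expr2 ler_piMl // ltW.
  rewrite /m' mulrDr; lra.
have ty' : `|- (t *: y)| <= t * m'.
  by rewrite normrN; apply: (le_trans ty); rewrite ler_pM2l.
pose s3 := - (t *: y) ** a - (- (t *: y) + a + 2^-1 *: br (- (t *: y)) a).
have s3P : `|s3| <= C * m' ^+ 3 * t ^+ 3 by rewrite -mulrA -exprMn (mulrC m'); apply: CP.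
pose E := r3 + s3 - 2^-1 *: (t *: br y r).
have cE : - (t *: y) ** a = t *: w + t ^+ 2 *: br w y + E.
  have -> : - (t *: y) ** a = s3 + (- (t *: y) + a + 2^-1 *: br (- (t *: y)) a) by rewrite subrK.
  have -> : br (- (t *: y)) a = t ^+ 2 *: br w y - t *: br y r.
    rewrite {1}aE linearNl !linearDr /= !linearZl_LR !linearZr_LR /= bracketxx.
    rewrite (bracketC G w y); move: (br w y) (br y r) => b1 b2.
    by apply/rowP => i; rewrite !mxE; ring.
  rewrite /E {1}aE; move: (br y r) => b2; rewrite rE; move: (br w y) (s3) (r3) => b1 s3' r3'.
  by apply/rowP => i; rewrite !mxE; field.
have EP : `|E| <= (C * m ^+ 3 + C * m' ^+ 3 + K * m * c1) * t ^+ 3.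
  rewrite /E; apply: (le_trans (ler_normB _ _)); rewrite !mulrDl; apply: lerD.
    by apply: (le_trans (ler_normD _ _)); apply: lerD.
  rewrite normrZ nt n2.
  have h : `|br y r| <= K * m * (c1 * t ^+ 2).
    by apply: (le_trans (KP _ _)); apply: ler_pM => //; rewrite ?mulr_ge0 ?ler_pM2l // ltW.
  have : t * `|br y r| <= t * (K * m * (c1 * t ^+ 2)) by rewrite ler_pM2l.
  have : 0 <= t * `|br y r| by rewrite mulr_ge0 // ltW.
  rewrite (_ : t * (K * m * (c1 * t ^+ 2)) = K * m * c1 * t ^+ 3); last by ring.
  lra.
pose c : {linear V -> V} := HB.pack (conj (t *: y))
  (GRing.isLinear.Build R V V _ (conj (t *: y)) (conj_linear G (t *: y))).
have := linearZ_LR c t w.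
rewrite /= {1}/conj -gmulA -/a cE => ctE.
have -> : conj (t *: y) w - w - t *: br w y = t^-1 *: E.
  apply: (scalerI (lt0r_neq0 t0)); rewrite scalerA divff ?lt0r_neq0 // scale1r.
  rewrite !scalerBr -ctE scalerA -expr2; move: (E) (br w y) => E' b'.
  by apply/rowP => i; rewrite !mxE; ring.
rewrite normrZ ger0_norm ?invr_ge0 ?(ltW t0) // ler_pdivrMl //.
by apply: (le_trans EP); rewrite [leRHS]mulrCA -exprS.
Qed.


End ConjugationDerivative.

(** * Horizontal words generate all directions *)

Section Words.
Variables (R : realType) (n : nat) (G : stratifiedGroup R n).
Local Notation V := 'rV[R]_n.
Local Notation "x ** y" := (gmul G x y) (at level 40, left associativity).
Local Notation br := (bracket G).
Local Notation conj := (conj G).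
Local Notation H1 := (layer G 1).


HB.instance Definition _ s := GRing.isLinear.Build R V V _ (conj s) (conj_linear G s).

(** Letters are prepended as the length grows: the factor on the right of the
    letter number [i] is the word of length [i], whatever follows. *)
Fixpoint pword (h : nat -> V) (tau : nat -> R) (m : nat) : V :=
  if m is m'.+1 then (tau m' *: h m') ** pword h tau m' else 0.

Lemma pwordD h tau m k : pword h tau (k + m) =
  pword (fun i => h (i + m)%N) (fun i => tau (i + m)%N) k ** pword h tau m.
Proof. by elim: k => [|k IH]; rewrite ?g0mul // addSn /= IH gmulA. Qed.

Lemma eq_pword h h' tau tau' m : (forall i, (i < m)%N -> h i = h' i) ->
  (forall i, (i < m)%N -> tau i = tau' i) -> pword h tau m = pword h' tau' m.
Proof.
elim: m => [|m IH] // hh tt; rewrite /= hh ?tt // IH // => i im; [apply: hh | apply: tt];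
  exact: ltnW.
Qed.

(** The smallest such subspace is invariant under conjugation by horizontal
    vectors, hence, differentiating, under bracketing with them, and the
    horizontal layer generates the Lie algebra. *)
Lemma conj_generates (U : {vspace V}) :
  (forall h k x, (forall i, h i \in H1) -> x \in H1 -> conj (pword h (fun=> 1) k) x \in U) ->
  U = fullv.
Proof.
pose P (W : {vspace V}) := forall h k x, (forall i, h i \in H1) -> x \in H1 ->
  conj (pword h (fun=> 1) k) x \in W.
move=> UP; pose dimP := fun d => `[< exists W, P W /\ \dim W = d >].
have exd : exists d, dimP d by exists (\dim U); apply/asboolP; exists U.
case: (ex_minnP exd) => d /asboolP[W [WP Wd]] dmin.
have WU : (W <= U)%VS.
  have : (\dim W <= \dim (W :&: U))%N.
    rewrite Wd; apply: dmin; apply/asboolP; exists (W :&: U)%VS; split=> // h k x hh hx.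
    by rewrite memv_cap WP // UP.
  by move=> WWU; rewrite -(eqP (_ : (W :&: U)%VS == W)) ?capvSr // eqEdim capvSl.
have Wconj y w : y \in H1 -> w \in W -> conj y w \in W.
  move=> yH wW; pose W' := (W :&: (linfun (conj y) @^-1: W))%VS.
  have WW' : (\dim W <= \dim W')%N.
    rewrite Wd; apply: dmin; apply/asboolP; exists W'; split=> // h k x hh hx.
    rewrite memv_cap WP //= -memv_preim lfunE /= -conj_gmul.
    have -> : pword h (fun=> 1) k ** y = pword (fun i => if i is i'.+1 then h i' else y) (fun=> 1) (k + 1).
      rewrite pwordD /= scale1r gmul0; congr (_ ** _).
      by apply: eq_pword => // i _; rewrite addn1.
    by apply: WP => // -[|i].
  have : w \in W' by rewrite (eqP (_ : W' == W)) // eqEdim capvSl.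
  by rewrite memv_cap -memv_preim lfunE => /andP[].
have H1W : (H1 <= W)%VS.
  by apply/subvP => x xH; have := WP (fun=> 0) 0%N x (fun=> mem0v _) xH; rewrite /= conj0.
have Wbr y w : y \in H1 -> w \in W -> br w y \in W.
  move=> yH wW; have [C C0 [T T0 CT]] := conj_first_order G w y.
  pose f v := v - projv W v.
  have lf : linear f by move=> a u v; rewrite /f linearP scalerBr opprD addrACA.
  have f0 v : (v \in W) = (f v == 0).
    rewrite /f subr_eq0; apply/idP/eqP => [vW|->]; first by rewrite projv_id.
    exact: memv_proj.
  have [D D0 DP] := linear_bound lf.
  rewrite f0 -normr_eq0 eq_le normr_ge0 andbT; apply/ler_addgt0Pl => e e0; rewrite addr0.
  pose t := Num.min T (e / (D * C)).
  have t0 : 0 < t by rewrite lt_min T0 divr_gt0 // mulr_gt0.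
  have tT : 0 < t <= T by rewrite t0 ge_min lexx.
  have := DP (conj (t *: y) w - w - t *: br w y).
  have fW : f (conj (t *: y) w - w) = 0.
    by apply/eqP; rewrite -f0 rpredB // Wconj // memvZ.
  pose F : {linear V -> V} := HB.pack f (GRing.isLinear.Build _ _ _ _ f lf).
  rewrite (_ : f (_ - t *: _) = - (t *: f (br w y))); last first.
    by rewrite -[f]/(F : _ -> _) linearB linearZ /= -/f fW sub0r.
  rewrite normrN normrZ gtr0_norm // => h.
  have {}h : t * `|f (br w y)| <= D * (C * t ^+ 2).
    by apply: (le_trans h); rewrite ler_pM2l // CT.
  have {}h : `|f (br w y)| <= (D * C) * t.
    by rewrite -(ler_pM2l t0) (le_trans h) // expr2 !mulrA mulrC !mulrA.
  apply: (le_trans h); rewrite mulrC -ler_pdivlMr ?mulr_gt0 //.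
  by rewrite ge_min lexx orbT.
have Wideal z w : w \in W -> br w z \in W.
  pose Q (N : {vspace V}) := forall z w, z \in N -> w \in W -> br w z \in W.
  pose dimQ := fun d => `[< exists N, Q N /\ \dim N = d >].
  have exQ : exists d, dimQ d.
    by exists (\dim H1); apply/asboolP; exists H1; split=> // {}z {}w; exact: Wbr.
  have ubQ d' : dimQ d' -> (d' <= \dim (fullv : {vspace V}))%N.
    by move=> /asboolP[N [_ <-]]; rewrite dimvS // subvf.
  case: (ex_maxnP exQ ubQ) => d' /asboolP[N [NQ Nd]] dmax.
  have NP z' : (forall w', w' \in W -> br w' z' \in W) -> z' \in N.
    move=> hz; have QN : Q (N + <[z']>)%VS.
      move=> u w' /memv_addP[u1 u1N [u2 /vlineP[c ->] ->]] w'W.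
      rewrite linearDr linearZr_LR /=; apply: rpredD; first exact: NQ.
      by apply: memvZ; apply: hz.
    have /dmax dd : dimQ (\dim (N + <[z']>)) by apply/asboolP; exists (N + <[z']>)%VS.
    have -> : N = (N + <[z']>)%VS by apply/eqP; rewrite eqEdim addvSl Nd.
    by rewrite (subvP (addvSr _ _)) // memv_line.
  have NE : N = fullv.
    apply: (layer1_generates (s := G)).
      by apply/subvP => y yH; apply: NP => w' /Wbr; apply.
    move=> x y xN yN; apply: NP => w' w'W.
    have := bracket_jacobi G w' x y; rewrite -addrA => /eqP; rewrite addr_eq0 => /eqP ->.
    rewrite rpredN rpredD // [br _ (br _ _)]bracketC rpredN NQ //.
      by rewrite bracketC rpredN NQ.
    by rewrite NQ.
  by move=> wW; apply: NQ => //; rewrite NE memvf.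
have WE : W = fullv by apply: (layer1_generates (s := G)) => // x y xW yW; exact: Wideal.
by apply/eqP; rewrite eqEsubv subvf /= -WE.
Qed.


(** As long as the conjugates found along a word span a proper subspace,
    [conj_generates] yields a longer word with one more independent conjugate. *)
Lemma horizontal_frame : exists h m (s : seq nat), [/\ forall i, h i \in H1,
  size s = n, all (fun i => i < m)%N s &
  free [seq conj (pword h (fun=> 1) i) (h i) | i <- s]].
Proof.
suff: forall k, (k <= n)%N -> exists h m (s : seq nat), [/\ forall i, h i \in H1,
  size s = k, all (fun i => i < m)%N s &
  free [seq conj (pword h (fun=> 1) i) (h i) | i <- s]] by apply.
elim=> [_|k IH kn].
  by exists (fun=> 0), 0%N, [::]; split=> // [i|]; [exact: mem0v | exact: nil_free].
have [h [m [s [hH sk sm sf]]]] := IH (ltnW kn).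
set X := [seq _ | _ <- _] in sf; set P := pword h (fun=> 1) m.
have [g [l [x [gH xH gxX]]]] : exists g l x, [/\ forall i, g i \in H1, x \in H1 &
    conj (pword g (fun=> 1) l ** P) x \notin <<X>>%VS].
  apply: contrapT => no.
  have : (linfun (conj P) @^-1: <<X>>)%VS = fullv.
    apply: conj_generates => g l x gH xH; rewrite -memv_preim lfunE /= -conj_gmul.
    by apply: contrapT => /negP gx; apply: no; exists g, l, x.
  move=> full; have : <<X>>%VS = fullv.
    apply/vspaceP => v; rewrite memvf -(conjN_K G P v).
    by have := memvf (conj (- P) v); rewrite -full -memv_preim lfunE.
  move/(congr1 (fun U : {vspace _} => \dim U)); rewrite (eqP sf) dimvf /dim /= mul1n size_map sk.
  by move=> kn'; move: kn; rewrite kn' ltnn.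
pose h' i := if (i < m)%N then h i else if (i < l + m)%N then g (i - m)%N else x.
have h'P i : (i <= m)%N -> pword h' (fun=> 1) i = pword h (fun=> 1) i.
  by move=> im; apply: eq_pword => // j ji; rewrite /h' (leq_trans ji).
exists h', (l + m).+1, (l + m :: s)%N; split=> [i| | |].
- by rewrite /h'; case: ifP => // _; case: ifP.
- by rewrite /= sk.
- by rewrite /= ltnSn; apply: sub_all sm => i im; rewrite ltnS ltnW // ltn_addl.
- rewrite /= free_cons.
  have -> : [seq conj (pword h' (fun=> 1) i) (h' i) | i <- s] = X.
    apply/eq_in_map => i /(allP sm) im; rewrite (h'P i (ltnW im)).
    by rewrite /h' im.
  have Pm := h'P m (leqnn m).
  rewrite sf andbT pwordD Pm.
  rewrite (@eq_pword _ g _ (fun=> 1)) => [|i il|//]; last first.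
    by rewrite /h' ltnNge leq_addl /= ltn_add2r il addnK.
  by rewrite /h' !ltnNge leq_addl leqnn.
Qed.

End Words.

(** * Generic horizontal words *)

Section Generic.
Variables (R : realType) (n : nat) (G : stratifiedGroup R n).
Local Notation V := 'rV[R]_n.
Local Notation "x ** y" := (gmul G x y) (at level 40, left associativity).
Local Notation br := (bracket G).
Local Notation conj := (conj G).
Local Notation H1 := (layer G 1).

Definition polynomial_curve (f : R -> V) :=
  exists q : 'I_n -> {poly R}, forall t i, f t ord0 i = (q i).[t].

Lemma polynomial_curve_cst v : polynomial_curve (fun=> v).
Proof. by exists (fun i => (v ord0 i)%:P) => t i; rewrite hornerC. Qed.

Lemma polynomial_curve_line a b v : polynomial_curve (fun t => (a + t * b) *: v).
Proof.
exists (fun i => ((a%:P + b *: 'X) * (v ord0 i)%:P)) => t i.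
by rewrite !hornerE mxE (mulrC b).
Qed.

Lemma polynomial_curveD f g : polynomial_curve f -> polynomial_curve g ->
  polynomial_curve (fun t => f t + g t).
Proof.
by move=> [p pE] [q qE]; exists (fun i => p i + q i) => t i; rewrite mxE pE qE hornerD.
Qed.

Lemma polynomial_curveZ a f : polynomial_curve f -> polynomial_curve (fun t => a *: f t).
Proof. by move=> [p pE]; exists (fun i => a *: p i) => t i; rewrite mxE pE hornerZ. Qed.

Lemma polynomial_curveN f : polynomial_curve f -> polynomial_curve (fun t => - f t).
Proof. by move=> [p pE]; exists (fun i => - p i) => t i; rewrite mxE pE hornerN. Qed.

Lemma polynomial_curve_bracket f g : polynomial_curve f -> polynomial_curve g ->
  polynomial_curve (fun t => br (f t) (g t)).
Proof.
move=> [p pE] [q qE].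
exists (fun i => \sum_a \sum_b p a * q b * (br (delta_mx ord0 a) (delta_mx ord0 b) ord0 i)%:P).
move=> t i; rewrite {1}(row_sum_delta (f t)) linear_sumlz summxE horner_sum.
apply: eq_bigr => a _; rewrite {1}(row_sum_delta (g t)) linearZl_LR mxE linear_sumr.
rewrite summxE mulr_sumr horner_sum.
by apply: eq_bigr => b _; rewrite linearZr_LR mxE mulrA !hornerM hornerC -pE -qE.
Qed.

Lemma polynomial_curve_gmul f g : polynomial_curve f -> polynomial_curve g ->
  polynomial_curve (fun t => f t ** g t).
Proof.
move=> df dg; have [T [T3 TE]] := gmul_expansion G.
have -> : (fun z => f z ** g z) = (fun z => f z + g z + 2^-1 *: br (f z) (g z)
    + \sum_(t <- T) t.1 *: bracket_word br t.2 (f z) (g z)) by apply/funext => z.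
apply: polynomial_curveD.
  apply: polynomial_curveD; first exact: polynomial_curveD.
  by apply: polynomial_curveZ; exact: polynomial_curve_bracket.
elim: T {T3 TE} => [|[c p] T IH].
  by under [X in polynomial_curve X]eq_fun do rewrite big_nil; exact: polynomial_curve_cst.
under [X in polynomial_curve X]eq_fun do rewrite big_cons.
apply: polynomial_curveD IH; apply: polynomial_curveZ; elim: p => [|e p IH].
  exact: polynomial_curve_cst.
have dfg : polynomial_curve (fun z => if e then f z else g z) by case: (e).
case: p IH => [|e' p] IH; first exact: dfg.
exact: (polynomial_curve_bracket dfg IH).
Qed.

Lemma polynomial_curve_pword h a b m :
  polynomial_curve (fun t => pword G h (fun i => a i + t * b i) m).
Proof.
elim: m => [|m IH] /=; first exact: polynomial_curve_cst.
by apply: polynomial_curve_gmul => //; exact: polynomial_curve_line.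
Qed.

Lemma poly_nonroot (q : {poly R}) d : q != 0 -> 0 < d -> exists2 t, 0 < t <= d & q.[t] != 0.
Proof.
move=> q0 d0; apply: contrapT => no.
pose rs := mkseq (fun k => d / k.+1%:R) (size q).
suff : (size rs < size q)%N by rewrite size_mkseq ltnn.
apply: max_poly_roots => //.
  apply/allP => _ /mapP[k _ ->]; apply: contrapT => /negP kr; apply: no.
  exists (d / k.+1%:R) => //; rewrite divr_gt0 //= ler_pdivrMr //.
  by rewrite ler_pMr // ler1n.
rewrite map_inj_uniq ?iota_uniq // => i j /(mulfI (lt0r_neq0 d0)) /invr_inj /eqP.
by rewrite eqr_nat eqSS => /eqP.
Qed.

(** A nonzero polynomial has finitely many roots: a point that is good for some of
    the functions can be moved along the line to a point that is good for another
    one, and then along the line to 0, and stay good. *)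
Lemma common_nonzero (I : finType) (D : I -> (nat -> R) -> R) :
  (forall i a b, exists q : {poly R}, forall t, D i (fun k => a k + t * b k) = q.[t]) ->
  (forall i, exists tau, D i tau != 0) ->
  exists tau, forall t0, 0 < t0 -> exists2 t, 0 < t <= t0 & forall i, D i (fun k => t * tau k) != 0.
Proof.
move=> Dpoly Dnz.
have [tau tauP] : exists tau, forall i, i \in enum I -> D i tau != 0.
  elim: (enum I) => [|i r [tau IH]]; first by exists (fun=> 0).
  have [sigma sigmaP] := Dnz i.
  pose q j := projT1 (cid (Dpoly j tau (fun k => sigma k - tau k))).
  have qP j t : D j (fun k => tau k + t * (sigma k - tau k)) = (q j).[t].
    by rewrite /q; case: cid.
  have q0 j : (j \in i :: r) -> q j != 0.
    rewrite inE => /orP[/eqP ->|jr].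
      apply/eqP => qi; move: sigmaP; have := qP i 1; rewrite qi horner0.
      by under eq_fun do rewrite mul1r addrC subrK; move=> ->; rewrite eqxx.
    apply/eqP => qj; move: (IH j jr); have := qP j 0; rewrite qj horner0.
    by under eq_fun do rewrite mul0r addr0; move=> ->; rewrite eqxx.
  have [|t _ tP] := @poly_nonroot (\prod_(j <- i :: r) q j) 1 _ ltr01.
    by rewrite prodf_seq_neq0; apply/allP => j /q0.
  exists (fun k => tau k + t * (sigma k - tau k)) => j jr; rewrite qP.
  by move: tP; rewrite horner_prod prodf_seq_neq0 => /allP /(_ j jr).
exists tau => t0 t00.
pose q j := projT1 (cid (Dpoly j (fun=> 0) tau)).
have qP j t : D j (fun k => t * tau k) = (q j).[t].
  by rewrite /q; case: cid => /= p <-; congr D; apply/funext => k; rewrite add0r.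
have [|t tt tP] := @poly_nonroot (\prod_j q j) t0 _ t00.
  apply/prodf_neq0 => j _; apply/eqP => qj.
  have := tauP j (mem_enum _ _); have := qP j 1; rewrite qj horner0.
  by under eq_fun do rewrite mul1r; move=> ->; rewrite eqxx.
exists t => // i; rewrite qP; move: tP; rewrite horner_prod.
by move=> /prodf_neq0 /(_ i isT).
Qed.

Definition signed (eps : seq bool) (tau : nat -> R) (i : nat) : R :=
  (-1) ^+ nth false eps i * tau i.

(** The row [j] is the velocity of the word, translated to the unit, when the
    coefficient of its letter number [nth 0 s j] moves. *)
Definition frame (h : nat -> V) (s : seq nat) (tau : nat -> R) : 'M[R]_n :=
  \matrix_(j < n) conj (pword G h tau (nth 0%N s j)) (h (nth 0%N s j)).

Lemma det_frame_poly h s a b : exists q : {poly R}, forall t,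
  \det (frame h s (fun k => a k + t * b k)) = q.[t].
Proof.
have c j : polynomial_curve (fun t => conj (pword G h (fun k => a k + t * b k) j) (h j)).
  rewrite /conj; apply: polynomial_curve_gmul; last exact: polynomial_curve_pword.
  apply: polynomial_curve_gmul; last exact: polynomial_curve_cst.
  by apply: polynomial_curveN; exact: polynomial_curve_pword.
pose q j := projT1 (cid (c j)).
have qP j t i : conj (pword G h (fun k => a k + t * b k) j) (h j) ord0 i = (q j i).[t].
  by rewrite /q; case: cid.
pose Q := \matrix_(j < n, i < n) q (nth 0%N s j) i.
exists (\det Q) => t; rewrite -[RHS]/(horner_eval t (\det Q)) -det_map_mx.
by congr determinant; apply/matrixP => j i; rewrite !mxE qP.
Qed.

Lemma free_frame h s tau : size s = n ->
  free [seq conj (pword G h tau i) (h i) | i <- s] -> \det (frame h s tau) != 0.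
Proof.
move=> sn; set X := [seq _ | _ <- _] => fX.
have sX : size X == n by rewrite size_map sn.
rewrite -unitfE -[_ \is a GRing.unit]/(frame h s tau \in unitmx) -row_free_unit.
apply: inj_row_free => v vM; apply/rowP => i; rewrite mxE.
have /freeP fX' : free (Tuple sX) by [].
rewrite (fX' (fun i => v ord0 i)) //.
apply/rowP => j; have /rowP/(_ j) := vM; rewrite !mxE => vj.
rewrite -[RHS]vj summxE; apply: eq_bigr => k _; rewrite !mxE /=.
by rewrite (nth_map 0%N) // sn.
Qed.

(** The determinants of the frames for the [2 ^ m] choices of signs are polynomials
    in the coefficients. None of them vanishes identically, because a
    change of signs is a bijection of the coefficients. *)
Lemma generic_word : exists h m (s : seq nat), [/\ forall i, h i \in H1,
  uniq s, size s = n, all (fun i => i < m)%N s &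
  forall rho, 0 < rho -> exists tau, (forall i, (i < m)%N -> `|tau i| <= rho) /\
    forall eps : m.-tuple bool, frame h s (signed eps tau) \in unitmx].
Proof.
have [h [m [s [hH sn sm sf]]]] := horizontal_frame G.
have us : uniq s.
  by have := free_uniq sf; apply: map_uniq.
exists h, m, s; split=> // rho rho0.
have := @common_nonzero _ (fun (eps : m.-tuple bool) tau => \det (frame h s (signed eps tau))).
case=> [eps a b|eps|tau tauP].
- have [q qP] := det_frame_poly h s (signed eps a) (signed eps b).
  exists q => t; rewrite -qP; congr (\det (frame _ _ _)); apply/funext => k.
  by rewrite /signed mulrDr mulrCA.
- exists (fun i => (-1) ^+ nth false eps i).
  rewrite (_ : signed _ _ = fun=> 1); first exact: free_frame.
  by apply/funext => i; rewrite /signed -expr2 sqrr_sign.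
- pose M := 1 + \sum_(i < m) `|tau i|.
  have M0 : 0 < M by rewrite ltr_pwDl // sumr_ge0.
  have [|t /andP[t0 tr] tP] := tauP (rho / M); first exact: divr_gt0.
  exists (fun k => t * tau k); split; last by move=> eps; rewrite unitmxE unitfE.
  move=> i im; rewrite normrM gtr0_norm //.
  apply: (@le_trans _ _ (t * M)); last by rewrite -ler_pdivlMr.
  rewrite ler_pM2l // /M (bigD1 (Ordinal im)) //= addrCA lerDl addr_ge0 // sumr_ge0 //.
Qed.

End Generic.

(** * Strict differentiability and local surjectivity *)

Section StrictDerivative.
Variables (R : realType) (n : nat).
Local Notation V := 'rV[R]_n.

Lemma continuous_withinP (W W' : normedModType R) (A : set W) (f : W -> W') :
  (forall x, A x -> forall e, 0 < e -> exists2 d, 0 < d &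
    forall y, A y -> `|x - y| < d -> `|f x - f y| <= e) ->
  {within A, continuous f}.
Proof.
move=> fA; apply/subspace_continuousP => x Ax; apply/cvgrPdist_le => e e0.
have [d d0 dP] := fA x Ax e e0.
apply/nbhs_ballP; exists d => //= y; rewrite -ball_normE /= => xy Ay; exact: dP.
Qed.

Lemma compact_norm_ball (x : V) r : compact [set y : V | `|x - y| <= r].
Proof.
apply: bounded_closed_compact.
  exists (`|x| + `|r|); split; first by rewrite realE addr_ge0.
  move=> M xM y /= xy; apply: ltW; apply: le_lt_trans xM.
  rewrite -[y](subKr x); apply: (le_trans (ler_normB _ _)); rewrite lerD2l.
  by apply: (le_trans xy); exact: ler_norm.
have -> : [set y : V | `|x - y| <= r] = (fun y => `|x - y|) @^-1` [set t : R | t <= r] by [].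
apply: preimage_closed; last exact: closed_le.
move=> y _; apply: continuous_comp; last exact: norm_continuous.
by apply: continuousB; [exact: cst_continuous | exact: id].
Qed.

(** Differentiability at a single point would not give the two-sided Lipschitz
    bounds that are needed near this point; the strict version does. *)
Definition strict_derivative0 (f A : V -> V) := [/\ f 0 = 0, linear A &
  forall eta : R, 0 < eta -> exists2 r : R, 0 < r & forall v v' : V, `|v| <= r -> `|v'| <= r ->
    `|f v - f v' - A (v - v')| <= eta * `|v - v'|].

Lemma strict_derivative0_linear A : linear A -> strict_derivative0 A A.
Proof.
move=> Al; pose L : {linear V -> V} := HB.pack A (GRing.isLinear.Build _ _ _ _ A Al).
split=> //; first exact: (linear0 L).
by move=> e e0; exists 1 => // v v' _ _; rewrite -[A]/(L : V -> V) linearB subrr normr0 mulr_ge0 // ltW.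
Qed.

Lemma strict_derivative0_gmul (G : stratifiedGroup R n) f A g B :
  strict_derivative0 f A -> strict_derivative0 g B ->
  strict_derivative0 (fun v => gmul G (f v) (g v)) (fun v => A v + B v).
Proof.
move=> [f0 Al fP] [g0 Bl gP]; split.
- by rewrite f0 g0 gmul0.
- by move=> a u v; rewrite Al Bl scalerDr addrACA.
move=> e e0; have [C C0 CP] := gmul_near0 G.
have [a a0 aP] := linear_bound Al; have [b b0 bP] := linear_bound Bl.
have [|r1 r10 r1P] := fP (Num.min 1 (e / 3)).
  by rewrite lt_min ltr01 divr_gt0.
have [|r2 r20 r2P] := gP (Num.min 1 (e / 3)).
  by rewrite lt_min ltr01 divr_gt0.
pose L := 1 + a + b; have L0 : 0 < L by rewrite !addr_gt0.
pose rho := Num.min 1 (e / (6 * C * L)).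
have rho0 : 0 < rho by rewrite lt_min ltr01 divr_gt0 // !mulr_gt0.
have [m1 m2] : Num.min 1 (e / 3) <= 1 /\ Num.min 1 (e / 3) <= e / 3.
  by split; rewrite ge_min lexx ?orbT.
exists (Num.min (Num.min r1 r2) (rho / L)).
  by rewrite !lt_min r10 r20 divr_gt0.
move=> v v'; rewrite !le_min => /andP[/andP[v1 v2] v3] /andP[/andP[v'1 v'2] v'3].
have lipf w w' : `|w| <= r1 -> `|w'| <= r1 -> `|f w - f w'| <= L * `|w - w'|.
  move=> w1 w'1; rewrite -(subrK (A (w - w')) (f w - f w')).
  apply: (le_trans (ler_normD _ _)); have := r1P _ _ w1 w'1; have := aP (w - w').
  have : Num.min 1 (e / 3) * `|w - w'| <= `|w - w'| by rewrite ler_piMl.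
  have : 0 <= b * `|w - w'| by rewrite mulr_ge0 // ltW.
  by rewrite /L !mulrDl mul1r; lra.
have lipg w w' : `|w| <= r2 -> `|w'| <= r2 -> `|g w - g w'| <= L * `|w - w'|.
  move=> w1 w'1; rewrite -(subrK (B (w - w')) (g w - g w')).
  apply: (le_trans (ler_normD _ _)); have := r2P _ _ w1 w'1; have := bP (w - w').
  have : Num.min 1 (e / 3) * `|w - w'| <= `|w - w'| by rewrite ler_piMl.
  have : 0 <= a * `|w - w'| by rewrite mulr_ge0 // ltW.
  by rewrite /L !mulrDl mul1r; lra.
have bf w : `|w| <= r1 -> `|w| <= rho / L -> `|f w| <= rho.
  move=> w1 w3; have := lipf w 0 w1; rewrite normr0 f0 !subr0 => /(_ (ltW r10)) /le_trans; apply.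
  by rewrite mulrC -ler_pdivlMr.
have bg w : `|w| <= r2 -> `|w| <= rho / L -> `|g w| <= rho.
  move=> w1 w3; have := lipg w 0 w1; rewrite normr0 g0 !subr0 => /(_ (ltW r20)) /le_trans; apply.
  by rewrite mulrC -ler_pdivlMr.
have rho1 : rho <= 1 by rewrite ge_min lexx.
have := CP rho (f v) (g v) (f v') (g v') rho1 (bf _ v1 v3) (bg _ v2 v3) (bf _ v'1 v'3) (bg _ v'2 v'3).
set rem := (_ - _ - _) => remP.
have -> : gmul G (f v) (g v) - gmul G (f v') (g v') - (A (v - v') + B (v - v')) =
   rem + (f v - f v' - A (v - v')) + (g v - g v' - B (v - v')).
  rewrite /rem; move: (gmul G (f v) (g v)) (gmul G (f v') (g v')) => *.
  move: (A _) (B _) (f v) (f v') (g v) (g v') => *.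
  by apply/rowP => i; rewrite !mxE; ring.
have d0 := normr_ge0 (v - v').
have h1 : `|rem| <= e / 3 * `|v - v'|.
  apply: (le_trans remP).
  apply: (@le_trans _ _ (C * rho * (L * `|v - v'| + L * `|v - v'|))).
    by rewrite ler_pM2l ?mulr_gt0 // lerD // ?lipf ?lipg.
  have : rho * (6 * C * L) <= e by rewrite -ler_pdivlMr ?mulr_gt0 // ge_min lexx orbT.
  move=> h; have : rho * (6 * C * L) * `|v - v'| <= e * `|v - v'| by rewrite ler_wpM2r.
  by lra.
have h2 : `|f v - f v' - A (v - v')| <= e / 3 * `|v - v'|.
  by apply: (le_trans (r1P _ _ v1 v'1)); rewrite ler_wpM2r.
have h3 : `|g v - g v' - B (v - v')| <= e / 3 * `|v - v'|.
  by apply: (le_trans (r2P _ _ v2 v'2)); rewrite ler_wpM2r.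
apply: (le_trans (ler_normD _ _)); have := ler_normD rem (f v - f v' - A (v - v')).
lra.
Qed.

Lemma mulmx_bound (B : 'M[R]_n) : exists2 C : R, 0 < C & forall v : V, `|v *m B| <= C * `|v|.
Proof. by apply: linear_bound => a u v; rewrite mulmxDl scalemxAl. Qed.

Lemma strict_derivative0_expanding f (B : 'M[R]_n) : B \in unitmx ->
  strict_derivative0 f (mulmxr B) -> exists2 c : R, 0 < c & exists2 r : R, 0 < r &
  forall v v' : V, `|v| <= r -> `|v'| <= r -> c * `|v - v'| <= `|f v - f v'|.
Proof.
move=> Bu [f0 _ fP]; have [C C0 CP] := mulmx_bound (invmx B).
exists (C^-1 / 2); first by rewrite divr_gt0 // invr_gt0.
have [|r r0 rP] := fP (C^-1 / 2); first by rewrite divr_gt0 // invr_gt0.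
exists r => // v v' vr v'r.
have h : C^-1 * `|v - v'| <= `|(v - v') *m B|.
  by rewrite ler_pdivrMl // (le_trans _ (CP _)) // mulmxK.
have := rP v v' vr v'r; rewrite /= => h'.
have : `|(v - v') *m B| <= `|f v - f v'| + `|f v - f v' - (v - v') *m B|.
  by rewrite -{1}(subKr (f v - f v') ((v - v') *m B)) ler_normB.
lra.
Qed.

(** The point of a small ball at which the distance from [f] to [w] is minimal is a
    solution: otherwise the Newton step with the fixed slope [B] would decrease
    this distance. *)
Lemma strict_derivative0_onto f (B : 'M[R]_n) : B \in unitmx ->
  strict_derivative0 f (mulmxr B) -> forall r : R, 0 < r -> exists2 d : R, 0 < d &
  forall w : V, `|w| <= d -> exists2 v : V, `|v| <= r & f v = w.
Proof.
move=> Bu [f0 _ fP] r r0; have [C C0 CP] := mulmx_bound (invmx B).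
have [|r1 r10 r1P] := fP ((2 * C)^-1); first by rewrite invr_gt0 mulr_gt0.
pose r2 := Num.min r r1; have r20 : 0 < r2 by rewrite lt_min r0.
pose Z v := f v *m invmx B.
have ZP v v' : `|v| <= r2 -> `|v'| <= r2 -> `|Z v - Z v' - (v - v')| <= 2^-1 * `|v - v'|.
  rewrite /r2 !le_min => /andP[_ h] /andP[_ h'].
  rewrite -[X in _ - X](mulmxK Bu) /Z -mulmxBl -mulmxBl.
  apply: (le_trans (CP _)); rewrite -ler_pdivlMl // mulrA -invfM (mulrC C).
  exact: r1P.
have Z0 : Z 0 = 0 by rewrite /Z f0 mul0mx.
exists (r2 / (2 * C)); first by rewrite divr_gt0 // mulr_gt0.
move=> w wd; set w' := w *m invmx B.
have w'r : `|w'| <= r2 / 2.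
  apply: (le_trans (CP _)); rewrite -ler_pdivlMl //; apply: (le_trans wd).
  by rewrite invfM mulrA (mulrC _ C^-1) mulrA.
pose K := [set v : V | `|0 - v| <= r2].
have [] := @compact_EVT_min _ _ (fun v => `|Z v - w'|) K.
- by exists 0; rewrite /K /= subrr normr0 ltW.
- exact: compact_norm_ball.
- apply: continuous_withinP => x; rewrite /K /= sub0r normrN => xr e e0.
  exists (e / 2); rewrite ?divr_gt0 // => y; rewrite sub0r normrN => yr xy.
  apply: (le_trans (ler_dist_dist _ _)); rewrite opprB addrA subrK.
  rewrite -(subrK (x - y) (Z x - Z y)); apply: (le_trans (ler_normD _ _)).
  by have := ZP x y xr yr; lra.
move=> v; rewrite inE /K /= sub0r normrN => vr vmin.
exists v; first by apply: (le_trans vr); rewrite ge_min lexx.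
pose v1 := v - (Z v - w').
have v1r : `|v1| <= r2.
  have -> : v1 = w' - (Z v - Z 0 - (v - 0)).
    by rewrite Z0 /v1; move: (Z v) (w') => *; apply/rowP => i; rewrite !mxE; ring.
  apply: (le_trans (ler_normB _ _)); have := ZP v 0 vr; rewrite normr0 => /(_ (ltW r20)).
  by rewrite (subr0 v); lra.
have := vmin v1; rewrite inE /K /= sub0r normrN => /(_ v1r).
have := ZP v1 v v1r vr.
rewrite (_ : _ - _ - _ = Z v1 - w'); last first.
  move: (Z v1); rewrite /v1; move: (Z v) (w') => *.
  by apply/rowP => i; rewrite !mxE; ring.
rewrite (_ : v1 - v = - (Z v - w')); last first.
  rewrite /v1; move: (Z v) (w') => *.
  by apply/rowP => i; rewrite !mxE; ring.
rewrite normrN => h1 h2.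
have : `|Z v - w'| = 0 by apply/eqP; rewrite eq_le normr_ge0 andbT; have := normr_ge0 (Z v - w'); lra.
by move/normr0_eq0/eqP; rewrite subr_eq0 /Z => /eqP /(can_inj (mulmxKV Bu)).
Qed.

End StrictDerivative.

(** * Perturbations of horizontal words *)

Section Words.
Variables (R : realType) (n : nat) (G : stratifiedGroup R n).
Local Notation V := 'rV[R]_n.
Local Notation "x ** y" := (gmul G x y) (at level 40, left associativity).
Local Notation H1 := (layer G 1).
Local Notation conj := (conj G).
Local Notation pword := (pword G).

(** Prepending a letter multiplies the displacement on the left by the conjugate of
    the increment of this letter, and near the unit products add up to first
    order. *)
Lemma pword_strict_derivative h tau (J : nat -> V -> R) :
  (forall i a u v, J i (a *: u + v) = a * J i u + J i v) -> forall k,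
  strict_derivative0 (fun v => - pword h tau k ** pword h (fun i => tau i + J i v) k)
    (fun v => \sum_(i < k) J i v *: conj (pword h tau i) (h i)).
Proof.
move=> Jl; elim=> [|k IH].
  have -> : (fun v => - pword h tau 0 ** pword h (fun i => tau i + J i v) 0) = fun=> 0.
    by apply/funext => v; rewrite /= gNmul.
  have -> : (fun v => \sum_(i < 0) J i v *: conj (pword h tau i) (h i)) = fun=> 0.
    by apply/funext => v; rewrite big_ord0.
  by apply: strict_derivative0_linear => a u v; rewrite scaler0 addr0.
have -> : (fun v => - pword h tau k.+1 ** pword h (fun i => tau i + J i v) k.+1) =
    (fun v => (J k v *: conj (pword h tau k) (h k))
       ** (- pword h tau k ** pword h (fun i => tau i + J i v) k)).
  apply/funext => v; rewrite /= goppM.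
  have -> : J k v *: conj (pword h tau k) (h k) = conj (pword h tau k) (J k v *: h k).
    by rewrite linearZ.
  have -> : J k v *: h k = - (tau k *: h k) ** ((tau k + J k v) *: h k).
    by rewrite -scaleNr gmulZZ addrA addNr add0r.
  by rewrite /conj !gmulA gmulK.
have -> : (fun v => \sum_(i < k.+1) J i v *: conj (pword h tau i) (h i)) =
    (fun v => J k v *: conj (pword h tau k) (h k)
       + \sum_(i < k) J i v *: conj (pword h tau i) (h i)).
  by apply/funext => v; rewrite big_ord_recr addrC.
apply: strict_derivative0_gmul IH; apply: strict_derivative0_linear => a u v.
by rewrite Jl scalerDl scalerA.
Qed.

(** Only the letters whose number is listed in [s] are perturbed, each one by its own
    coordinate of [v]. *)
Definition slot (s : seq nat) (i : nat) (v : V) : R :=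
  oapp (fun j : 'I_n => v ord0 j) 0 (insub (index i s)).

Lemma slot_linear s i a u v : slot s i (a *: u + v) = a * slot s i u + slot s i v.
Proof. by rewrite /slot; case: insub => [j|] /=; rewrite ?mxE // mulr0 addr0. Qed.

Lemma slot_bound s i v : `|slot s i v| <= `|v|.
Proof.
by rewrite /slot; case: insub => [j|] /=; [exact: coord_le_norm | rewrite normr0].
Qed.

Lemma word_strict_derivative h m s eps tau : uniq s -> size s = n ->
  all (fun i => i < m)%N s -> frame G h s (signed eps tau) \in unitmx ->
  exists2 B : 'M[R]_n, B \in unitmx &
  strict_derivative0 (fun v => - pword h (signed eps tau) m
     ** pword h (fun i => signed eps tau i + (-1) ^+ nth false eps i * slot s i v) m)
    (mulmxr B).
Proof.
move=> us sn sm Fu.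
pose d : V := \row_j (-1) ^+ nth false eps (nth 0%N s j).
exists (diag_mx d *m frame G h s (signed eps tau)).
  rewrite unitmx_mul Fu andbT unitmxE det_diag unitfE; apply/prodf_neq0 => j _.
  by rewrite mxE signr_eq0.
have Jl i a u v : (-1) ^+ nth false eps i * slot s i (a *: u + v) =
    a * ((-1) ^+ nth false eps i * slot s i u) + (-1) ^+ nth false eps i * slot s i v.
  by rewrite slot_linear; ring.
have := pword_strict_derivative h (signed eps tau) Jl m.
rewrite (_ : (fun v => \sum_(i < m) _) = mulmxr (diag_mx d *m frame G h s (signed eps tau))) //.
apply/funext => v /=; rewrite mulmxA mul_mx_diag mulmx_sum_row.
rewrite -(big_mkord xpredT (fun i => ((-1) ^+ nth false eps i * slot s i v)
   *: conj (pword h (signed eps tau) i) (h i))) /index_iota subn0.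
rewrite (bigID (mem s)) /= [X in _ + X]big1 ?addr0 => [|i si]; last first.
  rewrite /slot insubF ?mulr0 ?scale0r // ltnNge -sn; move: si.
  by rewrite -index_mem -leqNgt => ->.
rewrite -big_filter (perm_big s) /=; last first.
  apply: uniq_perm => //; first by rewrite filter_uniq // iota_uniq.
  move=> i; rewrite mem_filter mem_iota /= add0n andb_idr //; exact: (allP sm).
rewrite (big_nth 0%N) sn big_mkord; apply: eq_bigr => j _.
rewrite !mxE /slot index_uniq ?sn // valK /= mulrC; congr (_ *: _).
by apply/rowP => i; rewrite !mxE.
Qed.

End Words.

(** * Dilations and horizontal paths *)

Section Connectivity.
Variables (R : realType) (n : nat) (G : stratifiedGroup R n).
Local Notation V := 'rV[R]_n.
Local Notation "x ** y" := (gmul G x y) (at level 40, left associativity).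
Local Notation H1 := (layer G 1).
Local Notation br := (bracket G).
Local Notation pword := (pword G).
Local Notation dil := (dil G).

Definition gprod (l : seq V) : V := foldr (gmul G) 0 l.

Lemma gprod_cat l l' : gprod (l ++ l') = gprod l ** gprod l'.
Proof. by elim: l => [|x l IH] /=; rewrite ?g0mul // IH gmulA. Qed.

Lemma gprod_opp l : - gprod l = gprod (rev (map -%R l)).
Proof.
elim: l => [|x l IH] /=; first by rewrite oppr0.
by rewrite goppM IH rev_cons -cats1 gprod_cat /= gmul0.
Qed.

Lemma pwordE h tau m : pword h tau m = gprod [seq tau i *: h i | i <- rev (iota 0 m)].
Proof.
elim: m => [|m IH] //.
have -> : iota 0 m.+1 = rcons (iota 0 m) m by rewrite -{1}addn1 iotaD cats1.
by rewrite rev_rcons /= -IH.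
Qed.

Lemma layer_component j k x : (1 <= k <= step G)%N -> x \in layer G j ->
  component G k x = if k == j then x else 0.
Proof.
move=> ks xj.
have dl : directv (\sum_(i < step G) layer G i.+1)%VS.
  by have := layer_direct G; rewrite !directvE /= !big_add1 /= !big_mkord.
pose us (i : 'I_(step G)) := component G i.+1 x.
pose vs (i : 'I_(step G)) := if i.+1 == j then x else 0.
have sx : \sum_(i < step G) us i = x.
  transitivity (\sum_(1 <= i < (step G).+1) component G i x).
    by rewrite big_add1 /= big_mkord.
  by apply: sumv_pi_nat_sum; rewrite layer_full memvf.
have vx : \sum_(i < step G) vs i = x.
  have [j1|j1] := boolP (1 <= j <= step G)%N; last first.
    have x0 : x = 0 by move: xj; rewrite layer_out // memv0 => /eqP.
    by rewrite big1 // => i _; rewrite /vs x0; case: ifP.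
  have /andP[j0 js] := j1; have ji : (j.-1 < step G)%N by rewrite prednK.
  rewrite (bigD1 (Ordinal ji)) //= /vs /= prednK // eqxx big1 ?addr0 // => i.
  by rewrite -val_eqE /= => ij; case: eqP => // ij'; move: ij; rewrite -ij' eqxx.
have /andP[k0 kS] := ks; have ki : (k.-1 < step G)%N by rewrite prednK.
have := directv_sum_unique dl us vs.
rewrite sx vx eqxx => /(_ _ _)/esym/forallP hh.
have {}hh : forall i, us i = vs i.
  move=> i; apply/eqP; apply: (implyP (hh _ _ i)) => // {}i _; first exact: memv_sum_pi.
  by rewrite /vs; case: eqP => [->|_] //; exact: mem0v.
by have := hh (Ordinal ki); rewrite /us /vs /= prednK.
Qed.

Lemma dil_layer j r x : x \in layer G j -> dil r x = r ^+ j *: x.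
Proof.
move=> xj; rewrite /dil big_nat.
under eq_bigr => k ks do rewrite (layer_component _ xj) //.
have [j1|j1] := boolP (1 <= j <= step G)%N; last first.
  have x0 : x = 0 by move: xj; rewrite layer_out // memv0 => /eqP.
  by rewrite x0 scaler0 big1 // => i _; case: ifP; rewrite scaler0.
rewrite -big_nat (bigD1_seq j) ?iota_uniq //=; last by rewrite mem_index_iota ltnS.
by rewrite eqxx big1 ?addr0 // => i /negPf ->; rewrite scaler0.
Qed.

Lemma dil_linear r : linear (dil r).
Proof.
move=> a u v; rewrite /dil scaler_sumr -big_split; apply: eq_bigr => j _ /=.
by rewrite /component linearP scalerDr !scalerA mulrC.
Qed.

HB.instance Definition _ r := GRing.isLinear.Build R V V _ (dil r) (dil_linear r).

Lemma dil_dil r s x : dil r (dil s x) = dil (r * s) x.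
Proof.
apply: (layers_ind (G := G) (P := fun x => dil r (dil s x) = dil (r * s) x)) x.
- by rewrite !linear0.
- by move=> x y xP yP; rewrite !linearD /= xP yP.
- by move=> j x _ xj; rewrite (dil_layer s xj) linearZ /= !(dil_layer _ xj) scalerA exprMn mulrC.
Qed.

Lemma dil1 x : dil 1 x = x.
Proof.
apply: (layers_ind (G := G) (P := fun x => dil 1 x = x)) x; first by rewrite linear0.
- by move=> x y xP yP; rewrite linearD /= xP yP.
- by move=> j x _ xj; rewrite (dil_layer _ xj) expr1n scale1r.
Qed.

Lemma dilVK r x : r != 0 -> dil r (dil r^-1 x) = x.
Proof. by move=> r0; rewrite dil_dil divff // dil1. Qed.

Lemma dil_bracket r x y : dil r (br x y) = br (dil r x) (dil r y).
Proof.
apply: (layers_ind (G := G) (P := fun x => dil r (br x y) = br (dil r x) (dil r y))) x.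
- by rewrite linear0 ?linear0l ?linear0.
- by move=> x x' xP x'P; rewrite !(linearD, linearDl) /= xP x'P.
move=> i x _ xi.
apply: (layers_ind (G := G) (P := fun y => dil r (br x y) = br (dil r x) (dil r y))) y.
- by rewrite linear0 ?linear0r ?linear0.
- by move=> y y' yP y'P; rewrite !(linearD, linearDr) /= yP y'P.
move=> j y _ yj; rewrite (dil_layer _ (bracket_layer xi yj)) (dil_layer _ xi) (dil_layer _ yj).
by rewrite linearZl_LR linearZr_LR /= scalerA exprD.
Qed.

Lemma dil_gmul r x y : dil r (x ** y) = dil r x ** dil r y.
Proof.
have [T [_ TE]] := gmul_expansion G; rewrite !TE !linearD linearZ /= dil_bracket.
congr (_ + _); rewrite linear_sum; apply: eq_bigr => t _; rewrite linearZ /=; congr (_ *: _).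
elim: t.2 => [|c [|c' p] IH]; rewrite /bracket_word /= ?linear0 //; first by case: c.
by rewrite /bracket_word /= in IH; rewrite dil_bracket IH; case: c.
Qed.

Lemma dil_gprod r l : dil r (gprod l) = gprod (map (dil r) l).
Proof. by elim: l => [|x l IH] /=; rewrite ?linear0 // dil_gmul IH. Qed.

Lemma dil_bound : exists2 C : R, 0 < C & forall r x, 0 <= r <= 1 -> `|dil r x| <= C * r * `|x|.
Proof.
have bP j : exists2 C : R, 0 < C & forall x : V, `|component G j x| <= C * `|x|.
  by apply: linear_bound => a u v; rewrite /component linearP.
pose c j := projT1 (cid2 (bP j)).
have c0 j : 0 < c j by rewrite /c; case: cid2.
have cP j x : `|component G j x| <= c j * `|x| by rewrite /c; case: cid2.
exists (1 + \sum_(1 <= j < (step G).+1) c j).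
  by rewrite ltr_pwDl // sumr_ge0 // => j _; exact: ltW.
move=> r x /andP[r0 r1]; apply: (le_trans (ler_norm_sum _ _ _)).
apply: (@le_trans _ _ ((\sum_(1 <= j < (step G).+1) c j) * r * `|x|)); last first.
  by rewrite !ler_wpM2r // lerDr.
rewrite !mulr_suml [leLHS]big_nat [leRHS]big_nat; apply: ler_sum => -[|j] // _.
rewrite normrZ (ger0_norm (exprn_ge0 _ r0)).
rewrite mulrAC [leRHS]mulrC; apply: ler_pM => //; first exact: exprn_ge0.
by rewrite exprS ler_piMr // exprn_ile1.
Qed.

Definition horizontal_path (l : seq V) (rho : R) :=
  forall x, x \in l -> x \in H1 /\ `|x| <= rho.

(** The values of a generic word with small letters cover a neighbourhood of one of
    them, [P]; multiplying by the inverse of [P], itself a word with as many letters,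
    brings this neighbourhood to the unit. *)
Lemma connect_small : exists N, forall rho, 0 < rho -> exists2 r, 0 < r &
  forall w : V, `|w| <= r -> exists l, [/\ size l = N, horizontal_path l rho & gprod l = w].
Proof.
have [h [m [s [hH us sn sm gen]]]] := generic_word G.
exists (m + m)%N => rho rho0.
pose M := 1 + \sum_(i < m) `|h i|.
have M0 : 0 < M by rewrite ltr_pwDl // sumr_ge0.
have hM i : (i < m)%N -> `|h i| <= M.
  move=> im; rewrite /M (bigD1 (Ordinal im)) //= addrCA lerDl addr_ge0 // sumr_ge0 //.
pose r := rho / (2 * M); have r0 : 0 < r by rewrite divr_gt0 // mulr_gt0.
have [tau [taur Fu]] := gen r r0.
pose eps := nseq_tuple m false.
have [B Bu Bder] := word_strict_derivative us sn sm (Fu eps).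
have [d d0 dP] := strict_derivative0_onto Bu Bder r0.
exists d => // w /dP[v vr <-].
set t1 := signed eps tau; set t2 := fun i => _ + _.
have t1r i : (i < m)%N -> `|t1 i| <= r.
  by move=> im; rewrite /t1 /signed normrM normrX normrN1 expr1n mul1r taur.
have t2r i : (i < m)%N -> `|t2 i| <= 2 * r.
  move=> im; rewrite (_ : 2 * r = r + r); last by rewrite mulrDl mul1r.
  apply: (le_trans (ler_normD _ _)); apply: lerD; first exact: t1r.
  by rewrite normrM normrX normrN1 expr1n mul1r (le_trans (slot_bound s i v)).
have letter t i : `|t| <= 2 * r -> (i < m)%N -> t *: h i \in H1 /\ `|t *: h i| <= rho.
  move=> tr im; split; first exact: memvZ.
  rewrite normrZ; apply: (@le_trans _ _ (2 * r * M)); first by apply: ler_pM => //; exact: hM.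
  by rewrite /r le_eqVlt; apply/orP; left; apply/eqP; field; rewrite lt0r_neq0.
exists (rev (map -%R [seq t1 i *: h i | i <- rev (iota 0 m)]) ++ [seq t2 i *: h i | i <- rev (iota 0 m)]).
split.
- by rewrite size_cat size_rev !size_map size_rev size_iota.
- move=> x; rewrite mem_cat mem_rev => /orP[|] /mapP[y].
    move=> /mapP[i]; rewrite mem_rev mem_iota /= => im -> ->; rewrite -scaleNr.
    by apply: letter => //; rewrite normrN (le_trans (t1r i im)) // ler_peMl ?ltW // ltr1n.
  by rewrite mem_rev mem_iota /= => im ->; apply: letter => //; exact: t2r.
- by rewrite gprod_cat -gprod_opp -!pwordE.
Qed.

(** Dilating [connect_small] makes the lengths of the steps proportional to the
    scale [s], as the comparison with a homogeneous distance requires. *)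
Lemma connect_scaled : exists N, exists2 C : R, 0 < C & forall s (w : V), 0 < s -> `|w| <= 1 ->
  exists l, [/\ size l = N, horizontal_path l (C * s) & gprod l = dil s w].
Proof.
have [N NP] := connect_small; have [r r0 rP] := NP 1 ltr01.
have [D D0 DP] := dil_bound.
pose lam := Num.min 1 (r / D).
have lam0 : 0 < lam by rewrite lt_min ltr01 divr_gt0.
exists N, lam^-1; first by rewrite invr_gt0.
move=> s w s0 w1.
have [l [lN lH lw]] : exists l, [/\ size l = N, horizontal_path l 1 & gprod l = dil lam w].
  apply: rP; apply: (le_trans (DP _ _ _)); first by rewrite ltW //= ge_min lexx.
  apply: (@le_trans _ _ (D * lam)); first by rewrite ler_piMr // mulr_ge0 // ltW.
  by rewrite mulrC -ler_pdivlMr // ge_min lexx orbT.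
exists (map (dil (s / lam)) l); split; first by rewrite size_map.
  move=> _ /mapP[y /lH[yH y1] ->]; rewrite (dil_layer _ yH) expr1; split; first exact: memvZ.
  by rewrite normrZ gtr0_norm ?divr_gt0 // (mulrC _ s) ler_piMr // ltW // divr_gt0.
by rewrite -dil_gprod lw dil_dil divfK // lt0r_neq0.
Qed.

End Connectivity.

(** * Homogeneous distances *)

Section Distance.
Variables (R : realType) (n : nat) (G : stratifiedGroup R n).
Local Notation V := 'rV[R]_n.
Local Notation "x ** y" := (gmul G x y) (at level 40, left associativity).
Local Notation H1 := (layer G 1).
Local Notation dil := (dil G).

Lemma gmul_near (x0 : V) e : 0 < e -> exists2 r, 0 < r &
  forall y z : V, `|y - x0| <= r -> `|z| <= r -> `|y ** z - x0| <= e.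
Proof.
move=> e0; have M0 : 0 < `|x0| + 1 by rewrite ltr_pwDr.
have [C C0 CP] := gmul_lipschitz G M0.
exists (Num.min 1 (e / (2 * C))); first by rewrite lt_min ltr01 divr_gt0 // mulr_gt0.
move=> y z; rewrite !le_min => /andP[y1 yC] /andP[z1 zC].
rewrite -[X in _ - X](gmul0 G); apply: (le_trans (CP _ _ _ _ _ _ _ _)).
- by rewrite -(subrK x0 y) (le_trans (ler_normD _ _)) // addrC lerD2l.
- by apply: (le_trans z1); rewrite lerDr.
- by rewrite lerDl.
- by rewrite normr0 addr_ge0.
rewrite subr0 -ler_pdivlMl //; apply: (le_trans (lerD yC zC)).
by rewrite le_eqVlt; apply/orP; left; apply/eqP; field; rewrite lt0r_neq0.
Qed.

Lemma dil_continuous (v : V) : continuous (fun r : R => dil r v).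
Proof.
rewrite /dil; elim: (index_iota _ _) => [|j l IH].
  by under [X in continuous X]eq_fun do rewrite big_nil; exact: cst_continuous.
under [X in continuous X]eq_fun do rewrite big_cons.
move=> r; apply: cvgD; last exact: IH.
by apply: cvgZr_tmp; exact: exprn_continuous.
Qed.

Lemma dil0 z : dil 0 z = 0.
Proof.
by rewrite /dil big_nat big1 // => -[|j] // _; rewrite expr0n scale0r.
Qed.

Lemma compact_norm_sphere : compact [set y : V | `|y| = 1].
Proof.
have -> : [set y : V | `|y| = 1] = [set y : V | `|0 - y| <= 1] `&` [set y : V | 1 <= `|y|].
  apply/seteqP; split=> y /=; rewrite sub0r normrN; first by move=> ->.
  by move=> [y1 y2]; apply/eqP; rewrite eq_le y1.
apply: compact_closedI; first exact: compact_norm_ball.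
have -> : [set y : V | 1 <= `|y|] = Num.norm @^-1` [set t : R | 1 <= t] by [].
by apply: preimage_closed; [move=> y _; exact: norm_continuous | exact: closed_ge].
Qed.

Section Homogeneous.
Variable d : V -> V -> R.
Hypothesis dH : homogeneous_distance G d.

Lemma hdist_ge0 z : 0 <= d 0 z.
Proof.
have [d0 dC dT _ _] := dH; have := dT 0 z 0; rewrite (dC z 0).
by have /d0 -> := erefl (0 : V); lra.
Qed.

Lemma hdist_gt0 z : z != 0 -> 0 < d 0 z.
Proof.
move=> z0; rewrite lt_neqAle hdist_ge0 andbT eq_sym; apply/eqP => h.
by have [d0 _ _ _ _] := dH; move: z0; rewrite -((d0 0 z).1 h) eqxx.
Qed.

Lemma hdist_dil r z : 0 < r -> d 0 (dil r z) = r * d 0 z.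
Proof.
by move=> r0; have [_ _ _ _ [_ dd]] := dH; have := dd r 0 z r0; rewrite linear0.
Qed.

Lemma hdist_continuous : continuous (d 0).
Proof.
have [_ _ _ dc _] := dH => z.
apply: (@continuous_comp _ _ _ (fun z : V => (0 : V, z)) (fun p : V * V => d p.1 p.2)).
  by apply: (@cvg_pair _ _ _ (nbhs z) (nbhs (0 : V)) (nbhs z)); [exact: cvg_cst | exact: cvg_id].
exact: dc.
Qed.

(** The values of [d] on the unit sphere of the norm have a positive minimum, and
    a contracting dilation brings any point outside the unit ball of the norm onto
    this sphere. *)
Lemma hdist_small_ball : exists2 e : R, 0 < e & forall z, d 0 z <= e -> `|z| <= 1.
Proof.
have [[z0 z01]|nosphere] := pselect ([set y : V | `|y| = 1] !=set0); last first.
  exists 1 => // z _; apply: contrapT => z1; apply: nosphere.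
  have z0 : z != 0 by apply/eqP => z0; apply: z1; rewrite z0 normr0.
  exists (`|z|^-1 *: z); rewrite /= normrZ ger0_norm ?invr_ge0 // mulVf //.
  by rewrite normr_eq0.
have [|||c cS cmin] := @compact_EVT_min _ _ (d 0) [set y : V | `|y| = 1].
- by exists z0.
- exact: compact_norm_sphere.
- by apply: continuous_subspaceT; exact: hdist_continuous.
move: cS; rewrite inE /= => c1.
have c0 : c != 0 by apply/eqP => c0; move: c1; rewrite c0 normr0 => /eqP; rewrite eq_sym oner_eq0.
exists (d 0 c / 2); first by rewrite divr_gt0 // hdist_gt0.
move=> z dz; apply: contrapT => /negP; rewrite -ltNge => z1.
have [||r] := @IVT R (fun r => `|dil r z|) 0 1 1 ler01.
- apply: continuous_subspaceT => r; apply: continuous_comp; last exact: norm_continuous.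
  exact: dil_continuous.
- by rewrite dil0 normr0 dil1 ge_min ler01 /= le_max (ltW z1) orbT.
rewrite in_itv /= => /andP[r0 r1] rz.
have {}r0 : 0 < r.
  rewrite lt_neqAle r0 andbT; apply/eqP => r00; move: rz; rewrite -r00.
  by rewrite dil0 normr0 => /eqP; rewrite eq_sym oner_eq0.
have := cmin (dil r z); rewrite inE /= hdist_dil // => /(_ rz).
have := hdist_gt0 c0 => dc0; have h : r * d 0 z <= d 0 c / 2.
  by apply: le_trans dz; rewrite ler_piMl // hdist_ge0.
lra.
Qed.

Lemma hdist_control : exists2 C : R, 0 < C & forall z, z != 0 ->
  exists2 w : V, `|w| <= 1 & z = dil (C * d 0 z) w.
Proof.
have [e e0 eP] := hdist_small_ball; exists e^-1; first by rewrite invr_gt0.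
move=> z z0; have r0 : 0 < e^-1 * d 0 z by rewrite mulr_gt0 ?invr_gt0 ?hdist_gt0.
exists (dil (e^-1 * d 0 z)^-1 z); last by rewrite dilVK // lt0r_neq0.
apply: eP; rewrite hdist_dil ?invr_gt0 // invfM invrK -mulrA mulVf ?mulr1 //.
by rewrite lt0r_neq0 // hdist_gt0.
Qed.

End Homogeneous.
End Distance.

(** * Lebesgue outer measure *)

Section OuterMeasure.
Variables (R : realType) (n : nat).
Local Notation V := 'rV[R]_n.
Local Notation mu := (@lebesgue_outer_measure R n).
Local Open Scope ereal_scope.

Definition volume (a b : V) : R := (\prod_(i < n) (b ord0 i - a ord0 i))%R.

Lemma volume_ge0 (a b : V) : (forall i, a ord0 i <= b ord0 i)%R -> (0 <= volume a b)%R.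
Proof. by move=> ab; apply: prodr_ge0 => i _; rewrite subr_ge0. Qed.

Lemma outer_ge0 X : 0 <= mu X.
Proof.
apply: le_ereal_inf_tmp => /= _ [D [a [b [ab _ ->]]]].
by apply: nneseries_ge0 => k _ _; rewrite lee_fin volume_ge0.
Qed.

Lemma le_outer X Y : X `<=` Y -> mu X <= mu Y.
Proof.
move=> XY; apply: ereal_inf_le_tmp => /= _ [D [a [b [ab YD ->]]]].
by exists D, a, b; split=> //; exact: subset_trans YD.
Qed.

Lemma outer_box (a b : V) : (forall i, a ord0 i <= b ord0 i)%R -> mu (box a b) <= (volume a b)%:E.
Proof.
move=> ab; apply: ereal_inf_lbound => /=; exists (pred1 0%N), (fun=> a), (fun=> b); split=> //.
  by move=> x abx; exists 0%N.
rewrite -/(volume a b) (nneseries_esum (P := pred1 0%N)) => [|k _]; last by rewrite lee_fin volume_ge0.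
rewrite (_ : [set x | _] = [set 0%N]) ?esum_set1 ?lee_fin ?volume_ge0 //.
by apply/seteqP; split=> k /= => [/eqP|->].
Qed.

Lemma outer_sigma_subadditive X (A : nat -> set V) : X `<=` \bigcup_k A k ->
  mu X <= \sum_(0 <= k <oo) mu (A k).
Proof.
move=> XA; have [[i ioo]|] := pselect (exists i, mu (A i) = +oo).
  rewrite (eseries_pinfty _ _ ioo) ?leey // => k _.
  by rewrite -ltNye (lt_le_trans _ (outer_ge0 _)).
rewrite -forallNE => Aoo.
suff add2e (e : {posnum R}) : mu X <= \sum_(i <oo) mu (A i) + e%:num%:E.
  by apply/lee_addgt0Pr => _/posnumP[].
rewrite (le_trans _ (epsilon_trick _ _ _)) //; last by move=> k; exact: outer_ge0.
have cover k : exists c : (pred nat * (nat -> V)) * (nat -> V),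
   [/\ forall j i, (c.1.2 j ord0 i <= c.2 j ord0 i)%R,
       A k `<=` \bigcup_(j in [set j | c.1.1 j]) box (c.1.2 j) (c.2 j) &
       \sum_(0 <= j <oo | c.1.1 j) (volume (c.1.2 j) (c.2 j))%:E
         <= mu (A k) + (e%:num / (2 ^ k.+1)%:R)%:E].
  have fin : mu (A k) \is a fin_num.
    rewrite fin_numE; apply/andP; split; apply/eqP; last exact: Aoo.
    by move=> h; have := outer_ge0 (A k); rewrite h.
  have ek : (0 < e%:num / (2 ^ k.+1)%:R)%R by [].
  have [_ [D [a [b [ab AD ->]]]] lt] := lb_ereal_inf_adherent ek fin.
  by exists (D, a, b); split=> //; exact: ltW.
pose c k := projT1 (cid (cover k)).
have cab k j i : ((c k).1.2 j ord0 i <= (c k).2 j ord0 i)%R by rewrite /c; case: cid => ? [].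
have cA k : A k `<=` \bigcup_(j in [set j | (c k).1.1 j]) box ((c k).1.2 j) ((c k).2 j).
  by rewrite /c; case: cid => ? [].
have cmu k : \sum_(0 <= j <oo | (c k).1.1 j) (volume ((c k).1.2 j) ((c k).2 j))%:E
         <= mu (A k) + (e%:num / (2 ^ k.+1)%:R)%:E by rewrite /c; case: cid => ? [].
have /card_esym/ppcard_eqP[f] := card_nat2.
pose D m := (c (f m).1).1.1 (f m).2.
pose a m := (c (f m).1).1.2 (f m).2.
pose b m := (c (f m).1).2 (f m).2.
have vol0 k j : 0 <= (volume ((c k).1.2 j) ((c k).2 j))%:E by rewrite lee_fin volume_ge0.
apply: (@le_trans _ _ (\sum_(0 <= m <oo | D m) (volume (a m) (b m))%:E)).
  apply: ereal_inf_lbound; exists D, a, b; split=> //.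
    by move=> m i; exact: cab.
  move=> x /XA[k _ /cA[j Dj xj]].
  by exists (f^-1%FUN (k, j)); rewrite /= /D /a /b invK ?inE.
rewrite nneseries_esum; last by move=> m _; exact: vol0.
pose J k := [set j | (c k).1.1 j].
rewrite -(@reindex_esum _ _ _ [set m | D m] ([set: nat] `*`` J) f
    (fun p => (volume ((c p.1).1.2 p.2) ((c p.1).2 p.2))%:E)); last first.
  split.
  - by move=> m /= Dm.
  - by move=> x y _ _ /(inj (in_setT _) (in_setT _)).
  - by move=> [k j] [_ /= h]; exists (f^-1%FUN (k, j)); rewrite /= /D invK ?inE.
rewrite -(@esum_esum _ _ _ [set: nat] J (fun k j => (volume ((c k).1.2 j) ((c k).2 j))%:E)) //.
rewrite -nneseries_esumT; last by move=> k; apply: esum_ge0 => j _; exact: vol0.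
apply: lee_nneseries => [k _ _|k _]; first by apply: esum_ge0 => j _; exact: vol0.
rewrite -(@nneseries_esum _ _ (c k).1.1) => [|j _]; first exact: cmu.
exact: vol0.
Qed.

Lemma outer0 : mu set0 = 0.
Proof.
apply/eqP; rewrite eq_le outer_ge0 andbT; apply: ereal_inf_lbound => /=.
by exists xpred0, (fun=> 0%R), (fun=> 0%R); split=> //; rewrite eseries0.
Qed.

Lemma outerU X A B : X `<=` A `|` B -> mu X <= mu A + mu B.
Proof.
move=> XAB; pose F k := if k is k'.+1 then (if k' is 0%N then B else set0) else A.
apply: (le_trans (@outer_sigma_subadditive X F _)).
  by move=> x /XAB[xA|xB]; [exists 0%N | exists 1%N].
rewrite (nneseries_split _ 2); last by move=> k _; exact: outer_ge0.
rewrite eseries0 ?adde0 ?add0n; last by move=> [|[|k]] //= _ _; exact: outer0.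
by rewrite big_ltn // big_nat1.
Qed.

Lemma outer_finite_subadditive (I : eqType) (r : seq I) (A : I -> set V) X :
  (forall x, X x -> exists2 i, i \in r & A i x) ->
  mu X <= \sum_(i <- r) mu (A i).
Proof.
elim: r X => [|i r IH] X XA.
  rewrite big_nil; have -> : X = set0 by apply/seteqP; split=> // x /XA[].
  by rewrite outer0.
rewrite big_cons; apply: (le_trans (@outerU X (A i) (X `\` A i) _)).
  by move=> x Xx; have [Ai|nAi] := pselect (A i x); [left | right].
apply: leeD => //; apply: IH => x [/XA[j]]; rewrite inE => /orP[/eqP ->|jr Aj _] //.
by exists j.
Qed.

End OuterMeasure.

(** * Volume of boxes and expanding maps *)

Section BoxVolume.
Variable R : realType.
Local Open Scope ereal_scope.

(** Induction on the dimension: for each value [s] of the first coordinate, the boxes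
    whose first side contains [s] cover a cube of dimension [m]; integrate in [s]. *)
Lemma box_cover_volume (q : R) (q0 : (0 < q)%R) m (D : pred nat) (a b : nat -> 'I_m -> R) :
  (forall k i, a k i <= b k i)%R ->
  (forall x : 'I_m -> R, (forall i, 0 < x i <= q)%R ->
     exists2 k, D k & forall i, (a k i < x i <= b k i)%R) ->
  (q ^+ m)%:E <= \sum_(0 <= k <oo | D k) (\prod_(i < m) (b k i - a k i))%:E.
Proof.
elim: m D a b => [|m IH] D a b ab cov.
  have [k Dk _] := cov (fun=> 0%R) (fun i => False_ind _ (notF (valP i))).
    have lim := @nneseries_lim_ge R (fun k => (\prod_(i < 0) (b k i - a k i))%:E) D 0%N k.+1.
  apply: le_trans (lim _) => [|j _ _]; last by rewrite lee_fin big_ord0.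
  rewrite big_mkcond big_nat_recr //= Dk big_ord0 expr0.
  by apply: leeDr; apply: sume_ge0 => j _; case: ifP => // _; rewrite lee_fin big_ord0.
pose v k := (\prod_(i < m) (b k (lift ord0 i) - a k (lift ord0 i)))%R.
have v0 k : (0 <= v k)%R by apply: prodr_ge0 => i _; rewrite subr_ge0.
pose I : set (measurableTypeR R) := `]0%R, q]%classic.
have mI : measurable I by exact: measurable_itv.
pose E k : set (measurableTypeR R) := `]a k ord0, b k ord0]%classic.
pose g k (s : measurableTypeR R) : \bar R := if D k then (v k)%:E * (\1_(E k) s)%:E else 0.
have g0 k s : 0 <= g k s.
  rewrite /g; case: ifP => // _; apply: mule_ge0; first by rewrite lee_fin v0.
  by rewrite lee_fin indicE ler0n.
have gm k : measurable_fun I (g k).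
  rewrite /g; case: (D k); last exact: measurable_cst.
  by apply: measurable_funeM; apply/measurable_EFinP; apply: measurable_indic; exact: measurable_itv.
have step (s : R) : (0 < s <= q)%R -> (q ^+ m)%:E <= \sum_(0 <= k <oo) g k s.
  move=> sq.
  have := IH (fun k => D k && (a k ord0 < s <= b k ord0)%R)
    (fun k i => a k (lift ord0 i)) (fun k i => b k (lift ord0 i)).
  move=> /(_ _ _) /le_trans; apply => //.
    move=> x xq; have [|k Dk kx] := cov (fun i => oapp x s (unlift ord0 i)).
      by move=> i; case: unliftP => [j _|_] /=.
    exists k; first by have := kx ord0; rewrite unlift_none /= Dk.
    by move=> i; have := kx (lift ord0 i); rewrite liftK.
  rewrite eseries_mkcond; apply: lee_nneseries => [k _ _|k _].
    by case: ifP => // _; rewrite lee_fin v0.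
  rewrite /g; case: (D k) => //=; case: ifP => [ks|_]; last first.
    by apply: mule_ge0; rewrite lee_fin ?v0 // indicE ler0n.
  by rewrite indicE mem_set ?mule1 // /E /= in_itv.
have Eq : \int[lebesgue_measure]_(s in I) (q ^+ m)%:E = (q ^+ m.+1)%:E.
  rewrite integral_cst //.
  by rewrite /= lebesgue_measure_itv /= lte_fin q0 sube0 -EFinM exprSr.
rewrite -Eq; apply: (@le_trans _ _ (\int[lebesgue_measure]_(s in I) \sum_(0 <= k <oo) g k s)).
  apply: ge0_le_integral => //.
  - by move=> s _; rewrite lee_fin exprn_ge0 // ltW.
  - exact: ge0_emeasurable_sum.
rewrite (@integral_nneseries _ _ R lebesgue_measure I mI g gm (fun k s _ => g0 k s)).
rewrite [leRHS]eseries_mkcond; apply: lee_nneseries => [k _ _|k _]; first exact: integral_ge0.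
have mE : measurable (E k) by exact: measurable_itv.
rewrite /g; case: (D k); last by rewrite integral0.
rewrite ge0_integralZl //; first last.
- by rewrite lee_fin.
- by apply/measurable_EFinP; apply: measurable_indic.
rewrite integral_indic // big_ord_recl mulrC EFinM; apply: lee_wpmul2l; first by rewrite lee_fin v0.
apply: (@le_trans _ _ (lebesgue_measure (E k))).
  apply: (@le_measure _ _ _ lebesgue_measure) => //; rewrite ?inE //.
  exact: measurableI.
rewrite lebesgue_measure_itv /= lte_fin; case: ifP => // _.
by rewrite lee_fin subr_ge0.
Qed.

End BoxVolume.

Section OuterMeasure2.
Variables (R : realType) (n : nat).
Local Notation V := 'rV[R]_n.
Local Notation mu := (@lebesgue_outer_measure R n).
Local Open Scope ereal_scope.

Lemma outer_cube (q : R) : (0 < q)%R -> (q ^+ n)%:E <= mu (box (0 : V)%R (const_mx q)).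
Proof.
move=> q0; apply: le_ereal_inf_tmp => /= _ [D [a [b [ab cov ->]]]].
apply: (@box_cover_volume R q q0 n D (fun k i => a k ord0 i) (fun k i => b k ord0 i)) => // x xq.
have [|k Dk kx] := cov (\row_i x i)%R.
  by move=> i; have := xq i; rewrite !mxE.
by exists k => // i; have := kx i; rewrite !mxE.
Qed.

(** By additivity the measures of the disjoint pieces of [X] are summable, so that
    the tails of their sum tend to 0. *)
Lemma outer_tail (A : nat -> set V) (X : set V) e :
  (forall k, caratheodory_measurable mu (A k)) ->
  (forall i j, i != j -> A i `&` A j = set0) -> mu X < +oo -> (0 < e)%R ->
  exists N, mu (X `&` \bigcup_(k in [set k | (N <= k)%N]) A k) < e%:E.
Proof.
move=> mA dA Xoo e0.
have fin N Y : \sum_(0 <= k < N) mu (Y `&` A k) <= mu Y.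
  elim: N Y => [|N IH] Y; first by rewrite big_nil outer_ge0.
  rewrite big_nat_recr //= (mA N Y) addeC leeD2l //.
  apply: le_trans (IH _); rewrite big_nat [leRHS]big_nat; apply: lee_sum => k kN.
  apply: le_outer => x [Yx Akx]; split=> //; split=> // ANx.
  have kN' : k != N by rewrite neq_ltn; case/andP: kN => _ ->.
  by have : (A k `&` A N) x by []; rewrite dA.
have soo : \sum_(0 <= k <oo) mu (X `&` A k) < +oo.
  apply: le_lt_trans Xoo; apply: lime_le => //.
    by apply: is_cvg_nneseries => k _ _; exact: outer_ge0.
  by apply: nearW => N; exact: fin.
have /fine_cvgP[tf] := nneseries_tail_cvg soo (fun k _ => outer_ge0 (X `&` A k)).
move=> /cvgrPdist_lt /(_ e e0) /= te.
have [N _ NP] := filterI tf te.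
have [Nf Ne] := NP N (leqnn N); exists N.
apply: (@le_lt_trans _ _ (\sum_(N <= k <oo) mu (X `&` A k))); last first.
  rewrite -(fineK Nf) lte_fin; apply: le_lt_trans Ne.
  by rewrite sub0r normrN ler_norm.
apply: (le_trans (@outer_sigma_subadditive _ _ _ (fun k => if (N <= k)%N then X `&` A k else set0) _)).
  by move=> x [Xx [k /= Nk Akx]]; exists k => //; rewrite Nk.
rewrite (nneseries_split _ N) ?add0n; last by move=> k _; exact: outer_ge0.
rewrite big_nat big1 ?add0e => [|k /andP[_ kN]]; last by rewrite leqNgt kN outer0.
apply: lee_nneseries => [k _ _|k _]; first exact: outer_ge0.
by case: ifP => // _; rewrite outer0 outer_ge0.
Qed.

Lemma outer_small_diameter (S : set V) (d : R) : (0 < d)%R ->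
  (forall x y, S x -> S y -> `|x - y| <= d)%R -> mu S <= ((3 * d) ^+ n)%:E.
Proof.
move=> d0 Sd; have [[x0 Sx0]|S0] := pselect (S !=set0); last first.
  have -> : S = set0 by apply/seteqP; split=> // x Sx; apply: S0; exists x.
  by rewrite outer0 lee_fin exprn_ge0 // mulr_ge0 // ltW.
pose a : V := (x0 - const_mx (2 * d))%R; pose b : V := (x0 + const_mx d)%R.
apply: (@le_trans _ _ (mu (box a b))).
  apply: le_outer => x Sx i; have := Sd x x0 Sx Sx0.
  rewrite (rV_norm_le _ (ltW d0)) => /forallP /(_ i); rewrite !mxE ler_norml => /andP[h1 h2].
  by apply/andP; split; lra.
apply: le_trans (outer_box _) _; first by move=> i; rewrite !mxE; lra.
rewrite lee_fin /volume (eq_bigr (fun=> (3 * d)%R)) ?prodr_const ?card_ord //.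
by move=> i _; rewrite !mxE; ring.
Qed.

Section Expanding.
Variables (c : R) (Q : set V) (F : V -> V).
Hypothesis c0 : (0 < c)%R.
Hypothesis FQ : forall t t', Q t -> Q t' -> (c * `|t - t'| <= `|F t - F t'|)%R.

(** The box is cut into at most [\prod_i (2 * L i / s)] pieces of diameter [s], and the
    preimage of each of them has diameter at most [s / c]. *)
Lemma expanding_preimage_box (a b : V) : (forall i, a ord0 i <= b ord0 i)%R ->
  mu (Q `&` F @^-1` (box a b)) <= ((6 / c) ^+ n * volume a b)%:E.
Proof.
move=> ab; have [ablt|] := pselect (forall i, a ord0 i < b ord0 i)%R; last first.
  move=> /existsNP[i /negP]; rewrite -leNgt => ba.
  have -> : Q `&` F @^-1` box a b = set0.
    apply/seteqP; split=> // t [_ /(_ i) /andP[h1 h2]].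
    by have := lt_le_trans h1 (le_trans h2 ba); rewrite ltxx.
  by rewrite outer0 lee_fin mulr_ge0 ?exprn_ge0 ?divr_ge0 ?volume_ge0 // ltW.
pose L i := (b ord0 i - a ord0 i)%R.
have L0 i : (0 < L i)%R by rewrite subr_gt0.
pose s : R := \big[Num.min/1%R]_i L i.
have s0 : (0 < s)%R by apply: lt_bigmin; [exact: ltr01 | move=> i _; exact: L0].
have sL i : (s <= L i)%R by exact: bigmin_le.
pose N i := Num.truncn (L i / s).
pose T := {dffun forall i : 'I_n, 'I_(N i).+1}.
pose piece (f : T) : set V := [set t | [/\ Q t, box a b (F t) &
  forall i, Num.truncn ((F t ord0 i - a ord0 i) / s) = f i :> nat]].
apply: (le_trans (@outer_finite_subadditive _ _ T (enum T) piece _ _)).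
  move=> t [Qt bt].
  have tN i : (Num.truncn ((F t ord0 i - a ord0 i) / s) < (N i).+1)%N.
    rewrite ltnS; apply: le_truncn; rewrite ler_pM2r ?invr_gt0 // lerB //.
    by have /andP[] := bt i.
  by exists [ffun i => Ordinal (tN i)]; rewrite ?mem_enum //; split=> // i; rewrite ffunE.
have pieceS f : mu (piece f) <= ((3 * (s / c)) ^+ n)%:E.
  apply: outer_small_diameter; first exact: divr_gt0.
  move=> t t' [Qt bt ft] [Qt' bt' ft']; rewrite ler_pdivlMr // mulrC.
  apply: (le_trans (FQ Qt Qt')); rewrite (rV_norm_le _ (ltW s0)); apply/forallP => i.
  have z0 x : box a b x -> (0 <= (x ord0 i - a ord0 i) / s)%R.
    by move=> /(_ i) /andP[h _]; rewrite divr_ge0 ?(ltW s0) // subr_ge0 ltW.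
  have /andP[h1 h2] := truncn_itv (z0 _ bt); have /andP[h3 h4] := truncn_itv (z0 _ bt').
  have ff := etrans (ft i) (esym (ft' i)); rewrite -ff in h3 h4.
  set m := Num.truncn _ in h1 h2 h3 h4.
  rewrite -natr1 in h2 h4.
  have e1 : (F t ord0 i - a ord0 i = (F t ord0 i - a ord0 i) / s * s)%R by rewrite divfK // lt0r_neq0.
  have e2 : (F t' ord0 i - a ord0 i = (F t' ord0 i - a ord0 i) / s * s)%R by rewrite divfK // lt0r_neq0.
  rewrite !mxE -[X in `|X|%R](_ : (F t ord0 i - a ord0 i) - (F t' ord0 i - a ord0 i) = _)%R; last by ring.
  rewrite e1 e2 -mulrBl normrM (gtr0_norm s0) ler_piMl ?(ltW s0) // ler_norml.
  by apply/andP; split; lra.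
apply: (@le_trans _ _ (\sum_(f <- enum T) ((3 * (s / c)) ^+ n)%:E)).
  by apply: lee_sum => f _; exact: pieceS.
rewrite sumEFin lee_fin big_const_seq count_predT -cardE iter_addr_0.
have -> : #|T| = (\prod_(i < n) (N i).+1)%N.
  by rewrite card_dep_ffun foldrE big_map enumT; apply: eq_bigr => i _; rewrite card_ord.
rewrite -[leLHS]mulr_natl natr_prod.
apply: (@le_trans _ _ ((\prod_(i < n) (2 * (L i / s))) * (3 * (s / c)) ^+ n)%R).
  apply: ler_wpM2r; first by rewrite exprn_ge0 // mulr_ge0 // divr_ge0 // ltW.
  apply: ler_prod => i _; rewrite ler0n /=.
  have Ls1 : (1 <= L i / s)%R by rewrite ler_pdivlMr // mul1r.
  have /andP[h _] := truncn_itv (le_trans ler01 Ls1); rewrite -natr1.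
  by move: h; rewrite -/(N i); lra.
rewrite -[((3 * (s / c)) ^+ n)%R](_ : \prod_(i < n) (3 * (s / c)) = _)%R; last first.
  by rewrite prodr_const card_ord.
rewrite -[((6 / c) ^+ n)%R](_ : \prod_(i < n) (6 / c) = _)%R; last first.
  by rewrite prodr_const card_ord.
rewrite /volume -!big_split /= le_eqVlt; apply/orP; left; apply/eqP.
apply: eq_bigr => i _; rewrite /L; field.
by rewrite !lt0r_neq0.
Qed.

Lemma expanding_preimage (B : set V) (d : R) : mu B < d%:E ->
  mu (Q `&` F @^-1` B) <= ((6 / c) ^+ n * d)%:E.
Proof.
move=> /ereal_inf_lt[_ [D [a [b [ab BD ->]]]]] sumd.
have C0 : (0 <= (6 / c) ^+ n :> R)%R by rewrite exprn_ge0 // divr_ge0 // ltW.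
have vol0 k : (0 <= volume (a k) (b k))%R by exact: volume_ge0.
pose S k := if D k then Q `&` F @^-1` box (a k) (b k) else set0.
apply: (le_trans (@outer_sigma_subadditive _ _ _ S _)).
  by move=> t [Qt /BD[k /= Dk Fk]]; exists k => //; rewrite /S Dk.
rewrite EFinM; apply: (@le_trans _ _ (((6 / c) ^+ n)%:E * \sum_(0 <= k <oo | D k) (volume (a k) (b k))%:E)).
  rewrite -nneseriesZl //; last by move=> k _; rewrite lee_fin.
  rewrite [leRHS]eseries_mkcond; apply: lee_nneseries => [k _ _|k _]; first exact: outer_ge0.
  rewrite /S; case: (D k); last by rewrite outer0.
  by rewrite -EFinM; apply: expanding_preimage_box.
by apply: lee_wpmul2l; [rewrite lee_fin | exact: ltW].
Qed.

End Expanding.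
End OuterMeasure2.

(** * Local boundedness *)

Section LocalBound.
Variables (R : realType) (n : nat) (G : stratifiedGroup R n).
Local Notation V := 'rV[R]_n.
Local Notation "x ** y" := (gmul G x y) (at level 40, left associativity).
Local Notation H1 := (layer G 1).
Local Notation pword := (pword G).
Variables (Omega : set V) (u : V -> R).
Hypothesis uconv : h_convex G Omega u.

Lemma h_convexP (x h : V) l : h \in H1 -> (forall t, 0 <= t <= 1 -> Omega (x ** (t *: h))) ->
  0 <= l <= 1 -> u (x ** (l *: h)) <= l * u (x ** h) + (1 - l) * u x.
Proof.
move=> hH hO l01.
have O0 : Omega x by have := hO 0; rewrite scale0r gmul0; apply; rewrite lexx ler01.
have O1 : Omega (x ** h) by have := hO 1; rewrite scale1r; apply; rewrite lexx ler01.
have := @uconv x (x ** h) O0 O1; rewrite /ginv gKmul => /(_ hH).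
have dh t : dil G t h = t *: h by rewrite (dil_layer _ hH) expr1.
move=> hh; rewrite -dh; apply: hh => //.
by move=> _ [t t01 <-]; rewrite dh; apply: hO; move: t01; rewrite /= in_itv.
Qed.

Lemma h_convex_midpoint (x h : V) : h \in H1 ->
  (forall t, `|t| <= 1 -> Omega (x ** (t *: h))) ->
  2 * u x <= u (x ** h) + u (x ** - h).
Proof.
move=> hH hO.
have e t : x ** - h ** (t *: (2 *: h)) = x ** ((2 * t - 1) *: h).
  by rewrite -gmulA -scaleN1r scalerA gmulZZ; congr (_ ** (_ *: _)); ring.
have := @h_convexP (x ** - h) (2 *: h) 2^-1 (memvZ _ hH).
rewrite e (_ : 2 * 2^-1 - 1 = 0) ?scale0r ?gmul0; last by field.
rewrite -[in X in _ -> _ -> X](scale1r (2 *: h)) e (_ : 2 * 1 - 1 = 1) ?scale1r; last by ring.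
move=> hh; suff : u x <= 2^-1 * u (x ** h) + (1 - 2^-1) * u (x ** - h) by lra.
apply: hh; last by rewrite invr_ge0 ler0n invf_le1 ?ler1n.
move=> t /andP[t0 t1]; rewrite e; apply: hO.
by rewrite ler_norml; apply/andP; split; lra.
Qed.

Lemma open_norm_ball (x0 : V) : open Omega -> Omega x0 ->
  exists2 r, 0 < r & forall z, `|z - x0| <= r -> Omega z.
Proof.
move=> oO Ox; have /nbhs_ballP[e /= e0 eO] : nbhs x0 Omega by exact: open_nbhs_nbhs.
exists (e / 2); first exact: divr_gt0.
move=> z zx; apply: eO; rewrite -ball_normE /= distrC (le_lt_trans zx) //.
by rewrite ltr_pdivrMr // ltr_pMr // ltr1n.
Qed.

Section AtPoint.
Variables (x0 : V) (rho : R).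
Hypothesis rho0 : 0 < rho.
Hypothesis ballO : forall z, `|z - x0| <= rho -> Omega z.

(** The midpoint inequality is iterated along the word; the last claim says, without
    a maximum over [eps], that [u y] is at most the largest value at an end point. *)
Lemma sign_tree m : exists2 r, 0 < r <= rho & forall y (l : nat -> V), `|y - x0| <= r ->
  (forall i, (i < m)%N -> l i \in H1 /\ `|l i| <= r) ->
  (forall eps : nat -> bool, `|y ** pword l (fun i => (-1) ^+ eps i) m - x0| <= rho) /\
  forall M, (forall eps : nat -> bool, u (y ** pword l (fun i => (-1) ^+ eps i) m) <= M) -> u y <= M.
Proof.
elim: m => [|m [r' /andP[r'0 r'rho] IH]].
  exists rho; first by rewrite rho0 lexx.
  move=> y l yr _; rewrite /= gmul0; split=> // M /(_ (fun=> false)).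
  by [].
have [r'' r''0 r''P] := gmul_near G x0 r'0.
exists (Num.min r' r''); first by rewrite lt_min r'0 r''0 /= ge_min r'rho.
move=> y l; rewrite le_min => /andP[yr' yr''] lP.
have [lmH] := lP m (ltnSn m); rewrite le_min => /andP[_ lmr].
have near t : `|t| <= 1 -> `|y ** (t *: l m) - x0| <= r'.
  move=> t1; apply: r''P => //; rewrite normrZ (le_trans _ lmr) // ler_piMl //.
have lP' i : (i < m)%N -> l i \in H1 /\ `|l i| <= r'.
  by move=> im; have [|? h] := lP i; [exact: ltnW | split=> //; move: h; rewrite le_min => /andP[]].
have b1 (b : bool) : `|(-1) ^+ b : R| <= 1 by rewrite normrX normrN1 expr1n.
split=> [eps|M MP].
  by rewrite /= gmulA; apply: (IH _ l (near _ (b1 _)) lP').1.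
have side (b : bool) : u (y ** ((-1) ^+ b *: l m)) <= M.
  apply: (IH _ l (near _ (b1 b)) lP').2 => eps.
  have := MP (fun i => if i == m then b else eps i); rewrite /= eqxx gmulA.
  rewrite (@eq_pword _ _ _ _ l _ (fun i => (-1) ^+ eps i)) // => i im.
  by rewrite ltn_eqF.
have := @h_convex_midpoint y (l m) lmH (fun t t1 => ballO (le_trans (near t t1) r'rho)).
by have := side false; have := side true; rewrite expr1 expr0 scaleN1r scale1r; lra.
Qed.

End AtPoint.

Lemma pword_scale h (e a : nat -> R) m :
  pword (fun i => a i *: h i) e m = pword h (fun i => e i * a i) m.
Proof. by elim: m => //= m ->; rewrite scalerA. Qed.

Lemma common_lower_bound (I : finType) (c : I -> R) : (forall i, 0 < c i) ->
  exists2 d, 0 < d & forall i, d <= c i.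
Proof.
move=> c0; exists (\big[Num.min/1]_i c i); last by move=> i; exact: bigmin_le.
by apply: lt_bigmin; [exact: ltr01 | move=> i _; exact: c0].
Qed.

Lemma superlevel_small X e : lebesgue_measurable_fun Omega u ->
  (lebesgue_outer_measure X < +oo)%E -> 0 < e -> exists N : nat,
  (lebesgue_outer_measure (X `&` [set z | Omega z /\ (N%:R <= u z)%R]) < e%:E)%E.
Proof.
move=> mu_u Xoo e0.
pose A (k : nat) := Omega `&` u @^-1` `[k%:R, k.+1%:R[%classic.
have [|i j ij|N NP] := @outer_tail R n A X e _ _ Xoo e0.
- by move=> k; apply: mu_u; exact: measurable_itv.
- apply/seteqP; split=> // z [[_ /=]]; rewrite in_itv /= => /truncn_def iu.
  by move=> [_ /=]; rewrite in_itv /= => /truncn_def; rewrite iu => ij'; move: ij; rewrite ij' eqxx.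
exists N; apply: le_lt_trans NP; apply: le_outer => z [Xz [Oz Nz]]; split=> //.
have u0 : 0 <= u z by apply: le_trans Nz; rewrite ler0n.
exists (Num.truncn (u z)); last by split=> //=; rewrite in_itv /= truncn_itv.
by rewrite /= -[X in (X <= _)%N](@natrK R) le_truncn.
Qed.

(** If every perturbation [v] of the letters in a cube had an end point where [u] is
    at least [N], the cube would be covered by [2 ^ m] preimages, by expanding
    maps, of a set whose measure is small when [N] is large. *)
Lemma locally_bounded_above : open Omega -> lebesgue_measurable_fun Omega u ->
  forall x0, Omega x0 -> exists2 r, 0 < r & exists M, forall y, `|y - x0| <= r -> u y <= M.
Proof.
move=> oO mu_u x0 Ox0.
have [rho rho0 ballO] := open_norm_ball oO Ox0.
have [h [m [s [hH us sn sm gen]]]] := generic_word G.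
have [r1 /andP[r10 r1rho] tree] := sign_tree rho0 ballO m.
pose Hm := 1 + \sum_(i < m) `|h i|.
have Hm0 : 0 < Hm by rewrite ltr_pwDl // sumr_ge0.
have hHm i : (i < m)%N -> `|h i| <= Hm.
  move=> im; rewrite /Hm (bigD1 (Ordinal im)) //= addrCA lerDl addr_ge0 // sumr_ge0 //.
pose r2 := r1 / (2 * Hm); have r20 : 0 < r2 by rewrite divr_gt0 // mulr_gt0.
have [tau [taur Fu]] := gen r2 r20.
pose l (v : V) i := (tau i + slot s i v) *: h i.
have lP v : `|v| <= r2 -> forall i, (i < m)%N -> l v i \in H1 /\ `|l v i| <= r1.
  move=> vr i im; split; first exact: memvZ.
  rewrite normrZ; apply: (@le_trans _ _ ((r2 + r2) * Hm)).
    apply: ler_pM => //; last exact: hHm.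
    apply: (le_trans (ler_normD _ _)); apply: lerD; first exact: taur.
    exact: le_trans (slot_bound s i v) vr.
  by rewrite /r2 le_eqVlt; apply/orP; left; apply/eqP; field; rewrite lt0r_neq0.
pose sg (eps : seq bool) (i : nat) : R := (-1) ^+ nth false eps i.
pose F (eps : m.-tuple bool) (y v : V) := y ** pword (l v) (sg eps) m.
(* the words move in all directions with [v], uniformly in the signs and in [y] *)
pose g (eps : m.-tuple bool) (v : V) := - pword h (signed eps tau) m
     ** pword h (fun i => signed eps tau i + sg eps i * slot s i v) m.
have gexp eps : exists2 c, 0 < c & exists2 q, 0 < q & forall v v' : V, `|v| <= q -> `|v'| <= q ->
    c * `|v - v'| <= `|g eps v - g eps v'|.
  have [B Bu Bder] := word_strict_derivative us sn sm (Fu eps).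
  exact: strict_derivative0_expanding Bu Bder.
pose c1 eps := projT1 (cid2 (gexp eps)).
have c10 eps : 0 < c1 eps by rewrite /c1; case: cid2.
have gexp1 eps : exists2 q, 0 < q & forall v v' : V, `|v| <= q -> `|v'| <= q ->
    c1 eps * `|v - v'| <= `|g eps v - g eps v'| by rewrite /c1; case: cid2.
pose q1 eps := projT1 (cid2 (gexp1 eps)).
have q10 eps : 0 < q1 eps by rewrite /q1; case: cid2.
have gexp2 eps v v' : `|v| <= q1 eps -> `|v'| <= q1 eps ->
    c1 eps * `|v - v'| <= `|g eps v - g eps v'| by rewrite /q1; case: cid2 => ? ? /=; apply.
have [c2 c20 c2P] := common_lower_bound c10.
have [q2 q20 q2P] := common_lower_bound q10.
pose q := Num.min q2 r2; have q0 : 0 < q by rewrite lt_min q20.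
pose Q : set V := box 0 (const_mx q).
have Qq v : Q v -> `|v| <= q.
  move=> Qv; rewrite (rV_norm_le _ (ltW q0)); apply/forallP => i.
  by have := Qv i; rewrite !mxE => /andP[v0 vq]; rewrite ger0_norm // ltW.
have Fg eps y v : F eps y v = y ** pword h (signed eps tau) m ** g eps v.
  rewrite /F /g /l pword_scale -gmulA gNKmul; congr (_ ** pword _ _ _).
  by apply/funext => i; rewrite mulrDr.
have F_near eps y v : `|y - x0| <= r1 -> `|v| <= r2 -> `|F eps y v - x0| <= rho.
  move=> yr vr; exact: ((tree y (l v) yr (lP v vr)).1 (nth false eps)).
pose K := `|x0| + rho; have K0 : 0 < K by rewrite ltr_pwDr.
have nearK z : `|z - x0| <= rho -> `|z| <= K.
  by move=> zr; rewrite -(subrK x0 z) (le_trans (ler_normD _ _)) // addrC lerD2l.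
have [C C0 CP] := gmul_lipschitz G K0.
pose c := c2 / C; have c0 : 0 < c by rewrite divr_gt0.
have Fexp eps y : `|y - x0| <= r1 -> forall v v', Q v -> Q v' ->
    c * `|v - v'| <= `|F eps y v - F eps y v'|.
  move=> yr v v' /Qq + /Qq; rewrite !le_min => /andP[v1 v2] /andP[v'1 v'2].
  pose g0 := y ** pword h (signed eps tau) m.
  have g0K : `|- g0| <= K.
    rewrite normrN; have := F_near eps y 0 yr; rewrite normr0 => /(_ (ltW r20)) /nearK.
    rewrite Fg; have [B _ Bder] := word_strict_derivative us sn sm (Fu eps).
    by case: Bder => g00 _ _; rewrite (g00 : g eps 0 = 0) gmul0.
  rewrite /c mulrAC ler_pdivrMr // [leRHS]mulrC.
  have := CP (- g0) (F eps y v) (- g0) (F eps y v') g0K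
    (nearK _ (F_near eps y v yr v2)) g0K (nearK _ (F_near eps y v' yr v'2)).
  have gF w : - g0 ** F eps y w = g eps w by rewrite Fg gKmul.
  rewrite !gF subrr normr0 add0r; apply: le_trans.
  apply: (@le_trans _ _ (c1 eps * `|v - v'|)); first by rewrite ler_wpM2r.
  by apply: gexp2; [exact: le_trans v1 _ | exact: le_trans v'1 _].
pose X : set V := box (x0 - const_mx (2 * rho)) (x0 + const_mx rho).
have Xoo : (lebesgue_outer_measure X < +oo)%E.
  apply: le_lt_trans (outer_box _) (ltry _) => i; rewrite !mxE.
  by have := rho0; lra.
have XP z : `|z - x0| <= rho -> X z.
  rewrite (rV_norm_le _ (ltW rho0)) => /forallP zr i; have := zr i.
  rewrite !mxE => /ler_normlP[h1 h2]; have r0 := rho0; clear -h1 h2 r0.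
  by apply/andP; split; lra.
pose P6 := (6 / c) ^+ n * (2 ^+ m); have P60 : 0 < P6.
  by rewrite mulr_gt0 ?exprn_gt0 // divr_gt0.
pose d := q ^+ n / (2 * P6); have d0 : 0 < d by rewrite divr_gt0 ?exprn_gt0 // mulr_gt0.
have [N NP] := superlevel_small mu_u Xoo d0.
set B := X `&` _ in NP.
exists r1 => //; exists N%:R => y yr.
have [v Qv vP] : exists2 v, Q v & forall eps : m.-tuple bool, u (F eps y v) < N%:R.
  apply: contrapT => no.
  have : (lebesgue_outer_measure Q <= \sum_(eps <- enum {: m.-tuple bool})
      lebesgue_outer_measure (Q `&` F eps y @^-1` B))%E.
    apply: outer_finite_subadditive => v Qv.
    have : ~ forall eps : m.-tuple bool, u (F eps y v) < N%:R by move=> h'; apply: no; exists v.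
    move=> /existsNP[eps /negP]; rewrite -leNgt => uN.
    exists eps; first by rewrite mem_enum.
    have /Qq := Qv; rewrite le_min => /andP[_ v2].
    have nF := F_near eps y v yr v2.
    by split=> //; split; [exact: XP | split=> //; exact: ballO].
  apply/negP; rewrite -ltNge; apply: lt_le_trans (outer_cube n q0).
  apply: (@le_lt_trans _ _ (\sum_(eps <- enum {: m.-tuple bool}) ((6 / c) ^+ n * d)%:E)%E).
    by apply: lee_sum => eps _; apply: (expanding_preimage c0 (Fexp eps y yr) NP).
  rewrite sumEFin lte_fin big_const_seq count_predT -cardE iter_addr_0 card_tuple card_bool.
  rewrite -[ltLHS]mulr_natr natrX mulrAC -/P6 /d.
  rewrite (_ : P6 * _ = q ^+ n / 2); first by rewrite ltr_pdivrMr // ltr_pMr ?exprn_gt0 // ltr1n.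
  by field; rewrite lt0r_neq0.
have /Qq := Qv; rewrite le_min => /andP[_ v2].
apply: (tree y (l v) yr (lP v v2)).2 => eps.
have := vP [tuple eps i | i < m]; rewrite /F => /ltW.
rewrite (@eq_pword _ _ _ _ (l v) _ (fun i => (-1) ^+ eps i)) // => i im.
by rewrite /sg (nth_map (Ordinal im)) ?size_enum_ord // nth_enum_ord.
Qed.

End LocalBound.

(** * Local Lipschitz continuity *)

Section Lipschitz.
Variables (R : realType) (n : nat) (G : stratifiedGroup R n).
Local Notation V := 'rV[R]_n.
Local Notation "x ** y" := (gmul G x y) (at level 40, left associativity).
Local Notation H1 := (layer G 1).
Local Notation gprod := (gprod G).

Lemma gprod_take_S l i : (i < size l)%N -> gprod (take i.+1 l) = gprod (take i l) ** nth 0 l i.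
Proof. by move=> il; rewrite (take_nth 0 il) -cats1 gprod_cat /= gmul0. Qed.

Lemma path_near x0 N rho : 0 < rho -> exists2 r, 0 < r <= rho & forall y l,
  `|y - x0| <= r -> (size l <= N)%N -> horizontal_path G l r ->
  forall i, `|y ** gprod (take i l) - x0| <= rho.
Proof.
move=> rho0; elim: N => [|N [r /andP[r0 rrho] IH]].
  exists rho; first by rewrite rho0 lexx.
  by move=> y [|//] yr _ _ i; rewrite gmul0.
have [r' r'0 r'P] := gmul_near G x0 r0.
exists (Num.min r r'); first by rewrite lt_min r0 r'0 /= ge_min rrho.
move=> y [|a l]; rewrite le_min => /andP[yr yr'] lN hl [|i]; rewrite ?gmul0 ?(le_trans yr) //.
have [aH] := hl a (mem_head _ _); rewrite le_min => /andP[_ ar'].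
rewrite /= gmulA; apply: IH => //; first exact: r'P.
by move=> b bl; have [|? +] := hl b; rewrite ?inE ?bl ?orbT // le_min => /andP[].
Qed.

Lemma path_from x0 : exists N, forall rho, 0 < rho -> exists2 r, 0 < r &
  forall y, `|y - x0| <= r -> exists l, [/\ size l = N, horizontal_path G l rho & y = x0 ** gprod l].
Proof.
have [N NP] := connect_small G; exists N => rho rho0.
have [r r0 rP] := NP rho rho0.
have K0 : 0 < `|x0| + 1 by rewrite ltr_pwDr.
have [C C0 CP] := gmul_lipschitz G K0.
exists (Num.min 1 (r / C)); first by rewrite lt_min ltr01 divr_gt0.
move=> y; rewrite le_min => /andP[y1 yr].
have yK : `|y| <= `|x0| + 1.
  by rewrite -(subrK x0 y) (le_trans (ler_normD _ _)) // addrC lerD2l.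
have x0K : `|x0| <= `|x0| + 1 by rewrite lerDl.
have [|l [lN lH lw]] := rP (- x0 ** y).
  rewrite -[X in `|X|]subr0 -(gNmul G x0).
  have := CP (- x0) y (- x0) x0; rewrite normrN => /(_ x0K yK x0K x0K) /le_trans; apply.
  by rewrite subrr normr0 add0r mulrC -ler_pdivlMr.
by exists l; split=> //; rewrite lw gNKmul.
Qed.

Variables (Omega : set V) (u : V -> R).
Hypothesis uconv : h_convex G Omega u.
Hypothesis oO : open Omega.
Hypothesis ubound : forall x0, Omega x0 ->
  exists2 r, 0 < r & exists M, forall y, `|y - x0| <= r -> u y <= M.

(** By the midpoint inequality, [u (y h) >= 2 u y - M] when [u <= M]: an upper bound
    for [u] becomes a lower bound along a path. *)
Lemma locally_bounded x0 : Omega x0 -> exists2 r, 0 < r & exists2 M, 0 < M &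
  forall y, `|y - x0| <= r -> Omega y /\ `|u y| <= M.
Proof.
move=> Ox0; have [r1 r10 [M MP]] := ubound Ox0.
have [r2 r20 r2O] := open_norm_ball oO Ox0.
pose rho := Num.min r1 r2; have rho0 : 0 < rho by rewrite lt_min r10.
have [r3 r30 r3P] := gmul_near G x0 rho0.
have [N NP] := path_from x0.
have [r4 /andP[r40 r43] r4P] := path_near x0 N r30.
have [r5 r50 r5P] := NP _ r40.
have inball y : `|y - x0| <= rho -> Omega y /\ u y <= M.
  by rewrite le_min => /andP[y1 y2]; split; [exact: r2O | exact: MP].
exists (Num.min rho r5); first by rewrite lt_min rho0.
exists (`|M| + 2 ^+ N * `|u x0 - M| + 1).
  by rewrite ltr_wpDl // addr_ge0 // mulr_ge0 // exprn_ge0.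
move=> y; rewrite le_min => /andP[yrho /r5P[l [lN lH yl]]].
have [Oy uM] := inball y yrho; split=> //.
have near := r4P x0 l; rewrite subrr normr0 in near.
have {}near i := near (ltW r40) (eq_leq lN) lH i.
have low i : (i <= N)%N -> 2 ^+ i * (u x0 - M) <= u (x0 ** gprod (take i l)) - M.
  elim: i => [|i IH] iN; first by rewrite take0 /= gmul0 mul1r.
  have il : (i < size l)%N by rewrite lN.
  rewrite gprod_take_S // gmulA; set z := x0 ** _.
  have [aH ar] := lH _ (mem_nth 0 il); set a := nth 0 l i in aH ar *.
  have zr t : `|t| <= 1 -> `|z ** (t *: a) - x0| <= rho.
    move=> t1; apply: r3P; first exact: near.
    by rewrite normrZ (le_trans _ (le_trans ar r43)) // ler_piMl.
  have := h_convex_midpoint uconv aH (fun t t1 => (inball _ (zr t t1)).1).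
  have [_] : Omega (z ** - a) /\ u (z ** - a) <= M.
    by apply: inball; rewrite -scaleN1r; apply: zr; rewrite normrN1.
  by have := IH (ltnW iN); rewrite -/z exprS -mulrA; lra.
have := low N (leqnn N); rewrite take_oversize ?lN // -yl => low'.
have p2 : 0 < 2 ^+ N :> R by rewrite exprn_gt0.
have : - (2 ^+ N * `|u x0 - M|) <= 2 ^+ N * (u x0 - M).
  by rewrite -mulrN ler_pM2l // lerNl -normrN ler_norm.
have := ler_norm M; have := ler_norm (- M); rewrite normrN => h1 h2 h3.
have h4 : 0 <= 2 ^+ N * `|u x0 - M| by rewrite mulr_ge0 // ltW.
by rewrite ler_norml; apply/andP; split; lra.
Qed.

(** A convex function of one variable that is bounded on an interval is Lipschitz
    on a smaller one. *)
Lemma horizontal_lipschitz x0 : Omega x0 -> exists2 r, 0 < r & exists2 L, 0 < L &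
  forall y h, `|y - x0| <= r -> h \in H1 -> `|h| <= r ->
    Omega (y ** h) /\ `|u (y ** h) - u y| <= L * `|h|.
Proof.
move=> Ox0; have [rho rho0 [M M0 MP]] := locally_bounded Ox0.
have [r1 r10 r1P] := gmul_near G x0 rho0.
have [r2 r20 r2P] := gmul_near G x0 r10.
pose L := 2 * M / r1; have L0 : 0 < L by rewrite divr_gt0 // mulr_gt0.
have side y h : `|y - x0| <= r1 -> h \in H1 -> `|h| <= r1 -> u (y ** h) - u y <= L * `|h|.
  move=> yr hH hr; have [->|h0] := eqVneq h 0.
    by rewrite gmul0 subrr normr0 mulr0.
  have nh0 : 0 < `|h| by rewrite normr_gt0.
  pose e := (r1 / `|h|) *: h; have eH : e \in H1 by exact: memvZ.
  have er : `|e| = r1 by rewrite normrZ ger0_norm ?divr_ge0 ?(ltW r10) // divfK ?lt0r_neq0.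
  have eO t : 0 <= t <= 1 -> `|y ** (t *: e) - x0| <= rho.
    move=> /andP[t0 t1]; apply: r1P => //; rewrite normrZ er ger0_norm //.
    by rewrite ler_piMl // ltW.
  pose l := `|h| / r1.
  have l01 : 0 <= l <= 1 by rewrite divr_ge0 ?(ltW r10) //= ler_pdivrMr // mul1r.
  have := h_convexP uconv eH (fun t t1 => (MP _ (eO t t1)).1) l01.
  have -> : l *: e = h.
    by rewrite /e /l scalerA mulrA divfK ?lt0r_neq0 // divff ?lt0r_neq0 // scale1r.
  have yeO : `|y ** e - x0| <= rho by have := eO 1; rewrite scale1r ler01 lexx; apply.
  have yO : `|y - x0| <= rho by have := eO 0; rewrite scale0r gmul0 lexx ler01; apply.
  have [_] := MP _ yeO; have [_] := MP _ yO.
  rewrite !ler_norml => /andP[h1 h2] /andP[h3 h4] h5.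
  have -> : L * `|h| = l * (2 * M) by rewrite /L /l; field; rewrite lt0r_neq0.
  move: l01 => /andP[l0 l1].
  have : l * (u (y ** e) - u y) <= l * (2 * M) by rewrite ler_wpM2l //; lra.
  lra.
exists (Num.min r1 r2); first by rewrite lt_min r10.
exists L => // y h; rewrite !le_min => /andP[y1 y2] hH /andP[h1 h2].
have yh := r2P y h y2 h2; split; first by have [] := MP _ (r1P y h y1 h1).
rewrite ler_norml side // andbT lerNl opprB.
have := side (y ** h) (- h) yh; rewrite gmulK rpredN normrN; exact.
Qed.

Lemma h_convex_continuous x0 e : Omega x0 -> 0 < e -> exists2 r, 0 < r &
  forall y, `|y - x0| <= r -> Omega y /\ `|u y - u x0| <= e.
Proof.
move=> Ox0 e0; have [r1 r10 [L L0 LP]] := horizontal_lipschitz Ox0.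
have [N NP] := path_from x0.
have [r2 /andP[r20 r21] r2P] := path_near x0 N r10.
pose rho := Num.min r2 (e / (N.+1%:R * L)).
have rho0 : 0 < rho by rewrite lt_min r20 divr_gt0 // mulr_gt0.
have [r3 r30 r3P] := NP _ rho0.
have [r4 r40 r4P] := open_norm_ball oO Ox0.
exists (Num.min r3 r4); first by rewrite lt_min r30.
move=> y; rewrite le_min => /andP[/r3P[l [lN lH yl]] /r4P Oy]; split=> //.
have near := r2P x0 l; rewrite subrr normr0 in near.
have lH2 : horizontal_path G l r2.
  by move=> a /lH[aH]; rewrite le_min => /andP[].
have {}near i := near (ltW r20) (eq_leq lN) lH2 i.
have step i : (i <= N)%N -> `|u (x0 ** gprod (take i l)) - u x0| <= i%:R * (L * rho).
  elim: i => [|i IH] iN; first by rewrite take0 /= gmul0 subrr normr0 mul0r.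
  have il : (i < size l)%N by rewrite lN.
  rewrite gprod_take_S // gmulA; set z := x0 ** _ in IH *.
  have [aH ar] := lH _ (mem_nth 0 il); set a := nth 0 l i in aH ar *.
  have ar1 : `|a| <= r1 by apply: le_trans ar (le_trans _ r21); rewrite ge_min lexx.
  have [_ h] := LP z a (near i) aH ar1.
  rewrite -(subrK (u z) (u (z ** a))) -addrA; apply: (le_trans (ler_normD _ _)).
  rewrite -natr1 mulrDl mul1r [leRHS]addrC; apply: lerD; last exact: IH (ltnW iN).
  by apply: (le_trans h); rewrite ler_pM2l.
have := step N (leqnn N); rewrite take_oversize ?lN // -yl => /le_trans; apply.
have : rho * (N.+1%:R * L) <= e by rewrite -ler_pdivlMr ?mulr_gt0 // ge_min lexx orbT.
have : 0 <= L * rho by rewrite mulr_ge0 // ltW.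
by rewrite -natr1; lra.
Qed.

End Lipschitz.

(** * The inner product *)

Section InnerProduct.
Variables (R : realType) (n : nat) (G : stratifiedGroup R n).
Local Notation V := 'rV[R]_n.
Local Notation "x ** y" := (gmul G x y) (at level 40, left associativity).
Local Notation H1 := (layer G 1).
Variable ip : {dot V for idfun}.

Lemma ipC x y : ip x y = ip y x.
Proof. by rewrite hermC expr0 mul1r. Qed.

Lemma ipPl a x y z : ip (a *: x + y) z = a * ip x z + ip y z.
Proof. by rewrite linearDl linearZl_LR. Qed.

Lemma ipPr a x y z : ip z (a *: x + y) = a * ip z x + ip z y.
Proof. by rewrite ipC ipPl !(ipC z). Qed.

Lemma ip0l z : ip 0 z = 0.
Proof. exact: linear0l. Qed.

Lemma ip0r z : ip z 0 = 0.
Proof. by rewrite ipC ip0l. Qed.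

Lemma ipDl x y z : ip (x + y) z = ip x z + ip y z.
Proof. by rewrite -[x]scale1r ipPl scale1r mul1r. Qed.

Lemma ipDr x y z : ip z (x + y) = ip z x + ip z y.
Proof. by rewrite ipC ipDl !(ipC z). Qed.

Lemma ipZl a x z : ip (a *: x) z = a * ip x z.
Proof. by rewrite -[a *: x]addr0 ipPl ip0l addr0. Qed.

Lemma ipZr a x z : ip z (a *: x) = a * ip z x.
Proof. by rewrite ipC ipZl ipC. Qed.

Lemma ipNl x z : ip (- x) z = - ip x z.
Proof. by rewrite -scaleN1r ipZl mulN1r. Qed.

Lemma ipNr x z : ip z (- x) = - ip z x.
Proof. by rewrite ipC ipNl ipC. Qed.

Lemma ip_gt0 x : x != 0 -> 0 < ip x x.
Proof. exact: neq0_dnorm_gt0. Qed.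

Lemma ip_ge0 x : 0 <= ip x x.
Proof. by have [->|x0] := eqVneq x 0; [rewrite ip0l | exact/ltW/ip_gt0]. Qed.

Lemma ip_eq0 x : ip x x = 0 -> x = 0.
Proof. by move=> xx; apply/eqP; apply: contraT => /ip_gt0; rewrite xx ltxx. Qed.

Lemma ip_bound : exists2 K : R, 0 < K & forall x y, `|ip x y| <= K * `|x| * `|y|.
Proof.
by apply: (@bilinear_bound _ _ _ R^o ip) => [y|x] a v w; rewrite ?ipPl ?ipPr.
Qed.

Lemma ip_continuous x e : 0 < e ->
  exists2 d, 0 < d & forall y, `|x - y| < d -> `|ip x x - ip y y| <= e.
Proof.
move=> e0; have [K K0 KP] := ip_bound.
pose M := K * (2 * `|x| + 1); have M0 : 0 < M by rewrite mulr_gt0 // ltr_wpDl // mulr_ge0.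
exists (Num.min 1 (e / M)); first by rewrite lt_min ltr01 divr_gt0.
move=> y; rewrite lt_min => /andP[xy1 xye].
have -> : ip x x - ip y y = ip (x - y) (x + y).
  by rewrite ipDl ipNl !ipDr (ipC y x); ring.
apply: (le_trans (KP _ _)).
have h : `|x + y| <= 2 * `|x| + 1.
  have -> : x + y = 2 *: x - (x - y) by apply/rowP => i; rewrite !mxE; ring.
  by rewrite (le_trans (ler_normB _ _)) // normrZ ger0_norm // lerD2l ltW.
apply: (@le_trans _ _ (M * `|x - y|)); last by rewrite mulrC -ler_pdivlMr // ltW.
by rewrite mulrAC /M ler_wpM2r // ler_pM2l.
Qed.

Lemma ip_coercive : exists2 c : R, 0 < c & forall x, c * `|x| ^+ 2 <= ip x x.
Proof.
have normal (x : V) : x != 0 -> exists2 s : V, `|s| = 1 & x = `|x| *: s.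
  move=> x0; have nx : `|x| != 0 by rewrite normr_eq0.
  exists (`|x|^-1 *: x); last by rewrite scalerA divff // scale1r.
  by rewrite normrZ ger0_norm ?invr_ge0 // mulVf.
have [[s0 s01]|nosphere] := pselect ([set y : V | `|y| = 1] !=set0); last first.
  exists 1 => // x; have [->|/normal[s s1 _]] := eqVneq x 0.
    by rewrite normr0 ip0l expr0n mulr0.
  by case: nosphere; exists s.
have [|||c cS cmin] := @compact_EVT_min _ _ (fun x => ip x x) [set y : V | `|y| = 1].
- by exists s0.
- exact: compact_norm_sphere.
- apply: (@continuous_withinP R V R^o) => x _ e e0.
  by have [d d0 dP] := ip_continuous x e0; exists d => // y _; exact: dP.
exists (ip c c).
  apply: ip_gt0; apply/eqP => c0; move: cS; rewrite inE /= c0 normr0 => /eqP.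
  by rewrite eq_sym oner_eq0.
move=> x; have [->|/normal[s s1 ->]] := eqVneq x 0.
  by rewrite normr0 ip0l expr0n mulr0.
rewrite normrZ normr_id s1 mulr1 ipZl ipZr mulrA -expr2 mulrC ler_wpM2l ?exprn_ge0 //.
by apply: cmin; rewrite inE.
Qed.

Hypothesis ad : adapted_dot G ip.

Lemma ip_layers i j x y : i != j -> x \in layer G i -> y \in layer G j -> ip x y = 0.
Proof. by move=> /ad /orthovP h xi yj; exact: h. Qed.

Lemma ip_bracket p x y : p \in H1 -> ip p (bracket G x y) = 0.
Proof.
move=> pH; apply: (layers_ind (G := G) (P := fun x => ip p (bracket G x y) = 0)) x.
- by rewrite linear0l ip0r.
- by move=> x x' xP x'P; rewrite linearDl /= ipDr xP x'P addr0.
move=> i x /andP[i0 _] xi.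
apply: (layers_ind (G := G) (P := fun y => ip p (bracket G x y) = 0)) y.
- by rewrite linear0r ip0r.
- by move=> y y' yP y'P; rewrite linearDr /= ipDr yP y'P addr0.
move=> j y /andP[j0 _] yj; apply: (ip_layers (i := 1) (j := i + j)) => //; first by lia.
exact: bracket_layer.
Qed.

Lemma ip_gmul p x y : p \in H1 -> ip p (x ** y) = ip p x + ip p y.
Proof.
move=> pH; have [T [T3 ->]] := gmul_expansion G.
rewrite !ipDr ipZr ip_bracket // mulr0 addr0 -[RHS]addr0; congr (_ + _).
elim: T T3 => [|t T IH]; first by rewrite big_nil ip0r.
move=> /= /andP[t3 T3]; rewrite big_cons ipPr (IH T3) addr0.
by case: t.2 t3 => [|a [|b p']] //= _; rewrite /bracket_word /= ip_bracket // mulr0.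
Qed.

Lemma orthogonal_split x : exists2 a, a \in H1 &
  exists2 b, x = a + b & forall h, h \in H1 -> ip b h = 0.
Proof.
apply: (layers_ind (G := G) (P := fun x => exists2 a, a \in H1 &
  exists2 b, x = a + b & forall h, h \in H1 -> ip b h = 0)) x.
- by exists 0; [exact: mem0v | exists 0; [rewrite addr0 | move=> h _; rewrite ip0l]].
- move=> x x' [a aH [b -> bO]] [a' a'H [b' -> b'O]].
  exists (a + a'); first exact: memvD.
  by exists (b + b'); [rewrite addrACA | move=> h hH; rewrite ipDl bO ?b'O ?addr0].
- move=> j x _ xj; have [j1|j1] := eqVneq j 1%N.
    subst j; exists x => //; exists 0; first by rewrite addr0.
    by move=> h _; rewrite ip0l.
  exists 0; first exact: mem0v.
  by exists x; [rewrite add0r | move=> h hH; exact: (ip_layers j1)].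
Qed.

Lemma riesz (f : V -> R) : (forall a x y, f (a *: x + y) = a * f x + f y) ->
  exists2 p, p \in H1 & forall h, h \in H1 -> ip p h = f h.
Proof.
move=> fl; pose M : 'M[R]_n := \matrix_(i, j) ip (delta_mx ord0 i) (delta_mx ord0 j).
have ipM (x y : V) : ip x y = (x *m M *m y^T) ord0 ord0.
  rewrite {1}(row_sum_delta y).
  have h (r : seq 'I_n) : ip x (\sum_(i <- r) y ord0 i *: delta_mx ord0 i) =
      \sum_(i <- r) ip x (delta_mx ord0 i) * y ord0 i.
    by elim: r => [|i r IH]; rewrite ?big_nil ?ip0r // !big_cons ipPr IH mulrC.
  rewrite h mxE; apply: eq_bigr => j _; rewrite [y^T _ _]mxE; congr (_ * _).
  rewrite {1}(row_sum_delta x) mxE.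
  have h' (r : seq 'I_n) : ip (\sum_(i <- r) x ord0 i *: delta_mx ord0 i) (delta_mx ord0 j) =
      \sum_(i <- r) x ord0 i * ip (delta_mx ord0 i) (delta_mx ord0 j).
    by elim: r => [|i r IH]; rewrite ?big_nil ?ip0l // !big_cons ipPl IH.
  by rewrite h'; apply: eq_bigr => i _; rewrite [M _ _]mxE.
have Mu : M \in unitmx.
  rewrite -row_free_unit; apply: inj_row_free => v vM.
  by apply: ip_eq0; rewrite ipM vM mul0mx mxE.
pose w : V := \row_j f (delta_mx ord0 j).
have fE x : f x = (w *m x^T) ord0 ord0.
  rewrite {1}(row_sum_delta x) mxE.
  have f0 : f 0 = 0 by have := fl (-1) 0 0; rewrite scaler0 addr0 mulN1r addNr.
  have h (r : seq 'I_n) : f (\sum_(i <- r) x ord0 i *: delta_mx ord0 i) =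
      \sum_(i <- r) x ord0 i * f (delta_mx ord0 i).
    by elim: r => [|i r IH]; rewrite ?big_nil ?f0 // !big_cons fl IH.
  by rewrite h; apply: eq_bigr => i _; rewrite !mxE mulrC.
have [p pH [b wE bO]] := orthogonal_split (w *m invmx M).
exists p => // h hH; rewrite fE -(mulmxKV Mu w) -ipM wE ipDl (bO h hH) addr0 //.
Qed.

Lemma layer1_proj_ip p x : p \in H1 -> ip p (layer1_proj G ip x) = ip p x.
Proof.
move=> pH; rewrite /layer1_proj; set W := orthov ip H1.
have HW : (H1 :&: W = 0)%VS.
  apply/eqP; rewrite -subv0; apply/subvP => v; rewrite memv_cap memv0 => /andP[vH /mem_orthovP vW].
  by apply/eqP/ip_eq0; exact: vW.
have xHW : x \in (H1 + W)%VS.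
  have [a aH [b -> bO]] := orthogonal_split x.
  by apply: memv_add => //; apply/mem_orthovP => h hH; exact: bO.
rewrite -[in RHS](daddv_pi_add HW xHW) ipDr [X in _ + X](_ : _ = 0) ?addr0 //.
have /mem_orthovP h := memv_pi W H1 x.
by rewrite ipC; exact: h.
Qed.

End InnerProduct.

(** * The h-subdifferential *)

Section Subdifferential.
Variables (R : realType) (n : nat) (G : stratifiedGroup R n).
Local Notation V := 'rV[R]_n.
Local Notation "x ** y" := (gmul G x y) (at level 40, left associativity).
Local Notation H1 := (layer G 1).
Variable ip : {dot V for idfun}.
Hypothesis ad : adapted_dot G ip.
Variables (Omega : set V) (u : V -> R).
Local Notation subdiff := (h_subdifferential G ip Omega u).
Hypothesis uconv : h_convex G Omega u.
Hypothesis ucont : forall x0 e, Omega x0 -> 0 < e -> exists2 r, 0 < r &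
  forall y, `|y - x0| <= r -> Omega y /\ `|u y - u x0| <= e.
Hypothesis ulip : forall x0, Omega x0 -> exists2 r, 0 < r & exists2 L, 0 < L &
  forall y h, `|y - x0| <= r -> h \in H1 -> `|h| <= r ->
    Omega (y ** h) /\ `|u (y ** h) - u y| <= L * `|h|.

Lemma segment_in_translate x h : [set t *: h | t in `[0%R, 1%R]%classic] `<=` gmul G (ginv x) @` Omega <->
  forall t, 0 <= t <= 1 -> Omega (x ** (t *: h)).
Proof.
split=> [hO t t01|hO _ [t t01 <-]].
  have [|z Oz <-] := hO (t *: h); last by rewrite gNKmul.
  by exists t => //; rewrite /= in_itv.
exists (x ** (t *: h)); last by rewrite /ginv gKmul.
by apply: hO; move: t01; rewrite /= in_itv.
Qed.

Lemma subdiffP x p h : subdiff x p -> h \in H1 ->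
  (forall t, 0 <= t <= 1 -> Omega (x ** (t *: h))) -> u x + ip p h <= u (x ** h).
Proof. by move=> [_ pP] hH hO; apply: pP => //; apply/segment_in_translate. Qed.

(** Difference quotients of a convex function of one variable increase, so their
    limit at the base point bounds the one over the whole segment from below. *)
Lemma subdiff_first_order x p : p \in H1 ->
  (forall h eta, h \in H1 -> 0 < eta -> exists2 t0, 0 < t0 & forall t, 0 < t <= t0 ->
     u x + t * ip p h - eta * t <= u (x ** (t *: h))) -> subdiff x p.
Proof.
move=> pH pP; split=> // h hH /segment_in_translate hO.
apply/ler_addgt0Pr => eta eta0.
have [t0 t00 tP] := pP h eta hH eta0.
pose t := Num.min 1 t0; have t_gt0 : 0 < t by rewrite lt_min ltr01.
have t1 : t <= 1 by rewrite ge_min lexx.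
have := tP t; rewrite t_gt0 /= ge_min lexx orbT => /(_ isT) h1.
have := h_convexP uconv hH hO; move=> /(_ t); rewrite (ltW t_gt0) t1 => /(_ isT) h2.
rewrite -subr_ge0; rewrite -(pmulr_rge0 _ t_gt0); lra.
Qed.

(** The radius is common to all the base points near [x0], which allows passing to
    the limit in the base point. *)
Lemma subdiff_near x0 : Omega x0 -> exists2 r, 0 < r & exists2 L, 0 < L &
  forall y h, `|y - x0| <= r -> h \in H1 -> `|h| <= r ->
    [/\ Omega (y ** h), `|u (y ** h) - u y| <= L * `|h| &
        forall p, subdiff y p -> u y + ip p h <= u (y ** h)].
Proof.
move=> Ox0; have [r r0 [L L0 LP]] := ulip Ox0.
exists r => //; exists L => // y h yr hH hr.
have [hO h1] := LP y h yr hH hr; split=> // p py.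
apply: (subdiffP py hH) => t /andP[t0 t1].
apply: (LP y _ yr _ _).1; first exact: memvZ.
by rewrite normrZ ger0_norm // (le_trans _ hr) // ler_piMl.
Qed.

(** Test the subgradient inequality with a multiple of the subgradient itself. *)
Lemma subdiff_bounded x0 : Omega x0 -> exists2 r, 0 < r & exists2 B, 0 < B &
  forall y p, `|y - x0| <= r -> subdiff y p -> `|p| <= B.
Proof.
move=> Ox0; have [r r0 [L L0 LP]] := subdiff_near Ox0.
have [c c0 cP] := ip_coercive ip.
exists r => //; exists (L / c); first exact: divr_gt0.
move=> y p yr py; have [->|p0] := eqVneq p 0; first by rewrite normr0 divr_ge0 // ltW.
have np : 0 < `|p| by rewrite normr_gt0.
pose t := r / `|p|; have t0 : 0 < t by rewrite divr_gt0.
have [|_ h1 h2] := LP y (t *: p) yr (memvZ _ py.1).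
  by rewrite normrZ gtr0_norm // /t divfK // lt0r_neq0.
have {}h2 := h2 p py; rewrite ipZr in h2; have h3 : t * ip p p <= L * (t * `|p|).
  have := le_trans (ler_norm _) h1; rewrite normrZ gtr0_norm //; lra.
have h4 : ip p p <= L * `|p| by rewrite -(ler_pM2l t0) mulrCA.
rewrite ler_pdivlMr // mulrC -(ler_pM2r np) -mulrA -expr2.
exact: le_trans (cP p) h4.
Qed.

Lemma layer1_closed p : (forall e, 0 < e -> exists2 q, q \in H1 & `|q - p| <= e) -> p \in H1.
Proof.
move=> pH; pose f (v : V) := v - projv H1 v.
have lf : linear f by move=> a v w; rewrite /f linearP scalerBr opprD addrACA.
have f0 (v : V) : (v \in H1) = (f v == 0).
  rewrite /f subr_eq0; apply/idP/eqP => [vW|->]; first by rewrite projv_id.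
  exact: memv_proj.
have [D D0 DP] := linear_bound lf.
rewrite f0 -normr_eq0 eq_le normr_ge0 andbT; apply/ler_addgt0Pl => e e0; rewrite addr0.
have [|q qH qp] := pH (e / D); first exact: divr_gt0.
have -> : f p = - f (q - p).
  have := lf (-1) p q; rewrite !scaleN1r [- p + q]addrC => ->.
  by move: qH; rewrite f0 => /eqP ->; rewrite addr0 opprK.
by rewrite normrN (le_trans (DP _)) // mulrC -ler_pdivlMr.
Qed.

Lemma subdiff_closed x p : Omega x -> (forall e, 0 < e -> exists y q,
   [/\ `|y - x| <= e, `|q - p| <= e & subdiff y q]) -> subdiff x p.
Proof.
move=> Ox lim; apply: subdiff_first_order.
  by apply: layer1_closed => e e0; have [y [q [_ qp [qH _]]]] := lim e e0; exists q.
move=> h eta hH eta0; have [r r0 [L L0 LP]] := subdiff_near Ox.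
have [K K0 KP] := ip_bound ip.
have nh : 0 < 1 + `|h| by rewrite ltr_pwDl.
exists (r / (1 + `|h|)); first exact: divr_gt0.
move=> t /andP[t0 tr].
have thr : `|t *: h| <= r.
  rewrite normrZ gtr0_norm // (le_trans (_ : _ <= t * (1 + `|h|))) ?ler_pM2l ?lerDr //.
  by rewrite -ler_pdivlMr.
have thH : t *: h \in H1 by exact: memvZ.
apply/ler_addgt0Pr => e e0.
have [|hO _ _] := LP x (t *: h) _ thH thr; first by rewrite subrr normr0 ltW.
have [r1 r10 r1P] := ucont hO (divr_gt0 e0 (ltr0n R 2)).
have [r2 r20 r2P] := ucont Ox (divr_gt0 e0 (ltr0n R 2)).
have M0 : 0 < `|x| + 1 + `|t *: h| by rewrite ltr_pwDl // ltr_wpDl.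
have [C C0 CP] := gmul_lipschitz G M0.
pose e1 := Num.min (Num.min r r2) (Num.min (Num.min 1 (r1 / C)) (eta / (K * (1 + `|h|)))).
have e10 : 0 < e1 by rewrite !lt_min r0 r20 ltr01 !divr_gt0 // mulr_gt0.
have [y [q [yx qp qy]]] := lim e1 e10.
move: yx; rewrite !le_min => /andP[/andP[yr yr2] /andP[/andP[y1 yr1] _]].
have qp' : `|q - p| <= eta / (K * (1 + `|h|)).
  by move: qp; rewrite !le_min => /andP[_ /andP[_]].
have [_ _ sub] := LP y (t *: h) yr thH thr; have {}sub := sub q qy.
have xb : `|x| <= `|x| + 1 + `|t *: h| by rewrite -addrA lerDl addr_ge0.
have yb : `|y| <= `|x| + 1 + `|t *: h|.
  by rewrite -(subrK x y) (le_trans (ler_normD _ _)) // addrC -addrA lerD2l (le_trans y1) // lerDl.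
have hb : `|t *: h| <= `|x| + 1 + `|t *: h| by rewrite lerDr addr_ge0.
have [|_ u1] := r1P (y ** (t *: h)).
  apply: (le_trans (CP _ _ _ _ yb hb xb hb)).
  by rewrite subrr normr0 addr0 mulrC -ler_pdivlMr.
have [_ u2] := r2P y yr2.
have ipq : `|ip (q - p) h| <= eta.
  apply: (le_trans (KP _ _)); apply: (@le_trans _ _ (K * (1 + `|h|) * `|q - p|)).
    rewrite mulrAC ler_wpM2r //; rewrite ler_pM2l // lerDr //.
  by rewrite mulrC -ler_pdivlMr // mulr_gt0.
move: u1 u2 ipq; rewrite ipDl ipNl !ler_norml ipZr in sub * => /andP[a1 a2] /andP[a3 a4] /andP[a5 a6].
have : t * (- eta) <= t * (ip q h - ip p h) by rewrite ler_pM2l.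
lra.
Qed.

(** Cluster points of the filter generated by the sets of the [q] with [P e q]. *)
Lemma compact_extract B (P : R -> V -> Prop) :
  (forall e, 0 < e -> exists2 q, `|q| <= B & P e q) ->
  (forall e e' q, P e q -> e <= e' -> P e' q) ->
  exists2 q0, `|q0| <= B & forall e, 0 < e -> exists2 q, `|q - q0| <= e & P e q.
Proof.
move=> PB Pmono.
pose A e := [set q : V | `|0 - q| <= B] `&` [set q | P e q].
pose F := filter_from [set e : R | 0 < e] A.
have FF : ProperFilter F.
  apply: filter_from_proper; last first.
    by move=> e e0; have [q qB qP] := PB e e0; exists q; split=> //=; rewrite sub0r normrN.
  apply: filter_from_filter; first by exists 1; exact: ltr01.
  move=> e e' e0 e'0; exists (Num.min e e'); first by rewrite /= lt_min e0.
  by move=> q [qB qP]; split; split=> //; apply: Pmono qP _; rewrite ge_min lexx ?orbT.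
have [|q0 [q0B cl]] := compact_norm_ball (x := 0) (r := B) FF.
  by exists 1; [exact: ltr01 | move=> q []].
exists q0; first by move: q0B; rewrite /= sub0r normrN.
move=> e e0; have FA : F (A e) by exists e.
have [q [[_ qP] qe]] := cl _ _ FA (nbhsx_ballx q0 e e0).
by exists q => //; move: qe; rewrite -ball_normE /= distrC => /ltW.
Qed.

(** For [k] large the minimum of [w + k * N] over a small ball is attained at an
    interior point [y]; there a smooth function touches [w] from below, and the
    left translation by [y] is differentiable at the unit. *)
Lemma touching w x0 e : Omega x0 -> 0 < e ->
  (forall x0 e, Omega x0 -> 0 < e -> exists2 r, 0 < r &
     forall y, `|y - x0| <= r -> Omega y /\ `|w y - w x0| <= e) ->
  exists2 y, Omega y /\ `|y - x0| <= e & exists2 g : V -> R,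
    forall a z z', g (a *: z + z') = a * g z + g z' &
    exists2 r, 0 < r & exists2 D, 0 < D &
      forall h, `|h| <= r -> w y + g h - D * `|h| ^+ 2 <= w (y ** h).
Proof.
move=> Ox0 e0 wcont; have [r r0 rP] := wcont x0 1 Ox0 ltr01.
pose rho := Num.min r e; have rho0 : 0 < rho by rewrite lt_min r0.
have [c c0 cP] := ip_coercive ip; have [K K0 KP] := ip_bound ip.
pose N z := ip (z - x0) (z - x0).
pose k := 2 / (c * rho ^+ 2); have k0 : 0 < k by rewrite divr_gt0 // mulr_gt0 // exprn_gt0.
pose ball := [set z : V | `|x0 - z| <= rho].
have ballP z : ball z -> `|z - x0| <= r /\ `|z - x0| <= e.
  by rewrite /ball /= distrC le_min => /andP[].
have [|||y] := @compact_EVT_min _ _ (fun z => w z + k * N z) ball.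
- by exists x0; rewrite /ball /= subrr normr0 ltW.
- exact: compact_norm_ball.
- apply: (@continuous_withinP R V R^o) => z /ballP[zr _] eta eta0.
  have eta20 : 0 < eta / 2 by exact: divr_gt0.
  have [r1 r10 r1P] := wcont z _ (rP z zr).1 eta20.
  have [r2 r20 r2P] := ip_continuous ip (z - x0) (divr_gt0 eta20 k0).
  exists (Num.min r1 r2); first by rewrite lt_min r10.
  move=> z' _; rewrite lt_min => /andP[zz1 zz2].
  have [|_ h1] := r1P z'; first by rewrite distrC ltW.
  have := r2P (z' - x0); rewrite (_ : z - x0 - (z' - x0) = z - z'); last first.
    by rewrite opprB addrA subrK.
  move=> /(_ zz2); rewrite -/(N z) -/(N z') ler_pdivlMr // => h2.
  have -> : w z + k * N z - (w z' + k * N z') = (w z - w z') + (N z - N z') * k by ring.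
  apply: (le_trans (ler_normD _ _)); rewrite normrM (gtr0_norm k0).
  by rewrite distrC in h1; lra.
rewrite inE => yb ymin; have [yr ye] := ballP y yb.
have [Oy uy] := rP y yr.
have N0 : N x0 = 0 by rewrite /N subrr ip0l.
have yrho : `|y - x0| < rho.
  have := ymin x0; rewrite inE /ball /= subrr normr0 N0 => /(_ (ltW rho0)) h1.
  have h2 := cP (y - x0); rewrite -/(N y) in h2.
  have h3 : k * N y <= 1 by move: uy; rewrite ler_norml => /andP[]; lra.
  rewrite -(ltr_pXn2r (n := 2)) ?nnegrE ?(ltW rho0) //.
  have : k * (c * `|y - x0| ^+ 2) <= 1 by apply: le_trans h3; rewrite ler_pM2l.
  rewrite (_ : k * _ = 2 * `|y - x0| ^+ 2 / rho ^+ 2); last first.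
    by rewrite /k; field; rewrite !lt0r_neq0.
  have rho2 : 0 < rho ^+ 2 by rewrite exprn_gt0.
  by rewrite ler_pdivrMr //; lra.
have [A [Al [C C0 CP]]] := left_translation_diff G y.
have [a a0 aP] := linear_bound Al.
exists y; first by split.
exists (fun z => - (2 * k) * ip (y - x0) (A z)).
  by move=> t z z'; rewrite Al ipPr; ring.
have [|r1 r10 r1P] := @gmul_near _ _ G y (rho - `|y - x0|); first by rewrite subr_gt0.
exists (Num.min 1 r1); first by rewrite lt_min ltr01.
pose D := 2 * k * K * `|y - x0| * C + k * K * (a + C) ^+ 2.
have D0 : 0 < D.
  have h1 : 0 < k * K * (a + C) ^+ 2 by apply: mulr_gt0; [exact: mulr_gt0 | apply: exprn_gt0; exact: addr_gt0].
  have h2 : 0 <= 2 * k * K * C * `|y - x0| by apply: mulr_ge0 => //; apply: ltW; do ![apply: mulr_gt0 => //].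
  by rewrite /D [_ * `|y - x0| * C]mulrAC; lra.
exists D => // h; rewrite le_min => /andP[h1 hr1].
pose v := y ** h - y.
have vb : ball (y ** h).
  have := r1P y h; rewrite subrr normr0 => /(_ (ltW r10) hr1) hv.
  rewrite /ball /= distrC -(subrK y (y ** h)) -addrA (le_trans (ler_normD _ _)) //.
  by move: hv; lra.
have := ymin (y ** h); rewrite inE => /(_ vb) wmin.
have NE : N (y ** h) = N y + 2 * ip (y - x0) v + ip v v.
  rewrite /N (_ : y ** h - x0 = (y - x0) + v); last first.
    by rewrite /v; move: (y ** h) => t; apply/rowP => i; rewrite !mxE; ring.
  move: (y - x0) (v) => q' v'.
  by rewrite ipDl !ipDr (ipC ip v' q'); ring.
have e1 : `|v - A h| <= C * `|h| ^+ 2 by exact: CP.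
have e2 : `|v| <= (a + C) * `|h|.
  rewrite -(subrK (A h) v) (le_trans (ler_normD _ _)) // mulrDl addrC lerD ?aP //.
  by apply: (le_trans e1); rewrite ler_pM2l // expr2 ler_piMl.
have e3 : ip (y - x0) v - ip (y - x0) (A h) <= K * `|y - x0| * (C * `|h| ^+ 2).
  rewrite -ipNr -ipDr; apply: (le_trans (ler_norm _)); apply: (le_trans (KP _ _)).
  by rewrite ler_wpM2l // mulr_ge0 // ltW.
have e4 : ip v v <= K * ((a + C) ^+ 2 * `|h| ^+ 2).
  apply: (le_trans (ler_norm _)); apply: (le_trans (KP _ _)).
  by rewrite -mulrA ler_pM2l // -exprMn expr2 ler_pM.
have e5 : 2 * k * (ip (y - x0) v - ip (y - x0) (A h)) <= 2 * k * (K * `|y - x0| * (C * `|h| ^+ 2)).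
  by rewrite ler_pM2l // mulr_gt0.
have e6 : k * ip v v <= k * (K * ((a + C) ^+ 2 * `|h| ^+ 2)) by rewrite ler_pM2l.
move: wmin; rewrite NE /D; lra.
Qed.

End Subdifferential.

(** * Existence and uniqueness of subgradients *)

Section Differentiability.
Variables (R : realType) (n : nat) (G : stratifiedGroup R n).
Local Notation V := 'rV[R]_n.
Local Notation "x ** y" := (gmul G x y) (at level 40, left associativity).
Local Notation H1 := (layer G 1).
Local Notation gprod := (gprod G).
Variable ip : {dot V for idfun}.
Hypothesis ad : adapted_dot G ip.
Variables (Omega : set V) (u : V -> R).
Local Notation subdiff := (h_subdifferential G ip Omega u).
Hypothesis uconv : h_convex G Omega u.
Hypothesis ucont : forall x0 e, Omega x0 -> 0 < e -> exists2 r, 0 < r &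
  forall y, `|y - x0| <= r -> Omega y /\ `|u y - u x0| <= e.
Hypothesis ulip : forall x0, Omega x0 -> exists2 r, 0 < r & exists2 L, 0 < L &
  forall y h, `|y - x0| <= r -> h \in H1 -> `|h| <= r ->
    Omega (y ** h) /\ `|u (y ** h) - u y| <= L * `|h|.

Lemma increment_bound (v v' g b q q' c k : R) :
  v + q <= v' -> v' - q' <= v -> `|q - b| <= c -> `|q' - b| <= c -> `|v - g| <= k ->
  `|v' - (g + b)| <= k + c.
Proof.
rewrite !ler_norml => h1 h2 /andP[h3 h4] /andP[h5 h6] /andP[h7 h8].
by apply/andP; split; lra.
Qed.

Lemma small_scale (h : V) r D eta : 0 < r -> 0 < D -> 0 < eta ->
  exists2 t0, 0 < t0 & forall t, 0 < t <= t0 -> `|t *: h| <= r /\ D * `|t *: h| ^+ 2 <= eta * t.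
Proof.
move=> r0 D0 eta0; pose k := 1 + `|h|.
have k0 : 0 < k by rewrite ltr_pwDl.
exists (Num.min (r / k) (eta / (D * k ^+ 2))).
  by rewrite lt_min !divr_gt0 // mulr_gt0 // exprn_gt0.
move=> t /andP[t0]; rewrite le_min => /andP[tr te].
have hk : `|h| <= k by rewrite /k lerDr.
rewrite normrZ gtr0_norm //; split.
  by apply: (le_trans (_ : _ <= t * k)); [rewrite ler_pM2l | rewrite -ler_pdivlMr].
have {}te : t * (D * k ^+ 2) <= eta by rewrite -ler_pdivlMr // mulr_gt0 // exprn_gt0.
have hk2 : `|h| ^+ 2 <= k ^+ 2 by rewrite lerXn2r ?nnegrE ?(ltW k0) //.
apply: (@le_trans _ _ (t * (D * k ^+ 2) * t)); last by rewrite ler_pM2r.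
rewrite (_ : D * _ = D * `|h| ^+ 2 * t ^+ 2); last by ring.
rewrite (_ : t * _ * t = D * k ^+ 2 * t ^+ 2); last by ring.
by rewrite ler_pM2r ?exprn_gt0 // ler_pM2l.
Qed.

Lemma subdiff_dense x0 e : Omega x0 -> 0 < e ->
  exists2 y, Omega y /\ `|y - x0| <= e & exists q, subdiff y q.
Proof.
move=> Ox0 e0.
have [y Oy [g gl [r r0 [D D0 gP]]]] := @touching _ _ G ip Omega u x0 e Ox0 e0 ucont.
exists y => //; have [q qH qP] := riesz ad gl.
exists q; apply: (subdiff_first_order uconv) => // h eta hH eta0.
have [t0 t00 tP] := small_scale h r0 D0 eta0.
exists t0 => // t tt; have [thr thD] := tP t tt.
have := gP _ thr; rewrite -(qP (t *: h)) ?memvZ // ipZr; lra.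
Qed.

Lemma subdiff_nonempty x : Omega x -> exists q, subdiff x q.
Proof.
move=> Ox; have [r r0 [B B0 BP]] := subdiff_bounded ip ulip Ox.
have [||q0 _ q0P] := @compact_extract R n B (fun e q => exists2 y, `|y - x| <= e & subdiff y q).
- move=> e e0; have [|y [Oy yx] [q yq]] := subdiff_dense Ox (_ : 0 < Num.min e r).
    by rewrite lt_min e0.
  move: yx; rewrite le_min => /andP[ye yr].
  by exists q; [exact: BP yq | exists y].
- by move=> e e' q [y ye yq] ee'; exists y => //; exact: le_trans ee'.
exists q0; apply: (subdiff_closed uconv ucont ulip Ox) => e e0.
by have [q qq [y yx yq]] := q0P e e0; exists y, q.
Qed.

(** Where [u] is touched from above by a smooth function, a subgradient is bounded by
    the differential of this function in the directions [h] and [- h]. *)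
Lemma subdiff_unique_dense x0 e : Omega x0 -> 0 < e ->
  exists2 y, Omega y /\ `|y - x0| <= e & forall q q', subdiff y q -> subdiff y q' -> q = q'.
Proof.
move=> Ox0 e0.
have [|y [Oy yx] [g gl [r r0 [D D0 gP]]]] := @touching _ _ G ip Omega (fun z => - u z) x0 e Ox0 e0.
  move=> z eta Oz eta0; have [s s0 sP] := ucont Oz eta0; exists s => // y /sP[Oy h].
  by split=> //; rewrite -opprD normrN.
exists y; first by split.
have [r1 r10 [L L0 LP]] := subdiff_near ip ulip Oy.
have le q h : subdiff y q -> h \in H1 -> ip q h <= - g h.
  move=> yq hH; apply/ler_addgt0Pr => eta eta0.
  have rr1 : 0 < Num.min r r1 by rewrite lt_min r0.
  have [t0 t00 tP] := small_scale h rr1 D0 eta0.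
  have [|] := tP t0; first by rewrite t00 lexx.
  rewrite le_min => /andP[thr thr1] thD.
  have [|_ _ sub] := LP y (t0 *: h) _ (memvZ _ hH) thr1; first by rewrite subrr normr0 ltW.
  have := sub q yq; have := gP _ thr; rewrite /=.
  have -> : g (t0 *: h) = t0 * g h.
    have g0 : g 0 = 0 by have := gl (-1) 0 0; rewrite scaler0 addr0 mulN1r addNr.
    by rewrite -[t0 *: h]addr0 gl g0 addr0.
  by rewrite ipZr => h1 h2; rewrite -(ler_pM2l t00); lra.
have eq q h : subdiff y q -> h \in H1 -> ip q h = - g h.
  move=> yq hH; apply/eqP; rewrite eq_le le //= lerNl.
  have := le q (- h) yq; rewrite rpredN ipNr => /(_ hH).
  have -> : g (- h) = - g h.
    have g0 : g 0 = 0 by have := gl (-1) 0 0; rewrite scaler0 addr0 mulN1r addNr.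
    by rewrite -scaleN1r -[-1 *: h]addr0 gl g0 addr0 mulN1r.
  by rewrite opprK.
move=> q q' yq yq'; apply/eqP; rewrite -subr_eq0; apply/eqP/(ip_eq0 (ip := ip)).
have qqH : q - q' \in H1 by rewrite rpredB; [| case: yq | case: yq'].
by rewrite ipDl ipNl !eq // subrr.
Qed.

(** Otherwise subgradients far from [p] at points tending to [x] would have a limit,
    which is a subgradient at [x] by [subdiff_closed]. *)
Lemma subdiff_usc x p e : Omega x -> subdiff x p -> (forall q, subdiff x q -> q = p) -> 0 < e ->
  exists2 r, 0 < r & forall y q, `|y - x| <= r -> subdiff y q -> `|q - p| <= e.
Proof.
move=> Ox px puniq e0; apply: contrapT => no.
have [r r0 [B B0 BP]] := subdiff_bounded ip ulip Ox.
have [||q0 _ q0P] := @compact_extract R n B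
   (fun s q => e < `|q - p| /\ exists2 y, `|y - x| <= s & subdiff y q).
- move=> s s0; apply: contrapT => no'; apply: no.
  exists (Num.min s r); first by rewrite lt_min s0.
  move=> y q; rewrite le_min => /andP[ys yr] yq; rewrite leNgt; apply/negP => eq.
  by apply: no'; exists q; [exact: BP yq | split=> //; exists y].
- by move=> s s' q [eq [y ys yq]] ss'; split=> //; exists y => //; exact: le_trans ss'.
have q0x : subdiff x q0.
  apply: (subdiff_closed uconv ucont ulip Ox) => s s0.
  by have [q qq [_ [y yx yq]]] := q0P s s0; exists y, q.
have [q qq0 [eq _]] := q0P e e0.
by move: eq; rewrite -(puniq _ q0x) ltNge qq0.
Qed.

Variable d : V -> V -> R.
Hypothesis dH : homogeneous_distance G d.

(** At a point with a single subgradient [p], all the subgradients at nearby points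
    are close to [p]; along a horizontal path from [x] to [x z] with few steps, of
    lengths comparable with [d 0 z], each increment of [u] is squeezed between
    the subgradients at its two ends. *)
Lemma unique_subgradient_is_gradient x p : Omega x -> subdiff x p ->
  (forall q, subdiff x q -> q = p) -> is_h_gradient G ip d u x p.
Proof.
move=> Ox px puniq; have pH := px.1; split=> //.
have psc : scalar (fun z => ip p z) by move=> a v w; rewrite ipPr.
pose L : {scalar V} := HB.pack (fun z => ip p z) (GRing.isLinear.Build R V R *%R (fun z => ip p z) psc).
exists L; split=> //; first by move=> z; rewrite /L /= layer1_proj_ip.
apply/eqoP => e e0.
have [N [C C0 CP]] := connect_scaled G.
have [D D0 DP] := hdist_control dH.
have [K K0 KP] := ip_bound ip.
pose eta := e / (N.+1%:R * (K * (C * D))).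
have eta0 : 0 < eta by rewrite divr_gt0 // !mulr_gt0.
have [r1 r10 r1P] := subdiff_usc Ox px puniq eta0.
have [r2 r20 [M M0 MP]] := subdiff_near ip ulip Ox.
pose r3 := Num.min r1 r2; have r30 : 0 < r3 by rewrite lt_min r10.
have [r4 /andP[r40 r43] r4P] := path_near G x N r30.
have small : \forall z \near nbhs (0 : V), d 0 z < r4 / (C * D).
  have d00 : d 0 0 = 0 by have [d0 _ _ _ _] := dH; apply/d0.
  have cz : d 0 z @[z --> (0 : V)] --> (0 : R).
    by have := @hdist_continuous _ _ G d dH 0; rewrite /continuous_at d00.
  have r0 : 0 < r4 / (C * D) by rewrite divr_gt0 // mulr_gt0.
  move/cvgrPdist_lt: cz => /(_ _ r0); apply: filterS => z.
  by rewrite sub0r normrN => /(le_lt_trans (ler_norm _)).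
apply: filterS small => z dz.
have [->|z0] := eqVneq z 0.
  by rewrite gmul0 subrr sub0r linear0 oppr0 normr0 mulr_ge0 // ltW.
have dz0 := hdist_gt0 dH z0.
have [w w1 zE] := DP z z0.
have [|l [lN lH lz]] := CP (D * d 0 z) w _ w1; first exact: mulr_gt0.
rewrite -zE in lz.
have lr : C * (D * d 0 z) <= r4.
  by rewrite mulrA mulrC -ler_pdivlMr ?mulr_gt0 // ltW.
have lH4 : horizontal_path G l r4 by move=> a /lH[aH ar]; split=> //; exact: le_trans lr.
have near i : `|x ** gprod (take i l) - x| <= r3.
  by apply: r4P => //; [rewrite subrr normr0 ltW | rewrite lN].
have near12 i : `|x ** gprod (take i l) - x| <= r1 /\ `|x ** gprod (take i l) - x| <= r2.
  by have := near i; rewrite le_min => /andP[].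
have inO i : Omega (x ** gprod (take i l)).
  have [_ y2] := near12 i.
  by have [] := MP _ 0 y2 (mem0v _) _; rewrite ?normr0 ?(ltW r20) ?gmul0.
have step i : (i <= N)%N -> `|u (x ** gprod (take i l)) - u x - ip p (gprod (take i l))|
    <= i%:R * (K * eta * (C * (D * d 0 z))).
  elim: i => [|i IH] iN; first by rewrite take0 /= gmul0 subrr sub0r ip0r oppr0 normr0 mul0r.
  have il : (i < size l)%N by rewrite lN.
  have [aH ar] := lH _ (mem_nth 0 il); have [_ ar4] := lH4 _ (mem_nth 0 il).
  have [yS1 yS2] := near12 i.+1; have [y1 y2] := near12 i.
  have OS := inO i.+1; have Oy := inO i.
  have {}IH := IH (ltnW iN).
  rewrite gprod_take_S // gmulA in yS1 yS2 OS *.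
  rewrite ip_gmul //.
  set a := nth 0 l i in aH ar ar4 yS1 yS2 OS *; set g := gprod (take i l) in IH y1 y2 Oy yS1 yS2 OS *.
  have ar2 : `|a| <= r2 by apply: le_trans ar4 (le_trans r43 _); rewrite ge_min lexx orbT.
  have [q1 q1y] := subdiff_nonempty Oy.
  have [q2 q2y] := subdiff_nonempty OS.
  have [_ _ s1] := MP _ a y2 aH ar2; have {}s1 := s1 q1 q1y.
  have aNH : - a \in H1 by rewrite rpredN.
  have aNr : `|- a| <= r2 by rewrite normrN.
  have [_ _ s2] := MP _ (- a) yS2 aNH aNr; have {}s2 := s2 q2 q2y.
  rewrite gmulK ipNr in s2.
  have cb q : `|q - p| <= eta -> `|ip q a - ip p a| <= K * eta * (C * (D * d 0 z)).
    move=> qp; rewrite -ipNl -ipDl; apply: (le_trans (KP _ _)).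
    apply: ler_pM => //; first by apply: mulr_ge0 => //; exact: ltW.
    by apply: ler_wpM2l => //; exact: ltW.
  have b1 := cb q1 (r1P _ _ y1 q1y); have b2 := cb q2 (r1P _ _ yS1 q2y).
  have -> : i.+1%:R * (K * eta * (C * (D * d 0 z))) =
     i%:R * (K * eta * (C * (D * d 0 z))) + K * eta * (C * (D * d 0 z)).
    by rewrite -natr1 mulrDl mul1r.
  rewrite -addrA -opprD addrA; apply: (increment_bound s1 s2 b1 b2).
  by rewrite opprD addrA.
have := step N (leqnn N); rewrite take_oversize ?lN // lz => /le_trans; apply.
rewrite (ger0_norm (ltW dz0)).
have -> : e * d 0 z = N.+1%:R * (K * eta * (C * (D * d 0 z))).
  by rewrite /eta; field; rewrite !lt0r_neq0 // ?ltr0n.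
rewrite ler_wpM2r ?ler_nat //.
by apply/ltW; do ![apply: mulr_gt0 => //].
Qed.

Lemma gradient_dense x0 e : Omega x0 -> 0 < e ->
  exists2 y, Omega y /\ `|y - x0| <= e & exists p, is_h_gradient G ip d u y p.
Proof.
move=> Ox0 e0; have [y [Oy yx] yuniq] := subdiff_unique_dense Ox0 e0.
exists y => //; have [p yp] := subdiff_nonempty Oy.
exists p; apply: unique_subgradient_is_gradient => // q yq; exact: yuniq.
Qed.

(** The dilations act on horizontal vectors by multiplication, so that [d 0 (t *: h)]
    is of order [t] and the expansion of [u] is of first order in [t]. *)
Lemma gradient_is_subgradient x p : is_h_gradient G ip d u x p -> subdiff x p.
Proof.
move=> [pH [L [_ Lo Lp]]]; apply: (subdiff_first_order uconv) => // h eta hH eta0.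
have := (eqoP _ _ _).1 Lo.
pose k := 1 + d 0 h; have k0 : 0 < k by rewrite ltr_pwDl // (hdist_ge0 dH).
move=> /(_ (eta / k)); rewrite divr_gt0 // => /(_ isT).
move=> /nbhs_ballP[s /= s0 sP].
exists (s / (2 * (1 + `|h|))); first by rewrite divr_gt0 // mulr_gt0 // ltr_pwDl.
move=> t /andP[t0 ts].
have ths : ball (0 : V) s (t *: h).
  rewrite -ball_normE /= sub0r normrN normrZ gtr0_norm //.
  have h0 : 0 < 1 + `|h| by rewrite ltr_pwDl.
  move: ts; rewrite ler_pdivlMr ?mulr_gt0 // => ts; have := normr_ge0 h => hh.
  have : 0 <= t * `|h| by rewrite mulr_ge0 // ltW.
  by lra.
have := sP _ ths; rewrite /= Lp ?memvZ // ipZr.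
have -> : d 0 (t *: h) = t * d 0 h.
  by rewrite -(hdist_dil dH _ t0) (dil_layer _ hH) expr1.
have d0 := hdist_ge0 dH h.
rewrite (ger0_norm (mulr_ge0 (ltW t0) d0)) ler_norml => /andP[h1 _].
have : eta / k * (t * d 0 h) <= eta * t.
  rewrite mulrCA [leRHS]mulrC ler_pM2l // mulrAC ler_pdivrMr // ler_pM2l //.
  by rewrite /k lerDr.
lra.
Qed.

End Differentiability.

(** * The closed convex hull of the reachable gradient *)

Section Reachable.
Variables (R : realType) (n : nat) (G : stratifiedGroup R n).
Local Notation V := 'rV[R]_n.
Local Notation "x ** y" := (gmul G x y) (at level 40, left associativity).
Local Notation H1 := (layer G 1).
Variable ip : {dot V for idfun}.

(** [q] is the projection of [p], which minimizes the distance to [p]. *)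
Lemma separation (K : set V) p : closed K -> K !=set0 ->
  (forall a b t, K a -> K b -> 0 <= t <= 1 -> K (t *: a + (1 - t) *: b)) -> ~ K p ->
  exists2 q, K q & forall k, K k -> ip (k - q) (p - q) <= 0.
Proof.
move=> clK [k0 Kk0] convK Kp.
have [c c0 cP] := ip_coercive ip.
pose N z := ip (z - p) (z - p).
pose r := N k0 / c + 1.
have N0 z : 0 <= N z by exact: ip_ge0.
have r1 : 1 <= r by rewrite lerDr divr_ge0 // ltW.
pose B := [set z : V | `|p - z| <= r] `&` K.
have inB z : N z <= N k0 -> `|p - z| <= r.
  move=> Nz; rewrite distrC leNgt; apply/negP => zr.
  have h1 := le_trans (cP (z - p)) Nz.
  have h2 : r <= `|z - p| ^+ 2.
    by rewrite expr2 (le_trans (ltW zr)) // ler_peMl // (le_trans r1) // ltW.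
  have : c * r <= N k0 by apply: le_trans h1; rewrite ler_pM2l.
  by rewrite /r mulrDr mulr1 mulrCA divff ?lt0r_neq0 // mulr1 gerDl leNgt c0.
have [|||q qB qmin] := @compact_EVT_min _ _ N B.
- by exists k0; split=> //=; exact: inB.
- by apply: compact_closedI => //; exact: compact_norm_ball.
- apply: (@continuous_withinP R V R^o) => z _ e e0.
  have [s s0 sP] := ip_continuous ip (z - p) e0; exists s => // y _ zy.
  by apply: sP; rewrite opprB addrA subrK.
move: qB; rewrite inE => -[_ Kq].
have qmin' k : K k -> N q <= N k.
  move=> Kk; have [h|h] := leP (N k) (N k0).
    by apply: qmin; rewrite inE; split=> //; exact: inB.
  apply: (le_trans _ (ltW h)); apply: qmin; rewrite inE; split=> //; exact: inB.
exists q => // k Kk; rewrite leNgt; apply/negP => pos.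
set a := ip (k - q) (p - q) in pos.
pose b := ip (k - q) (k - q) + 1.
have b0 : 0 < b by rewrite ltr_wpDl // ip_ge0.
pose t := Num.min 1 (a / b); have t0 : 0 < t by rewrite lt_min ltr01 divr_gt0.
have t01 : 0 <= t <= 1 by rewrite (ltW t0) ge_min lexx.
have := qmin' _ (convK k q t Kk Kq t01).
have tb : t * b <= a by rewrite -ler_pdivlMr // ge_min lexx orbT.
have -> : N (t *: k + (1 - t) *: q) = N q - 2 * t * a + t ^+ 2 * (b - 1).
  rewrite /N (_ : t *: k + _ - p = t *: (k - q) - (p - q)); last first.
    by apply/rowP => i; rewrite !mxE; ring.
  rewrite /a /b addrK -(opprB p q); move: (k - q) (p - q) => v w.
  by rewrite !ipDl !ipDr !ipNl !ipNr !ipZl !ipZr (ipC ip w v); ring.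
have : t * (t * b) <= t * a by rewrite ler_pM2l.
have : 0 < t * a by rewrite mulr_gt0.
have : 0 < t * t by rewrite mulr_gt0.
rewrite expr2; nra.
Qed.

Hypothesis ad : adapted_dot G ip.
Variables (Omega : set V) (u : V -> R) (d : V -> V -> R).
Local Notation subdiff := (h_subdifferential G ip Omega u).
Local Notation reachable := (h_reachable_gradient G ip d Omega u).
Hypothesis dH : homogeneous_distance G d.
Hypothesis uconv : h_convex G Omega u.
Hypothesis ucont : forall x0 e, Omega x0 -> 0 < e -> exists2 r, 0 < r &
  forall y, `|y - x0| <= r -> Omega y /\ `|u y - u x0| <= e.
Hypothesis ulip : forall x0, Omega x0 -> exists2 r, 0 < r & exists2 L, 0 < L &
  forall y h, `|y - x0| <= r -> h \in H1 -> `|h| <= r ->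
    Omega (y ** h) /\ `|u (y ** h) - u y| <= L * `|h|.

Lemma reachable_sub_subdiff x : Omega x -> reachable x `<=` subdiff x.
Proof.
move=> Ox p [pH [x_ [p_ [xO xx grad pp]]]].
apply: (subdiff_closed uconv ucont ulip Ox) => e e0.
have near_le (v_ : nat -> V) (v : V) : v_ @ \oo --> v -> \forall k \near \oo, `|v_ k - v| <= e.
  by move=> /cvgrPdist_le /(_ e e0); apply: filterS => k; rewrite distrC.
have [k _ kP] := filterI (near_le _ _ xx) (near_le _ _ pp).
have [h1 h2] := kP k (leqnn k).
by exists (x_ k), (p_ k); split=> //; exact: (gradient_is_subgradient uconv dH (grad k)).
Qed.

Lemma reachableP x p : p \in H1 -> (forall e, 0 < e -> exists y q,
   [/\ Omega y, `|y - x| <= e, `|q - p| <= e & is_h_gradient G ip d u y q]) -> reachable x p.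
Proof.
move=> pH lim; split=> //.
have lim' (k : nat) : exists yq : V * V, [/\ Omega yq.1, `|yq.1 - x| <= k.+1%:R^-1,
    `|yq.2 - p| <= k.+1%:R^-1 & is_h_gradient G ip d u yq.1 yq.2].
  have [|y [q h]] := lim k.+1%:R^-1; first by rewrite invr_gt0 ltr0n.
  by exists (y, q).
pose f k := projT1 (cid (lim' k)).
have fP k : [/\ Omega (f k).1, `|(f k).1 - x| <= k.+1%:R^-1,
    `|(f k).2 - p| <= k.+1%:R^-1 & is_h_gradient G ip d u (f k).1 (f k).2].
  by rewrite /f; case: cid.
have cv (v_ : nat -> V) (v : V) : (forall k, `|v_ k - v| <= k.+1%:R^-1) -> v_ @ \oo --> v.
  move=> vP; apply/cvgrPdist_le => e e0; exists (Num.bound e^-1) => //= k /= ek.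
  rewrite distrC (le_trans (vP k)) // -[leRHS]invrK lef_pV2 ?posrE ?invr_gt0 ?ltr0n //.
  apply: (le_trans (ltW (archi_boundP _))); first by rewrite invr_ge0 ltW.
  by rewrite ler_nat leqW.
exists (fun k => (f k).1), (fun k => (f k).2); split=> [k| |k|].
- by have [] := fP k.
- by apply: cv => k; have [] := fP k.
- by have [] := fP k.
- by apply: cv => k; have [] := fP k.
Qed.

(** [u] grows at least at the rate [ip p h] from [x] to [x (t h)]; by convexity the
    derivative in the direction [h] at the points of differentiability near
    [x (t h)] is at least this rate, up to a small error. *)
Lemma reachable_support x p h : Omega x -> subdiff x p -> h \in H1 ->
  exists2 q, reachable x q & ip p h <= ip q h.
Proof.
move=> Ox px hH.
have [r0 r00 [B B0 BP]] := subdiff_bounded ip ulip Ox.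
have [r1 r10 [L L0 LP]] := subdiff_near ip ulip Ox.
have [K K0 KP] := ip_bound ip.
pose P e q := ip p h - e <= ip q h /\
  exists y, [/\ Omega y, `|y - x| <= e & is_h_gradient G ip d u y q].
have [||q0 q0B q0P] := @compact_extract R n B P; first 1 last.
- move=> e e' q [qh [y [Oy ye grad]]] ee'; split; first by lra.
  by exists y; split=> //; exact: le_trans ee'.
- have q0H : q0 \in H1.
    apply: layer1_closed => e e0; have [q qq [_ [y [_ _ [qH _]]]]] := q0P e e0.
    by exists q.
  exists q0.
    apply: reachableP => // e e0; have [q qq [_ [y [Oy ye grad]]]] := q0P e e0.
    by exists y, q.
  apply/ler_addgt0Pr => e e0.
  have e20 : 0 < e / 2 by exact: divr_gt0.
  have kh : 0 < K * (1 + `|h|) by rewrite mulr_gt0 // ltr_pwDl.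
  have m0 : 0 < Num.min (e / 2) (e / 2 / (K * (1 + `|h|))) by rewrite lt_min e20 divr_gt0.
  have [q] := q0P _ m0; rewrite le_min => /andP[_ qq] [qh _].
  have {}qh : ip p h - e / 2 <= ip q h.
    by apply: le_trans qh; rewrite lerD2l lerN2 ge_min lexx.
  have : `|ip (q - q0) h| <= e / 2.
    apply: (le_trans (KP _ _)); apply: (@le_trans _ _ (K * (1 + `|h|) * `|q - q0|)).
      by rewrite mulrAC ler_wpM2r // ler_pM2l // lerDr.
    by rewrite mulrC -ler_pdivlMr.
  by rewrite ipDl ipNl ler_norml => /andP[_ h2]; lra.
move=> e e0.
pose rr := Num.min (Num.min r0 r1) e.
have rr0 : 0 < rr by rewrite !lt_min r00 r10.
have [r2 r20 r2P] := gmul_near G x (divr_gt0 rr0 (ltr0n R 2)).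
have hk : 0 < 1 + `|h| by rewrite ltr_pwDl.
pose t := Num.min r1 r2 / (1 + `|h|); have t0 : 0 < t by rewrite divr_gt0 // lt_min r10.
have thn : `|t *: h| <= r1 /\ `|t *: h| <= r2.
  have h1 : `|t *: h| <= Num.min r1 r2.
    rewrite normrZ gtr0_norm // (le_trans (_ : _ <= t * (1 + `|h|))) ?ler_pM2l ?lerDr //.
    by rewrite /t divfK // lt0r_neq0.
  by move: h1; rewrite le_min => /andP[].
have [th1 th2] := thn; have thH : t *: h \in H1 by exact: memvZ.
have x0x : `|x - x| <= r1 by rewrite subrr normr0 ltW.
have [Oz _ sub] := LP x (t *: h) x0x thH th1; have {}sub := sub p px.
set z0 := x ** (t *: h) in Oz sub.
have z0x : `|z0 - x| <= rr / 2 by apply: r2P => //; rewrite subrr normr0 ltW.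
have te0 : 0 < e * t / 2 by rewrite divr_gt0 // mulr_gt0.
have [s1 s10 s1P] := ucont Oz te0.
have [s2 s20 s2P] := ucont Ox te0.
have zx : z0 ** - (t *: h) = x by rewrite gmulK.
have M0 : 0 < `|z0| + 1 + `|t *: h| by rewrite ltr_pwDl // ltr_wpDl.
have [C C0 CP] := gmul_lipschitz G M0.
pose s := Num.min (Num.min 1 s1) (Num.min (s2 / C) (rr / 2)).
have s0 : 0 < s by rewrite !lt_min ltr01 s10 !divr_gt0.
have [z [Oz' zz0] [q grad]] := gradient_dense ad uconv ucont ulip dH Oz s0.
move: zz0; rewrite !le_min => /andP[/andP[zz1 zs1] /andP[zs2 zr]].
have zx' : `|z - x| <= rr.
  rewrite -(subrK z0 z) -addrA (le_trans (ler_normD _ _)) //; lra.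
have [/andP[zr0 zr1] ze] : (`|z - x| <= r0) && (`|z - x| <= r1) /\ `|z - x| <= e.
  by move: zx'; rewrite !le_min => /andP[-> ->].
have qz := gradient_is_subgradient uconv dH grad.
exists q; first exact: BP qz.
split; last by exists z.
have thN : `|- (t *: h)| <= r1 by rewrite normrN.
have thNH : - (t *: h) \in H1 by rewrite rpredN.
have [_ _ subq] := LP z _ zr1 thNH thN; have {}subq := subq q qz.
have [_ u1] := s1P z zs1.
have [|_ u2] := s2P (z ** - (t *: h)).
  rewrite -zx; apply: (le_trans (CP _ _ _ _ _ _ _ _)).
  - rewrite -(subrK z0 z) (le_trans (ler_normD _ _)) // addrC -addrA lerD2l.
    by rewrite (le_trans zz1) // lerDl.
  - by rewrite normrN lerDr addr_ge0.
  - by rewrite -addrA lerDl addr_ge0.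
  - by rewrite normrN lerDr addr_ge0.
  by rewrite subrr normr0 addr0 mulrC -ler_pdivlMr.
move: u1 u2; rewrite !ler_norml => /andP[a1 a2] /andP[a3 a4].
rewrite ipNr !ipZr in subq; rewrite ipZr in sub.
rewrite -(ler_pM2l t0); clear -a1 a2 a3 a4 subq sub; lra.
Qed.

Lemma convex_setP (K : set V) : @convex_set R V K <->
  forall a b t, K a -> K b -> 0 <= t <= 1 -> K (t *: a + (1 - t) *: b).
Proof.
split=> [cK a b t Ka Kb t01|cK a b t].
  have := cK a b (Itv01 (proj1 (andP t01)) (proj2 (andP t01))).
  by rewrite !inE => /(_ Ka Kb).
rewrite !inE => Ka Kb; apply: cK => //.
by apply/andP; split.
Qed.

Lemma subdiff_convex x a b t : subdiff x a -> subdiff x b -> 0 <= t <= 1 ->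
  subdiff x (t *: a + (1 - t) *: b).
Proof.
move=> [aH aP] [bH bP] /andP[t0 t1]; split; first by rewrite memvD // memvZ.
move=> h hH hO; have h1 := aP h hH hO; have h2 := bP h hH hO.
rewrite ipDl !ipZl.
have : t * (u x + ip a h) <= t * u (x ** h) by rewrite ler_wpM2l.
have : (1 - t) * (u x + ip b h) <= (1 - t) * u (x ** h) by rewrite ler_wpM2l // subr_ge0.
lra.
Qed.

Lemma closed_convex_hull_reachable x : Omega x ->
  closed_convex_hull (reachable x) = subdiff x.
Proof.
move=> Ox; apply/seteqP; split=> [p clp|p px].
  apply: (subdiff_closed uconv ucont ulip Ox) => e e0.
  have [q [qK qp]] := clp _ (nbhsx_ballx p e e0).
  exists x, q; split; first by rewrite subrr normr0 ltW.
    by move: qp; rewrite -ball_normE /= distrC => /ltW.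
  apply: qK; split; last exact: reachable_sub_subdiff.
  by apply/convex_setP => a b t; exact: subdiff_convex.
apply: contrapT => pK; set K := closed_convex_hull _ in pK.
have subK : reachable x `<=` K.
  by move=> q qx; apply: subset_closure => M [_ /(_ q qx)].
have hullP : forall a b t, smallest (@convex_set R V) (reachable x) a ->
  smallest (@convex_set R V) (reachable x) b -> 0 <= t <= 1 ->
  smallest (@convex_set R V) (reachable x) (t *: a + (1 - t) *: b).
  move=> a b t ha hb t01 M MP; have [/convex_setP cM _] := MP.
  by apply: cM => //; [exact: ha | exact: hb].
have [|||q Kq qP] := @separation K p _ _ _ pK.
- exact: closed_closure.
- by have [q qx _] := reachable_support Ox px (mem0v _); exists q; exact: subK.
- move=> a b t Ka Kb t01 W /nbhs_ballP[e /= e0 eW].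
  have [a' [a'K aa']] := Ka _ (nbhsx_ballx a e e0).
  have [b' [b'K bb']] := Kb _ (nbhsx_ballx b e e0).
  exists (t *: a' + (1 - t) *: b'); split; first exact: hullP.
  apply: eW; move: aa' bb' t01; rewrite -!ball_normE /= => aa' bb' /andP[t0 t1].
  have -> : t *: a + (1 - t) *: b - (t *: a' + (1 - t) *: b') = t *: (a - a') + (1 - t) *: (b - b').
    by apply/rowP => i; rewrite !mxE; ring.
  apply: (le_lt_trans (ler_normD _ _)); rewrite !normrZ (ger0_norm t0) ger0_norm ?subr_ge0 //.
  have [->|tn0] := eqVneq t 0; first by rewrite mul0r subr0 mul1r add0r.
  have tp : 0 < t by rewrite lt_neqAle eq_sym tn0.
  have : t * `|a - a'| < t * e by rewrite ltr_pM2l.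
  have : (1 - t) * `|b - b'| <= (1 - t) * e by rewrite ler_wpM2l ?subr_ge0 // ltW.
  lra.
have KH k : K k -> k \in H1.
  move=> Kk; apply: layer1_closed => e e0.
  have [k' [k'K kk']] := Kk _ (nbhsx_ballx k e e0); exists k'; last first.
    by move: kk'; rewrite -ball_normE /= distrC => /ltW.
  have : subdiff x k'.
    apply: k'K; split; last exact: reachable_sub_subdiff.
    by apply/convex_setP => a b t; exact: subdiff_convex.
  by case.
have hH : p - q \in H1 by apply: rpredB; [exact: px.1 | exact: KH].
have [k kx kp] := reachable_support Ox px hH.
have := qP k (subK _ kx); rewrite ipDl ipNl => h1.
have h2 : ip (p - q) (p - q) <= 0 by rewrite ipDl ipNl; lra.
have : p - q = 0 by apply: (ip_eq0 (ip := ip)); apply/eqP; rewrite eq_le h2 ip_ge0.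
by move/eqP; rewrite subr_eq0 => /eqP pq; apply: pK; rewrite pq.
Qed.

End Reachable.

Theorem theorem1p2 (R : realType) (n : nat) (G : stratifiedGroup R n)
    (ip : {dot 'rV[R]_n for idfun}) (d : 'rV[R]_n -> 'rV[R]_n -> R)
    (Omega : set 'rV[R]_n) (u : 'rV[R]_n -> R) :
  adapted_dot G ip ->
  homogeneous_distance G d ->
  open Omega ->
  lebesgue_measurable_fun Omega u ->
  h_convex G Omega u ->
  forall x : 'rV[R]_n, Omega x ->
    closed_convex_hull (h_reachable_gradient G ip d Omega u x)
      = h_subdifferential G ip Omega u x.
Proof.
move=> ad dH oO mu_u uconv x Ox.
have ubound := locally_bounded_above uconv oO mu_u.
apply: closed_convex_hull_reachable => //.
- by move=> x0 e Ox0 e0; exact: (h_convex_continuous uconv oO ubound).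
- by move=> x0; exact: (horizontal_lipschitz uconv oO ubound).
Qed.
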